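(* Let $m\ge1$ be an integer, let $p_i(\cdot)\in LH\cap\mathcal P$ for $i=1,\dots,m$, put $\frac1{p(\cdot)}=\sum_{i=1}^m\frac1{p_i(\cdot)}$, let $\alpha$ be a constant and $q(\cdot)\in\mathcal P_0$ an exponent with $\frac{\alpha}{n}=\frac1{p(\cdot)}-\frac1{q(\cdot)}\in(0,m)$, and let $\vec\omega=(\omega_1,\dots,\omega_m)$ be a multiple weight with $\omega:=\prod_{i=1}^m\omega_i$. Let $\mathscr T_\alpha$ be either the multilinear fractional maximal operator $\mathscr M_\alpha$ or the multilinear fractional integral operator $\mathscr I_\alpha$. Then $\mathscr T_\alpha$ is bounded from $L^{p_1(\cdot)}(\omega_1)\times\cdots\times L^{p_m(\cdot)}(\omega_m)$ to $L^{q(\cdot)}(\omega)$ if and only if $\vec\omega\in A_{\vec p(\cdot),q(\cdot)}$.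
   Context: Exponents: for a measurable $p:\mathbb R^n\to(0,\infty)$ put $p_-=\operatorname{ess\,inf}p$, $p_+=\operatorname{ess\,sup}p$. $\mathcal P$ is the set of measurable $p(\cdot)$ with $1<p_-\le p_+<\infty$; $\mathcal P_0$ the set of measurable $p(\cdot)$ with $0<p_-\le p_+<\infty$. The conjugate exponent is $p'(\cdot)=p(\cdot)/(p(\cdot)-1)$. $p(\cdot)\in LH$ (globally log-Hölder continuous) means there are $C>0$ and $p_\infty>0$ with $|p(x)-p(y)|\le\frac{C}{-\log|x-y|}$ whenever $|x-y|<\frac12$, and $|p(x)-p_\infty|\le\frac{C}{\log(e+|x|)}$ for all $x\in\mathbb R^n$. Spaces: for $p(\cdot)\in\mathcal P_0$, $\|f\|_{L^{p(\cdot)}}=\inf\{\lambda>0:\int_{\mathbb R^n}(|f(x)|/\lambda)^{p(x)}dx\le1\}$, and $\|f\|_{L^{p(\cdot)}(\omega)}=\|\omega f\|_{L^{p(\cdot)}}$. A weight is a locally integrable $\omega:\mathbb R^n\to[0,\infty]$ with $0<\omega<\infty$ a.e.; a multiple weight is an $m$-tuple of weights. $\vec\omega\in A_{\vec p(\cdot),q(\cdot)}$ means $$[\vec\omega]_{A_{\vec p(\cdot),q(\cdot)}}:=\sup_{B\subseteq\mathbb R^n}|B|^{\frac{\alpha}{n}-m}\|\omega\chi_B\|_{L^{q(\cdot)}}\prod_{i=1}^m\|\omega_i^{-1}\chi_B\|_{L^{p_i'(\cdot)}}<\infty,$$ the supremum being over all balls $B$. Operators, for $0<\alpha<mn$ and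 $\vec f=(f_1,\dots,f_m)$: $$\mathscr M_\alpha(\vec f)(x)=\sup_{r>0}\frac1{|B(x,r)|^{m-\frac{\alpha}{n}}}\prod_{i=1}^m\int_{B(x,r)}|f_i(y_i)|\,dy_i,$$ $$\mathscr I_\alpha(\vec f)(x)=\int_{(\mathbb R^n)^m}\frac{f_1(y_1)\cdots f_m(y_m)}{(|x-y_1|+\cdots+|x-y_m|)^{mn-\alpha}}\,dy_1\cdots dy_m.$$ Bounded means: there is $C$ with $\|\mathscr T_\alpha(\vec f)\|_{L^{q(\cdot)}(\omega)}\le C\prod_{i=1}^m\|f_i\|_{L^{p_i(\cdot)}(\omega_i)}$ for all $f_i\in L^{p_i(\cdot)}(\omega_i)$. *)

(* Defs.v *)
From HB Require Import structures.
From mathcomp Require Import all_boot all_order all_algebra.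
From mathcomp Require Import all_classical all_reals all_analysis.
From mathcomp Require Import measurable_realfun ess_sup_inf.

Set Implicit Arguments.
Unset Strict Implicit.
Unset Printing Implicit Defensive.

Import Order.TTheory GRing.Theory Num.Theory.
Import numFieldNormedType.Exports.

Local Open Scope classical_set_scope.
Local Open Scope ring_scope.

(* The library equips [k.-tuple T] with the product sigma-algebra but only
   provides binary products of measures; [tuple_measure mu k] is the k-fold
   product of [mu], characterized by its values on boxes in [tuple_measureX]. *)

Definition tcons (T : Type) k (xt : T * k.-tuple T) : k.+1.-tuple T :=
  [tuple of xt.1 :: xt.2].

Lemma measurable_tcons d (T : measurableType d) k :
  measurable_fun [set: T * k.-tuple T] (@tcons T k).
Proof. exact: measurable_cons. Qed.

Definition cons_measure d (T : measurableType d) (R : realType) k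
    (mu : {sigma_finite_measure set T -> \bar R})
    (nu : {sigma_finite_measure set (k.-tuple T) -> \bar R}) :
    set (k.+1.-tuple T) -> \bar R :=
  pushforward (mu \x nu)%E (@tcons T k).

Section cons_measure_theory.
Context d (T : measurableType d) (R : realType) (k : nat).
Context (mu : {sigma_finite_measure set T -> \bar R}).
Context (nu : {sigma_finite_measure set (k.-tuple T) -> \bar R}).
Local Open Scope ereal_scope.

Let cmu := cons_measure mu nu.

Let mcons A : measurable A -> measurable (@tcons T k @^-1` A).
Proof. by move=> mA; rewrite -[X in measurable X]setTI; exact: measurable_tcons. Qed.

Let cmu0 : cmu set0 = 0.
Proof. by rewrite /cmu /cons_measure /pushforward preimage_set0 measure0. Qed.

Let cmu_ge0 A : 0 <= cmu A. Proof. exact: (measure_ge0 (mu \x nu)). Qed.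

Let cmu_additive : semi_sigma_additive cmu.
Proof.
move=> F mF tF mUF; rewrite /cmu /cons_measure /pushforward preimage_bigcup.
apply: measure_semi_sigma_additive.
- by move=> i; exact: mcons.
- apply/trivIsetP => /= i j _ _ ij; rewrite -preimage_setI.
  by move/trivIsetP : tF => /(_ _ _ _ _ ij) ->//; rewrite preimage_set0.
- by rewrite -preimage_bigcup; exact: mcons.
Qed.

HB.instance Definition _ := isMeasure.Build _ _ _ (cons_measure mu nu)
  cmu0 cmu_ge0 cmu_additive.

Let uncons (t : k.+1.-tuple T) : T * k.-tuple T := (thead t, [tuple of behead t]).

Let unconsK : cancel (@tcons T k) uncons.
Proof. by case=> x t; rewrite /uncons; congr pair; apply/val_inj. Qed.

Let muncons A : measurable A -> measurable (uncons @^-1` A).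
Proof.
move=> mA; rewrite -[X in measurable X]setTI.
apply: (measurable_fun_pair (measurable_tnth ord0) (@measurable_behead _ T k)) => //.
Qed.

Let cmu_sigma_finite : sigma_finite setT cmu.
Proof.
have /sigma_finiteP[F [TF ndF Foo]] := sigma_finiteT mu.
have /sigma_finiteP[G [TG ndG Goo]] := sigma_finiteT nu.
exists (fun i => uncons @^-1` (F i `*` G i)).
  apply/esym; rewrite -subTset => t _.
  have [i _ Fi] : (\bigcup_i F i) (uncons t).1 by rewrite -TF.
  have [j _ Gj] : (\bigcup_j G j) (uncons t).2 by rewrite -TG.
  exists (maxn i j) => //; split.
  - by move: Fi; exact/subsetPset/ndF/leq_maxl.
  - by move: Gj; exact/subsetPset/ndG/leq_maxr.
move=> i; have [mF Fi] := Foo i; have [mG Gi] := Goo i.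
split; first by apply: muncons; exact: measurableX.
rewrite /cmu /cons_measure /pushforward -comp_preimage.
rewrite (_ : uncons \o _ = id); last by apply/funext => z; exact: unconsK.
by rewrite preimage_id product_measure1E// lte_mul_pinfty// ge0_fin_numE.
Qed.

HB.instance Definition _ := Measure_isSigmaFinite.Build _ _ _
  (cons_measure mu nu) cmu_sigma_finite.

End cons_measure_theory.

Fixpoint tuple_measure d (T : measurableType d) (R : realType)
    (mu : {sigma_finite_measure set T -> \bar R}) (k : nat) :
    {sigma_finite_measure set (k.-tuple T) -> \bar R} :=
  match k with
  | 0 => dirac ([tuple] : 0.-tuple T)
  | k'.+1 => cons_measure mu (tuple_measure mu k')
  end.

Lemma tuple_measureX d (T : measurableType d) (R : realType)
    (mu : {sigma_finite_measure set T -> \bar R}) k (A : 'I_k -> set T) :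
  (forall i, measurable (A i)) ->
  tuple_measure mu k [set t | forall i, A i (tnth t i)] =
    (\prod_(i < k) mu (A i))%E.
Proof.
elim: k A => [|k IHk] A mA.
  by rewrite big_ord0 /= diracE mem_set// => -[].
rewrite big_ord_recl /= -IHk // -product_measure1E //; last first.
  rewrite (_ : [set _ | _] = \bigcap_(i in [set: 'I_k])
      ((@tnth _ T ^~ i) @^-1` A (lift ord0 i))); last first.
    by apply/seteqP; split=> [t tA i _|t tA i]; exact: tA.
  apply: fin_bigcap_measurable => // i _; rewrite -[X in measurable X]setTI.
  exact: measurable_tnth.
rewrite /cons_measure /pushforward; congr product_measure1.
apply/seteqP; split=> [[x t] /= tA|[x t] /= [xA tA] i].
  split=> [|i]; first by have := tA ord0; rewrite /tcons tnth0.
  by have := tA (lift ord0 i); rewrite /tcons /= tnthS.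
by case: (unliftP ord0 i) => [j|] ->; rewrite /tcons ?tnthS ?tnth0.
Qed.

(* [n.-tuple] carries no vector-space or metric structure, and the norm that
   ['rV_n] has in the library is the sup norm, hence the explicit Euclidean
   distance below. *)
Notation "''Eucl_' ( n , R )" := (n.-tuple (measurableTypeR R))
  (format "''Eucl_' ( n ,  R )") : type_scope.

Definition eucl_norm (R : realType) n (x : 'Eucl_(n, R)) : R :=
  Num.sqrt (\sum_(i < n) (tnth x i : R) ^+ 2).

Definition eucl_dist (R : realType) n (x y : 'Eucl_(n, R)) : R :=
  Num.sqrt (\sum_(i < n) ((tnth x i : R) - (tnth y i : R)) ^+ 2).

Definition eucl_ball (R : realType) n (x : 'Eucl_(n, R)) (r : R) :
    set 'Eucl_(n, R) :=
  [set y | eucl_dist x y < r].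

Definition leb (R : realType) n :
    {sigma_finite_measure set 'Eucl_(n, R) -> \bar R} :=
  tuple_measure (@lebesgue_measure R) n.

(* The sigma-algebra on ['Eucl_(n, R)] is the Borel one. Measurability below is
   Lebesgue measurability: preimages belong to the completion of the Borel sets.
   [\int[leb R n]] is a supremum over Borel simple functions (for the positive
   and negative parts), so on such functions it is the Lebesgue integral. *)
Definition leb_measurable_fun (R : realType) n d (T : measurableType d)
    (f : 'Eucl_(n, R) -> T) : Prop :=
  forall Y : set T, measurable Y -> completed_algebra_gen (leb R n) (f @^-1` Y).

Definition P0_exponent (R : realType) n (p : 'Eucl_(n, R) -> R) : Prop :=
  [/\ leb_measurable_fun (p : _ -> measurableTypeR R),
      forall x, 0 < p x,
      (0 < ess_inf (leb R n) (EFin \o p))%E &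
      (ess_sup (leb R n) (EFin \o p) < +oo)%E].

Definition P_exponent (R : realType) n (p : 'Eucl_(n, R) -> R) : Prop :=
  [/\ leb_measurable_fun (p : _ -> measurableTypeR R),
      forall x, 0 < p x,
      (1 < ess_inf (leb R n) (EFin \o p))%E &
      (ess_sup (leb R n) (EFin \o p) < +oo)%E].

Definition conj_exponent (R : realType) n (p : 'Eucl_(n, R) -> R) :
    'Eucl_(n, R) -> R :=
  fun x => p x / (p x - 1).

(* At x = y the first bound reads 0 <= 0, since [ln 0 = 0] and [0^-1 = 0]. *)
Definition log_holder (R : realType) n (p : 'Eucl_(n, R) -> R) : Prop :=
  exists C pinfty : R,
    [/\ 0 < C, 0 < pinfty,
        forall x y, eucl_dist x y < 2^-1 ->
          `|p x - p y| <= C / (- ln (eucl_dist x y)) &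
        forall x, `|p x - pinfty| <= C / ln (expR 1 + eucl_norm x)].

Definition var_norm (R : realType) n (p : 'Eucl_(n, R) -> R)
    (f : 'Eucl_(n, R) -> \bar R) : \bar R :=
  ereal_inf [set l%:E | l in
    [set l : R | 0 < l /\
      (\int[leb R n]_x ((`|f x| / l%:E) `^ p x) <= 1)%E]].

Definition wvar_norm (R : realType) n (p : 'Eucl_(n, R) -> R)
    (w f : 'Eucl_(n, R) -> \bar R) : \bar R :=
  var_norm p (fun x => w x * f x)%E.

Definition wvar_space (R : realType) n (p : 'Eucl_(n, R) -> R)
    (w : 'Eucl_(n, R) -> \bar R) (f : 'Eucl_(n, R) -> R) : Prop :=
  leb_measurable_fun (f : _ -> measurableTypeR R) /\
  (wvar_norm p w (EFin \o f) < +oo)%E.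

Definition weight (R : realType) n (w : 'Eucl_(n, R) -> \bar R) : Prop :=
  [/\ leb_measurable_fun w,
      forall x, (0 <= w x)%E,
      forall x (r : R), 0 < r -> (\int[leb R n]_(y in eucl_ball x r) w y < +oo)%E &
      \forall x \ae leb R n, (0 < w x < +oo)%E].

Definition weight_prod (R : realType) n m (w : 'I_m -> 'Eucl_(n, R) -> \bar R) :
    'Eucl_(n, R) -> \bar R :=
  fun x => (\prod_(i < m) w i x)%E.

Definition Apq_const (R : realType) n m (alpha : R)
    (p : 'I_m -> 'Eucl_(n, R) -> R) (q : 'Eucl_(n, R) -> R)
    (w : 'I_m -> 'Eucl_(n, R) -> \bar R) : \bar R :=
  ereal_sup [set c | exists (x : 'Eucl_(n, R)) (r : R), 0 < r /\
    c = (leb R n (eucl_ball x r) `^ (alpha / n%:R - m%:R)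
      * var_norm q (fun y => weight_prod w y * (\1_(eucl_ball x r) y)%:E)
      * \prod_(i < m) var_norm (conj_exponent (p i))
          (fun y => (w i y)^-1 * (\1_(eucl_ball x r) y)%:E))%E].

Definition Apq (R : realType) n m (alpha : R)
    (p : 'I_m -> 'Eucl_(n, R) -> R) (q : 'Eucl_(n, R) -> R)
    (w : 'I_m -> 'Eucl_(n, R) -> \bar R) : Prop :=
  (Apq_const alpha p q w < +oo)%E.

Definition frac_max (R : realType) n m (alpha : R)
    (f : 'I_m -> 'Eucl_(n, R) -> R) (x : 'Eucl_(n, R)) : \bar R :=
  ereal_sup [set c | exists r : R, 0 < r /\
    c = ((leb R n (eucl_ball x r) `^ (m%:R - alpha / n%:R))^-1
      * \prod_(i < m) \int[leb R n]_(y in eucl_ball x r) `|f i y|%:E)%E].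

(* When the integral does not converge absolutely its value is -oo or +oo (in
   the library oo - oo = -oo), so a finite value of [|frac_int alpha f x|] means
   that the integral defining it converges absolutely. *)
Definition frac_int (R : realType) n m (alpha : R)
    (f : 'I_m -> 'Eucl_(n, R) -> R) (x : 'Eucl_(n, R)) : \bar R :=
  (\int[tuple_measure (leb R n) m]_y
    ((\prod_(i < m) f i (tnth y i)) /
     (\sum_(i < m) eucl_dist x (tnth y i)) `^ (m%:R * n%:R - alpha))%:E)%E.

Definition bounded_mop (R : realType) n m
    (T : ('I_m -> 'Eucl_(n, R) -> R) -> 'Eucl_(n, R) -> \bar R)
    (p : 'I_m -> 'Eucl_(n, R) -> R) (w : 'I_m -> 'Eucl_(n, R) -> \bar R)
    (q : 'Eucl_(n, R) -> R) (v : 'Eucl_(n, R) -> \bar R) : Prop :=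
  exists C : R, forall f : 'I_m -> 'Eucl_(n, R) -> R,
    (forall i, wvar_space (p i) (w i) (f i)) ->
    (wvar_norm q v (T f) <=
     C%:E * \prod_(i < m) wvar_norm (p i) (w i) (EFin \o f i))%E.

(* Main.v *)
(** Put [beta = m - alpha / n].  On dyadic cells [Q] both operators are dominated
    by [S(x) = sum_k 2^(k n beta) prod_i int_(cells near Q_k(x)) |f_i|], so with
    the [A_(p,q)] condition it is enough to bound [omega S] in [L^q].

    Let [N(Q)] be the norm on [Q] of [omega] or of one of the [1 / w_i].  The
    generalized Hölder inequality and the [A_(p,q)] condition show that a subset
    of [Q] of proportional measure carries a proportional part of each norm, hence
    [N(Q') <= kappa N(Q)] with [kappa < 1] for each dyadic child [Q'] of [Q].
    Geometric sums along the chain of cells containing a point then replace the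
    maximal function: if [c_Q] is the normalized pairing of [f_i w_i] with
    [1 / w_i] over [Q], Young's inequality bounds [sum_Q c_Q ^ t(Q)] whenever [t(Q)]
    exceeds [p_i] on [Q] by a fixed factor, and [(omega S) ^ q] is bounded by such
    a sum.  There is room for the factor because [alpha > 0] makes [q > p]
    strictly.  Log-Hölder continuity is used only to choose [t(Q)] constant on [Q],
    up to finitely many cells of one generation.

    Conversely, testing on functions supported in a ball that nearly attain the
    dual norms of the [1 / w_i] gives the [A_(p,q)] bound on that ball. *)
From HB Require Import structures.
Require Import Defs.
From mathcomp Require Import all_boot all_order all_algebra.
From mathcomp Require Import all_classical all_reals all_analysis.
From mathcomp Require Import measurable_realfun ess_sup_inf.
From mathcomp Require Import ring lra zify.
Set Implicit Arguments.
Unset Strict Implicit.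
Unset Printing Implicit Defensive.
Import Order.TTheory GRing.Theory Num.Theory.
Import numFieldNormedType.Exports.
Local Open Scope classical_set_scope.
Local Open Scope ring_scope.

(** * Countable sums *)

Section esum_extra.
Context {R : realType}.
Local Open Scope ereal_scope.

(** The exponents vary from point to point, so no embedding of fixed sequence spaces over the cells
    is available, and modulars rather than norms have to be summed. A cell average is split by
    Young's inequality at half its own value: the lower part is absorbed, and the upper part carries
    a gain $\min(u,1/u)^e$, where $u$ compares the two sides of Young's inequality. This gain makes
    the sum over all generations converge at each single point, with no selection of stopping cells;
    its price is the passage from $p_i$ to the larger exponent $t$. The weights $\omega$ and
    $1/\omega_i$ enter symmetrically, as $m+1$ functions with product $1$ whose exponents have
    reciprocals adding up to $\beta$. One Hölder inequality therefore yields the decay of all the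
    norms at once, also when $q$ takes values below $1$. The data are only Lebesgue measurable, and
    measurability of $\mathscr T_\alpha(\vec f)$ is never established. Hence the work takes place on
    a conull Borel set [D], and integrals of arbitrary nonnegative functions are compared by
    monotonicity alone. *)

Lemma esum_countE (I : countType) (a : I -> \bar R) :
  (forall i, 0 <= a i) ->
  \esum_(i in [set: I]) a i = \sum_(n <oo) oapp a 0 (pickle_inv n).
Proof.
move=> a0; rewrite nneseries_esumT; last by move=> n; case: pickle_inv => /=.
have -> : \esum_(n in [set: nat]) oapp a 0 (pickle_inv n) =
    \esum_(n in range (@pickle I)) oapp a 0 (pickle_inv n).
  rewrite esum_mkcond [RHS]esum_mkcond; apply: eq_esum => n _.
  rewrite in_setT; case: ifPn => //; rewrite notin_setE => /= nr.
  have := @pickle_invK I n; case: pickle_inv => //= i ni.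
  by exfalso; apply: nr; exists i.
rewrite (@reindex_esum R _ _ [set: I] (range (@pickle I)) pickle).
  by apply: eq_esum => i _; rewrite pickleK_inv.
by apply: inj_bij => x y _ _; exact: (pcan_inj pickleK).
Qed.

Lemma esumZ (I : countType) (c : R) (a : I -> \bar R) : (0 <= c)%R ->
  (forall i, 0 <= a i) ->
  \esum_(i in [set: I]) (c%:E * a i) = c%:E * \esum_(i in [set: I]) a i.
Proof.
move=> c0 a0; rewrite !esum_countE//; last by move=> i; rewrite mule_ge0.
rewrite -nneseriesZl//; last by move=> n _; case: pickle_inv => /=.
by apply: eq_eseriesr => n _; case: pickle_inv => //=; rewrite mule0.
Qed.

Lemma integral_esum d (T : measurableType d) (mu : {measure set T -> \bar R})
    (D : set T) (I : countType) (f : I -> T -> \bar R) :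
  measurable D -> (forall i, measurable_fun D (f i)) ->
  (forall i x, 0 <= f i x) ->
  \int[mu]_(x in D) (\esum_(i in [set: I]) f i x) =
  \esum_(i in [set: I]) \int[mu]_(x in D) f i x.
Proof.
move=> mD mf f0; rewrite esum_countE; last by move=> i; exact: integral_ge0.
under eq_integral do rewrite esum_countE//.
rewrite integral_nneseries//.
- apply: eq_eseriesr => n _; case: pickle_inv => //=.
  by rewrite integral0.
- by move=> n; case: pickle_inv.
- by move=> n x _; case: pickle_inv => /=.
Qed.

Lemma esum_ge1 (I : choiceType) (a : I -> \bar R) i :
  (forall i, 0 <= a i) -> a i <= \esum_(i in [set: I]) a i.
Proof.
move=> a0; rewrite -(esum_set1 (a0 i)) esum_mkcond.
apply: le_esum => j _; case: ifPn => //.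
Qed.

Lemma nneseries_telescope_le (a : nat -> R) (s : nat -> R) (B : R) :
  (forall n, 0 <= a n)%R -> (forall n, a n <= s n.+1 - s n)%R ->
  (forall n, 0 <= s n <= B)%R -> \sum_(n <oo) (a n)%:E <= B%:E.
Proof.
move=> a0 as_ sB; apply: lime_le.
  by apply: is_cvg_nneseries => n _ _; rewrite lee_fin.
near=> n; rewrite sumEFin lee_fin.
apply: (@le_trans _ _ (s n - s 0))%R; last by have := sB n; have := sB 0%N; lra.
rewrite -(telescope_sumr s (leq0n n)).
by apply: ler_sum => i _.
Unshelve. all: by end_near. Qed.

Lemma esum_intE (a : int -> \bar R) : (forall i, 0 <= a i) ->
  \esum_(i in [set: int]) a i =
  \sum_(n <oo) a (Posz n) + \sum_(n <oo) a (Negz n).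
Proof.
move=> a0; rewrite (esumID (range Posz))// !setTI !nneseries_esumT//.
congr (_ + _).
  by rewrite (@reindex_esum R _ _ [set: nat] (range Posz) Posz)//; apply: inj_bij => x y _ _ [].
rewrite (@reindex_esum R _ _ [set: nat] (~` range Posz) Negz)//.
split => [x _ /= [y _]//|x y _ _ []//|].
move=> [n|n] /= h; first by exfalso; apply: h; exists n.
by exists n.
Qed.

(** The drops of [s] to the right of [0] and those to its left each add up to at most [B]. *)
Lemma esum_int_telescope (a s : int -> R) (B : R) :
  (forall k, 0 <= a k)%R -> (forall k, a k <= s k - s (k + 1))%R ->
  (forall k, 0 <= s k <= B)%R ->
  \esum_(k in [set: int]) (a k)%:E <= (B + B)%:E.
Proof.
move=> a0 as_ sB; rewrite esum_intE; last by move=> i; rewrite lee_fin.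
rewrite EFinD leeD//.
  apply: (@nneseries_telescope_le _ (fun n => B - s (Posz n)))%R => // n.
    by have := as_ (Posz n); rewrite (_ : (Posz n + 1)%R = Posz n.+1); [lra|lia].
  by have := sB (Posz n); lra.
apply: (@nneseries_telescope_le _ (fun n => s (- Posz n)))%R => // n.
have := as_ (Negz n); rewrite (_ : (Negz n + 1)%R = (- Posz n)%R); last by rewrite NegzE; lia.
by rewrite NegzE.
Qed.

(** The function equal to $a$ for $a\le1$ and to $2-1/a$ beyond is increasing with values in
    $(0,2)$, and it drops by at least $(1-g)\min(a,1/a)$ from $a$ to any $b\le ga$. It serves as a
    bounded potential: sums telescope without locating the index at which a sequence crosses $1$. *)
Lemma geometric_potential (a b g : R) : (0 < g < 1)%R -> (0 < a)%R -> (0 < b)%R ->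
  (b <= g * a)%R ->
  (Num.min a a^-1 <= (if a <= 1 then a else 2 - a^-1) / (1 - g) -
                     (if b <= 1 then b else 2 - b^-1) / (1 - g))%R.
Proof.
move=> k1 a0 b0 ba.
rewrite -mulrBl ler_pdivlMr; last lra.
have aV : (a * a^-1 = 1)%R by rewrite mulfV ?gt_eqF.
have bV : (b * b^-1 = 1)%R by rewrite mulfV ?gt_eqF.
have aV0 : (0 < a^-1)%R by rewrite invr_gt0.
have bV0 : (0 < b^-1)%R by rewrite invr_gt0.
have m1 : (Num.min a a^-1 <= a)%R by rewrite ge_min lexx.
have m2 : (Num.min a a^-1 <= a^-1)%R by rewrite ge_min lexx orbT.
move: (Num.min a a^-1)%R m1 m2 => mn m1 m2.
have n1 : (mn * (1 - g) <= a * (1 - g))%R by rewrite ler_wpM2r//; lra.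
have n2 : (mn * (1 - g) <= a^-1 * (1 - g))%R by rewrite ler_wpM2r//; lra.
case: (lerP a 1) => a1.
  have ga : (g * a < 1 * a)%R by rewrite ltr_pM2r//; lra.
  by rewrite ifT; lra.
case: (lerP b 1) => b1.
  suff : (a^-1 * (1 - g) <= 2 - a^-1 - b)%R by lra.
  rewrite -(ler_pM2l a0) mulrA aV mul1r !mulrBr aV.
  have h1 : (a * b <= a * (g * a))%R by rewrite ler_pM2l.
  have h2 : (a * b <= a * 1)%R by rewrite ler_pM2l.
  have : (g * a <= 1)%R \/ (1 < g * a)%R by lra.
  case=> h; last by nra.
  have : (0 <= (a - 1) * (1 - g * a))%R by rewrite mulr_ge0//; lra.
  have : (0 <= (a - 1) * (1 - g))%R by rewrite mulr_ge0//; lra.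
  nra.
suff : (a^-1 * (1 - g) <= b^-1 - a^-1)%R by lra.
have bga : (a^-1 <= g * b^-1)%R.
  by rewrite -(ler_pM2l a0) aV -(ler_pM2r b0) mul1r -!mulrA mulVf ?gt_eqF// mulr1 mulrC.
have : (g * b^-1 <= 1 * b^-1)%R by rewrite ler_pM2r//; lra.
have : (g * (g * b^-1) <= g * b^-1)%R by rewrite ger_pMl ?mulr_gt0//; lra.
have : (g * a^-1 <= g * (g * b^-1))%R by rewrite ler_pM2l//; lra.
nra.
Qed.

(** The terms decay geometrically on both sides of the place where [u] crosses [1]. The potential is
    at most $2$ and is spent on both half-lines, hence the $4$. The bound does not depend on [u], so
    it may be applied at every point [x], along the chain of cells containing [x], and then
    integrated. *)
Lemma esum_geometric (u : int -> R) (kappa e : R) :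
  (forall k, 0 < u k)%R -> (forall k, u (k + 1) <= kappa * u k)%R ->
  (0 < kappa < 1)%R -> (0 < e)%R ->
  \esum_(k in [set: int]) (Num.min (u k) (u k)^-1 `^ e)%:E
    <= (4 / (1 - kappa `^ e))%:E.
Proof.
move=> u0 uk kap e0.
have k1 : (0 < kappa `^ e < 1)%R.
  rewrite powR_gt0 /=; last lra.
  have : (kappa `^ e < 1 `^ e)%R by rewrite gt0_ltr_powR// ?nnegrE; lra.
  by rewrite powR1.
set g := (kappa `^ e)%R.
pose s k := (let a := u k `^ e in (if a <= 1 then a else 2 - a^-1) / (1 - g))%R.
apply: le_trans (_ : (2 / (1 - g) + 2 / (1 - g))%:E <= _); last first.
  by rewrite -mulrDl lee_fin ler_pM2r ?invr_gt0 /g; lra.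
apply: (@esum_int_telescope _ s).
- by move=> k; rewrite powR_ge0.
- move=> k; rewrite /s.
  have a0 : (0 < u k `^ e)%R by rewrite powR_gt0.
  have b0 : (0 < u (k + 1) `^ e)%R by rewrite powR_gt0.
  have ba : (u (k + 1) `^ e <= g * u k `^ e)%R.
    rewrite /g -powRM; [|lra|exact: ltW].
    rewrite ge0_ler_powR// ?nnegrE ?(ltW e0)// ?(ltW (u0 _))//.
    by rewrite mulr_ge0 ?(ltW (u0 _))//; lra.
  have -> : (Num.min (u k) (u k)^-1 `^ e = Num.min (u k `^ e) (u k `^ e)^-1)%R.
    have uV : ((u k)^-1 `^ e = (u k `^ e)^-1)%R.
      by rewrite -powR_inv1 ?(ltW (u0 _))// -powRrM mulN1r powRN.
    have [h|h] := leP (u k) (u k)^-1%R.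
      rewrite min_l// -uV ge0_ler_powR// ?nnegrE ?(ltW e0)// ?invr_ge0 ?(ltW (u0 _))//.
    rewrite min_r// -uV ge0_ler_powR// ?nnegrE ?(ltW e0)// ?invr_ge0 ?(ltW (u0 _))//.
    exact: ltW.
  exact: geometric_potential.
- move=> k; rewrite /s /=; have a0 : (0 < u k `^ e)%R by rewrite powR_gt0.
  rewrite -/g in k1; clear -k1 a0; move: (u k `^ e)%R a0 => a a0.
  have aV0 : (0 < a^-1)%R by rewrite invr_gt0.
  rewrite divr_ge0 /=; last lra.
    by rewrite ler_pM2r ?invr_gt0; [case: ifP => ?; lra|lra].
  case: ifPn => //; rewrite -?ltNge => ?; first lra.
  have : (a^-1 < 1)%R by rewrite invf_lt1. lra.
Qed.

End esum_extra.

(** * Integrals over cells *)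

Section integral_extra.
Context d (T : measurableType d) (R : realType) (mu : {measure set T -> \bar R}).

(* No measurability is required, unlike in [ge0_le_integral]. *)
Lemma le_integral_ge0 (D : set T) (f g : T -> \bar R) :
  (forall x, D x -> 0 <= f x)%E -> (forall x, D x -> f x <= g x)%E ->
  (\int[mu]_(x in D) f x <= \int[mu]_(x in D) g x)%E.
Proof.
move=> f0 fg; rewrite !ge0_integralE//; last first.
  by move=> x Dx; exact: le_trans (f0 x Dx) (fg x Dx).
apply: le_ereal_sup => _ [h hf <-]; exists h => // x.
apply: le_trans (hf x) _; rewrite /patch; case: ifPn => //.
by rewrite inE => /fg.
Qed.

(** Scaling the simple functions below [f] gives one inequality for every positive factor, and the
    factor [k^-1] gives the other. Among the integrands to which it is applied are powers of dyadic
    sums whose measurability is not established. *)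
Lemma integralZl_ge0 (D : set T) (k : R) (f : T -> \bar R) : 0 < k ->
  (forall x, D x -> 0 <= f x)%E ->
  (\int[mu]_(x in D) (k%:E * f x) = k%:E * \int[mu]_(x in D) f x)%E.
Proof.
have H l (h : T -> \bar R) : 0 < l -> (forall x, D x -> 0 <= h x)%E ->
    (l%:E * \int[mu]_(x in D) h x <= \int[mu]_(x in D) (l%:E * h x))%E.
  move=> l0 h0; rewrite -lee_pdivlMl// (ge0_integralE mu h0).
  apply: ge_ereal_sup => _ [s sh <-]; rewrite lee_pdivlMl//.
  rewrite -sintegralrM ge0_integralE; last first.
    by move=> x Dx; rewrite mule_ge0 ?h0// lee_fin ltW.
  pose ls : {nnsfun T >-> R} := scale_nnsfun s (ltW l0).
  apply: ereal_sup_ubound; exists ls => // x.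
  rewrite /= EFinM; apply: le_trans (lee_wpmul2l _ (sh x)) _.
    by rewrite lee_fin ltW.
  by rewrite /patch; case: ifP => //; rewrite mule0.
move=> k0 f0; apply/eqP; rewrite eq_le H// andbT.
have kV : 0 < k^-1 by rewrite invr_gt0.
have kf0 x : D x -> (0 <= k%:E * f x)%E by move=> Dx; rewrite mule_ge0 ?f0// lee_fin ltW.
rewrite -lee_pdivrMl//; apply: le_trans (H _ _ kV kf0) _.
rewrite le_eqVlt; apply/orP; left; apply/eqP; apply: eq_integral => x _.
by rewrite muleA -EFinM mulVf ?mul1e// gt_eqF.
Qed.

Lemma measurable_fun_powR2 (f r : T -> R) :
  measurable_fun setT f -> measurable_fun setT r ->
  measurable_fun setT (fun x => f x `^ r x).
Proof.
move=> mf mr; rewrite /powR; apply: measurable_fun_ifT.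
- apply: (measurable_fun_bool true) => //.
  rewrite [X in measurable X](_ : _ = setT `&` f @^-1` [set 0]); first exact: mf.
  by apply/seteqP; split => x /= [_ /eqP].
- have -> : (fun t => (r t == 0)%:R) = (\1_(r @^-1` [set 0]) : T -> R).
    apply/funext => x; rewrite indicE; congr (_%:R); congr nat_of_bool.
    by apply/eqP/idP; rewrite inE.
  apply: measurable_indic; rewrite -[X in measurable X]setTI; exact: mr.
- apply: measurableT_comp => //; apply: measurable_funM => //.
  by apply: measurableT_comp => //; exact: measurable_ln.
Qed.

Lemma measurable_funV_pos (f : T -> R) : (forall x, 0 <= f x) ->
  measurable_fun setT f -> measurable_fun setT (fun x => (f x)^-1).
Proof.
move=> f0 mf; rewrite (_ : (fun x => _) = (fun x => f x `^ (-1))); last first.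
  by apply/funext => x; rewrite powR_inv1.
exact: measurable_fun_powR2.
Qed.

End integral_extra.

Section cells.
Context d (T : measurableType d) (R : realType) (mu : {measure set T -> \bar R}).
Variables (D : set T) (J : countType) (cl : int -> T -> J).

Definition cell (a : int * J) : set T := D `&` cl a.1 @^-1` [set a.2].

Hypothesis mD : measurable D.
Hypothesis mcell : forall a, measurable (cell a).

(** In each generation the cells are the fibres of [cl k] in [D], hence a partition of [D]. Sums
    over all cells thus become integrals of sums along the chain of cells through one point. *)
Lemma esum_cells (Phi : int * J -> T -> \bar R) :
  (forall a x, 0 <= Phi a x)%E -> (forall a, measurable_fun setT (Phi a)) ->
  (\esum_(a in [set: int * J]) \int[mu]_(x in cell a) Phi a x =
   \int[mu]_(x in D) \esum_(k in [set: int]) Phi (k, cl k x) x)%E.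
Proof.
move=> P0 mP.
transitivity (\esum_(a in [set: int * J])
    \int[mu]_(x in D) (Phi a \_ (cell a)) x)%E.
  apply: eq_esum => a _; rewrite -integral_mkcondr; congr integral.
  by rewrite /cell setIA setIid.
rewrite -integral_esum//; first last.
- by move=> a x; rewrite /patch; case: ifP.
- move=> a; apply: measurable_funS (measurableT) _ _ => //.
  by apply/(measurable_restrictT _ (mcell a)); exact: measurable_funTS.
apply: eq_integral => x; rewrite inE => Dx.
rewrite [X in esum X _](_ : _ = [set: int] `*`` (fun=> [set: J])); last first.
  by apply/seteqP; split => // -[].
have eqp (i : int * J) : ([set: int] `*`` (fun=> [set: J])) i ->
    (Phi i \_ (cell i)) x = (Phi (i.1, i.2) \_ (cell (i.1, i.2))) x by case: i.
rewrite (eq_esum eqp).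
rewrite -(@esum_esum R int J [set: int] (fun=> [set: J])
  (fun k j => (Phi (k, j) \_ (cell (k, j))) x)); last first.
  by move=> k j _ _; rewrite /patch; case: ifP.
apply: eq_esum => k _; rewrite -(@esum_set1 R J (cl k x) (fun j => Phi (k, j) x))//.
rewrite [RHS]esum_mkcond; apply: eq_esum => j _; rewrite /patch.
congr (if _ then _ else _); apply/idP/idP; rewrite !inE.
  by move=> -[].
by move=> ->.
Qed.

End cells.

(** * Pointwise inequalities *)

Section pointwise.
Context {R : realType}.
Implicit Types v G p t e al F g N : R.

Lemma powR_le1 v t : 0 <= v <= 1 -> 0 <= t -> v `^ t <= 1.
Proof.
move=> /andP[v0 v1] t0; have : v `^ t <= 1 `^ t by rewrite ge0_ler_powR// nnegrE.
by rewrite powR1.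
Qed.

Lemma powR_ge1 v t : 1 <= v -> 0 <= t -> 1 <= v `^ t.
Proof. by move=> v1 t0; rewrite -[leLHS](powRr0 v) ler_powR. Qed.

Lemma powR_lt1 v t : 0 < v < 1 -> 0 < t -> 0 < v `^ t < 1.
Proof.
move=> /andP[v0 v1] t0; rewrite powR_gt0//=.
have : v `^ t < 1 `^ t by rewrite gt0_ltr_powR// ?nnegrE; lra.
by rewrite powR1.
Qed.

(** Three ranges of $v$. For $v\le al$ the first term suffices. For $al<v\le1$ one has
    $v=v^{1-t}v^t\le al^{1-t}v^t$ and $v^t\le v^{(1+e)p}$, where the minimum is $v^p$; if [b] holds,
    $v^t\le1$ is used instead. For $v>1$ the minimum is $v^{-p}$, and $e\le1-1/p$ gives $v\le
    v^{p(1-e)}$. *)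
Lemma truncated_young v G p t e al (b : bool) :
  0 <= v -> 0 < G -> 1 < p -> 0 < e <= 1 - p^-1 -> 0 < al <= 1 -> 1 <= t ->
  ((1 + e) * p <= t) || b ->
  v * G <= al * G +
    al `^ (1 - t) * (v `^ p * G * Num.min (v `^ p) (v `^ p)^-1 `^ e + b%:R * G).
Proof.
move=> v0 G0 p1 /andP[e0 ep] /andP[a0 a1] t1 tb.
have mn0 : 0 <= v `^ p * G * Num.min (v `^ p) (v `^ p)^-1 `^ e.
  by rewrite !mulr_ge0 ?powR_ge0// ltW.
have bG0 : 0 <= b%:R * G by rewrite mulr_ge0// ltW.
have [va|av] := leP v al.
  apply: ler_wpDr; first by rewrite mulr_ge0 ?powR_ge0 ?addr_ge0.
  by rewrite ler_pM2r.
have {}v0 : 0 < v by exact: lt_trans av.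
have vp0 : 0 < v `^ p by rewrite powR_gt0.
apply: ler_wpDl; first by rewrite mulr_ge0 ?ltW.
have p0 : p != 0 by rewrite gt_eqF//; lra.
have [v1|v1] := leP v 1.
  have vp1 : v `^ p <= 1 by rewrite powR_le1//; lra.
  have -> : Num.min (v `^ p) (v `^ p)^-1 = v `^ p.
    by rewrite min_l// (le_trans vp1)// invf_ge1.
  have -> : v = v `^ (1 - t) * v `^ t.
    by rewrite -powRD ?(gt_eqF v0) ?implybT// subrK powRr1// ltW.
  rewrite -(mulrA (v `^ (1 - t))); apply: ler_pM.
  - exact: powR_ge0.
  - by rewrite mulr_ge0 ?powR_ge0 ?ltW.
  - have -> : 1 - t = - (t - 1) by lra.
    rewrite !powRN lef_pV2 ?posrE ?powR_gt0// ge0_ler_powR ?nnegrE//; lra.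
  - rewrite [v `^ (1 - t) * v `^ t](_ : _ = v); last first.
      by rewrite -powRD ?(gt_eqF v0) ?implybT// subrK powRr1// ltW.
    rewrite mulrAC -mulrDl ler_pM2r//.
    case: b {bG0 mn0} tb => /=; rewrite ?orbT ?orbF => tp.
      apply: ler_wpDl; first by rewrite mulr_ge0 ?powR_ge0.
      by rewrite powR_le1//; lra.
    rewrite addr0 -[X in X * _](powRr1 (powR_ge0 _ _)) -powRD; last first.
      by rewrite (gt_eqF vp0) implybT.
    rewrite -powRrM ger_powR// ?v0//; lra.
have vp1 : 1 <= v `^ p by rewrite powR_ge1//; lra.
have -> : Num.min (v `^ p) (v `^ p)^-1 = (v `^ p)^-1.
  by rewrite min_r// (le_trans _ vp1)// invf_le1.
have al1 : 1 <= al `^ (1 - t).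
  rewrite (_ : 1 - t = - (t - 1)); last lra.
  rewrite powRN invf_ge1 ?powR_gt0// powR_le1//; lra.
have vG : v * G <= v `^ p * G * (v `^ p)^-1 `^ e.
  rewrite mulrAC ler_pM2r// -powR_inv1 ?powR_ge0// -!powRrM -powRD; last first.
    by rewrite (gt_eqF v0) implybT.
  rewrite -[leLHS]powRr1 ?(ltW v0)// ler_powR ?(ltW v1)//.
  have : p * e <= p * (1 - p^-1) by rewrite ler_pM2l//; lra.
  rewrite mulrBr mulr1 mulfV//; lra.
rewrite -[leLHS]mul1r; apply: ler_pM => //; first by rewrite mulr_ge0 ?ltW.
by rewrite (le_trans vG)// lerDl.
Qed.

Lemma conj_powR g N p : 1 < p -> 0 < g -> 0 < N ->
  ((g / N) `^ (1 - p / (p - 1))) `^ p = (N / g) `^ (p / (p - 1)).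
Proof.
move=> p1 g0 N0; rewrite -powRrM -[N / g]invf_div -[(g / N)^-1]powR_inv1; last first.
  by rewrite divr_ge0// ltW.
by rewrite -powRrM; congr (_ `^ _); field; lra.
Qed.

(** With $p'=p/(p-1)$ and $v=F(g/N)^{1-p'}$ one has $vG=Fg/N$, $v^pG=F^p$ and $v^p=u$, so this is
    the truncated inequality. Plain Young would give $F^p$ without the factor in $u$, and its sum
    over the generations would diverge. *)
Lemma cell_young F g N p t e al (b : bool)
    (u := F `^ p * (N / g) `^ (p / (p - 1)))
    (G := (g / N) `^ (p / (p - 1))) :
  0 <= F -> 0 < g -> 0 < N -> 1 < p -> 0 < e <= 1 - p^-1 -> 0 < al <= 1 ->
  1 <= t -> ((1 + e) * p <= t) || b ->
  F * g / N <= al * G +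
    al `^ (1 - t) * (F `^ p * Num.min u u^-1 `^ e + b%:R * G).
Proof.
move=> F0 g0 N0 p1 ep a01 t1 tb.
have gN : 0 < g / N by rewrite divr_gt0.
have G0 : 0 < G by rewrite powR_gt0.
pose v := F * (g / N) `^ (1 - p / (p - 1)).
have vp : v `^ p = u by rewrite powRM ?powR_ge0// conj_powR.
have uG : u * G = F `^ p.
  rewrite -mulrA -powRM ?divr_ge0 ?(ltW g0) ?(ltW N0)//.
  by rewrite -invf_div mulVf ?gt_eqF// powR1 mulr1.
have vG : v * G = F * g / N.
  rewrite /v /G -mulrA -powRD; last by rewrite (gt_eqF gN) implybT.
  by rewrite subrK powRr1 ?ltW// mulrA.
have := @truncated_young v G p t e al b _ G0 p1 ep a01 t1 tb.
by rewrite vp vG uG; apply; rewrite mulr_ge0 ?powR_ge0.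
Qed.

Lemma cell_young1 F g N p :
  0 <= F -> 0 < g -> 0 < N -> 1 < p ->
  F * g / N <= F `^ p + (g / N) `^ (p / (p - 1)).
Proof.
move=> F0 g0 N0 p1.
have gN : 0 < g / N by rewrite divr_gt0.
pose v := F * (g / N) `^ (1 - p / (p - 1)).
have G0 : 0 < (g / N) `^ (p / (p - 1)) by rewrite powR_gt0.
have uG : v `^ p * (g / N) `^ (p / (p - 1)) = F `^ p.
  have -> : v `^ p = F `^ p * (N / g) `^ (p / (p - 1)).
    by rewrite /v powRM ?powR_ge0// conj_powR.
  rewrite -mulrA -powRM ?divr_ge0 ?(ltW g0) ?(ltW N0)//.
  by rewrite -invf_div mulVf ?gt_eqF// powR1 mulr1.
have vG : v * (g / N) `^ (p / (p - 1)) = F * g / N.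
  rewrite /v -mulrA -powRD; last by rewrite (gt_eqF gN) implybT.
  by rewrite subrK powRr1 ?ltW// mulrA.
rewrite -vG -uG -[X in _ <= _ + X]mul1r -mulrDl ler_pM2r//.
have [v1|v1] := leP v 1; first by rewrite (le_trans v1)// lerDr powR_ge0.
rewrite (@le_trans _ _ (v `^ p)) ?lerDl// -[leLHS]powRr1 ?mulr_ge0 ?powR_ge0//.
by rewrite ler_powR// ltW.
Qed.

End pointwise.

(** * Sums over a nested family of cells *)

Lemma le_powR_root (R : realType) (y q r : R) : 0 <= y -> 0 < q ->
  y `^ q <= r -> y <= r `^ q^-1.
Proof.
move=> y0 q0 yr; have {1}-> : y = (y `^ q) `^ q^-1.
  by rewrite -powRrM divff ?powRr1// lt0r_neq0.
by rewrite ge0_ler_powR ?nnegrE ?powR_ge0 ?invr_ge0 ?(ltW q0)// (le_trans _ yr)// powR_ge0.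
Qed.

Section cell_sums.
Context d (T : measurableType d) (R : realType) (mu : {measure set T -> \bar R}).
Variables (D : set T) (J : countType) (cl : int -> T -> J).
Hypothesis mD : measurable D.
Hypothesis mcell : forall a, measurable (cell D cl a).
Variables (k0 : int) (S : seq J).

(** A measurable majorant of the indicator of the exceptional cells, where the constant exponents
    attached to the coarser cells may be wrong. *)
Let s (x : T) : R := \sum_(i <- S) \1_(cell D cl (k0, i)) x.

Let s_ge0 x : 0 <= s x.
Proof. by apply: sumr_ge0 => i _. Qed.

Let s_ge1 x : D x -> cl k0 x \in S -> 1 <= s x.
Proof.
move=> Dx xS; rewrite /s (big_rem _ xS) /= indicE mem_set//.
by rewrite lerDl; apply: sumr_ge0.
Qed.

Let ms : measurable_fun setT s.
Proof. by apply: measurable_sum => i; exact: measurable_indic. Qed.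

Variables (N : int * J -> R) (kap : R).
Hypothesis N_gt0 : forall a, 0 < N a.
Hypothesis kap01 : 0 < kap < 1.
Hypothesis N_decay : forall k x, D x ->
  N (k + 1, cl (k + 1) x) <= kap * N (k, cl k x).

Lemma cell_norm_anti k l x : D x -> k <= l -> N (l, cl l x) <= N (k, cl k x).
Proof.
move=> Dx kl; have -> : l = k + Posz `|l - k|%N by lia.
elim: `|l - k|%N => [|n IH]; first by rewrite addr0.
have -> : k + Posz n.+1 = k + Posz n + 1 by lia.
apply: le_trans (N_decay _ Dx) (le_trans _ IH).
by rewrite ger_pMl ?N_gt0 // ltW//; case/andP: kap01.
Qed.

(** From generation [k0] towards coarser ones [N] grows geometrically, so at each point the terms
    with [k <= k0] are dominated by a geometric sum times the term of generation [k0]. The modular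
    of the latter is at most [1] on each of the [size S] exceptional cells. *)
Lemma tail_cells (g r : T -> R) (rlo : R) :
  measurable_fun setT g -> measurable_fun setT r ->
  (forall x, 0 < g x) -> 0 < rlo -> (forall x, rlo <= r x) ->
  (forall a, \int[mu]_(x in cell D cl a) ((g x / N a) `^ r x)%:E <= 1)%E ->
  (\int[mu]_(x in D) (\esum_(k in [set: int])
     ((k <= k0)%R%:R * s x * (g x / N (k, cl k x)) `^ r x)%:E)
   <= (4 / (1 - kap `^ rlo) * (size S)%:R)%:E)%E.
Proof.
move=> mg mr g0 rlo0 rlor gN.
have k1 := powR_lt1 kap01 rlo0.
set C := 4 / (1 - kap `^ rlo).
have C0 : 0 <= C by rewrite divr_ge0// subr_ge0 ltW//; case/andP: k1.
have mG a : measurable_fun setT (fun x => (g x / N a) `^ r x).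
  by apply: measurable_fun_powR2 => //; exact: measurable_funM.
apply: (@le_trans _ _ (\int[mu]_(x in D) (\sum_(i <- S)
   (C%:E * (fun y => ((g y / N (k0, i)) `^ r y)%:E) \_ (cell D cl (k0, i)) x))))%E.
  apply: le_integral_ge0 => x Dx.
    by apply: esum_ge0 => k _; rewrite lee_fin !mulr_ge0 ?powR_ge0.
  rewrite -ge0_sume_distrr; last first.
    by move=> i _; rewrite /patch; case: ifP => // _; rewrite lee_fin powR_ge0.
  have -> : (\sum_(i <- S)
      ((fun y => ((g y / N (k0, i)) `^ r y)%:E) \_ (cell D cl (k0, i))) x =
      (s x * (g x / N (k0, cl k0 x)) `^ r x)%:E)%E.
    rewrite /s mulr_suml -sumEFin; apply: eq_bigr => i _.
    rewrite /patch indicE; case: ifPn => [|_]; last by rewrite mul0r.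
    by rewrite inE => -[_ /= <-]; rewrite mul1r.
  pose u k := N (k, cl k x) / N (k0, cl k0 x).
  have u0 k : 0 < u k by rewrite divr_gt0.
  have uk k : u (k + 1) <= kap * u k.
    by rewrite /u mulrA ler_pM2r ?invr_gt0//; exact: N_decay.
  have := esum_geometric u0 uk kap01 rlo0; rewrite -/C => uC.
  rewrite [leRHS]muleC.
  apply: (@le_trans _ _ ((s x * (g x / N (k0, cl k0 x)) `^ r x)%:E *
    \esum_(k in [set: int]) (Num.min (u k) (u k)^-1 `^ rlo)%:E))%E; last first.
    by apply: lee_wpmul2l => //; rewrite lee_fin mulr_ge0 ?powR_ge0.
  rewrite -esumZ ?mulr_ge0 ?powR_ge0//; last by move=> k; rewrite lee_fin powR_ge0.
  apply: le_esum => k _; rewrite -EFinM lee_fin.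
  case: (lerP k k0) => kk0 /=; last by rewrite !mul0r !mulr_ge0 ?powR_ge0.
  rewrite mul1r -mulrA ler_wpM2l//.
  have u1 : 1 <= u k by rewrite ler_pdivlMr// mul1r cell_norm_anti.
  rewrite min_r; last by rewrite (le_trans _ u1)// invf_le1.
  have -> : g x / N (k, cl k x) = g x / N (k0, cl k0 x) * (u k)^-1.
    by rewrite /u invf_div mulrA divfK ?gt_eqF.
  rewrite powRM ?invr_ge0 ?divr_ge0 ?(ltW (g0 _)) ?(ltW (N_gt0 _)) ?(ltW (u0 _))//.
  rewrite ler_wpM2l ?powR_ge0// ger_powR// invr_gt0 u0 invf_le1//.
rewrite ge0_integral_sum//; last 2 first.
- move=> i; apply: measurable_funeM.
  apply: measurable_funS (measurableT) _ _ => //.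
  apply/(measurable_restrictT _ (mcell _)); apply: measurable_funTS.
  exact/measurable_EFinP.
- move=> i x _; rewrite mule_ge0// /patch; case: ifP => // _.
  by rewrite lee_fin powR_ge0.
apply: (@le_trans _ _ (\sum_(i <- S) C%:E)%E); last first.
  rewrite sumEFin lee_fin big_const_seq count_predT iter_addr_0 mulr_natr//.
apply: lee_sum => i _; rewrite ge0_integralZl_EFin//; last 2 first.
- by move=> x _; rewrite /patch; case: ifP => // _; rewrite lee_fin powR_ge0.
- apply: measurable_funS (measurableT) _ _ => //.
  apply/(measurable_restrictT _ (mcell _)); apply: measurable_funTS.
  exact/measurable_EFinP.
rewrite -[leRHS]mule1; apply: lee_wpmul2l => //.
rewrite -integral_mkcondr (_ : D `&` _ = cell D cl (k0, i)) ?gN//.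
by rewrite /cell setIA setIid.
Qed.

(** * Summability of powers of the cell averages *)

Section energy.
Variables (p F g : T -> R) (t : int * J -> R) (plo e : R).
Hypotheses (mp : measurable_fun setT p) (mF : measurable_fun setT F)
  (mg : measurable_fun setT g).
Hypotheses (plo1 : 1 < plo) (plop : forall x, plo <= p x).
Hypotheses (F0 : forall x, 0 <= F x) (g0 : forall x, 0 < g x).
Hypothesis gN : forall a,
  (\int[mu]_(x in cell D cl a) ((g x / N a) `^ (p x / (p x - 1)))%:E <= 1)%E.
Hypothesis F1 : (\int[mu]_(x in D) (F x `^ p x)%:E <= 1)%E.

Let p1 x : 1 < p x. Proof. exact: lt_le_trans plo1 (plop x). Qed.

Let mFp : measurable_fun setT (fun x => F x `^ p x).
Proof. exact: measurable_fun_powR2. Qed.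

Let mp1 : measurable_fun setT (fun x => (p x - 1)^-1).
Proof.
apply: measurable_funV_pos; first by move=> x; rewrite subr_ge0 ltW.
exact: measurable_funB.
Qed.

Let mG a : measurable_fun setT (fun x => (g x / N a) `^ (p x / (p x - 1))).
Proof.
by apply: measurable_fun_powR2; [exact: measurable_funM|exact: measurable_funM].
Qed.

Let F1cell a : (\int[mu]_(x in cell D cl a) (F x `^ p x)%:E <= 1)%E.
Proof.
apply: le_trans F1; apply: ge0_subset_integral => //.
- by apply: measurable_funTS; exact/measurable_EFinP.
- by move=> x _; rewrite lee_fin powR_ge0.
- by move=> x [].
Qed.

Let Fg0 a x : 0 <= F x * g x / N a.
Proof. by rewrite divr_ge0 ?mulr_ge0 ?(ltW (g0 _)) ?(ltW (N_gt0 _)). Qed.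

Lemma cell_avg_le2 a :
  (\int[mu]_(x in cell D cl a) (F x * g x / N a)%:E <= 2%:E)%E.
Proof.
apply: (@le_trans _ _ (\int[mu]_(x in cell D cl a)
  ((F x `^ p x)%:E + ((g x / N a) `^ (p x / (p x - 1)))%:E))%E).
  apply: le_integral_ge0 => x _; rewrite ?lee_fin//.
  exact: cell_young1.
rewrite ge0_integralD//.
- by have -> : 2%:E = (1 + 1)%E :> \bar R; [rewrite -EFinD|exact: leeD (F1cell a) (gN a)].
- by move=> x _; rewrite lee_fin powR_ge0.
- by apply: measurable_funTS; exact/measurable_EFinP.
- by move=> x _; rewrite lee_fin powR_ge0.
- by apply: measurable_funTS; exact/measurable_EFinP.
Qed.

Hypothesis e01 : 0 < e <= 1 - plo^-1.
Hypothesis t1 : forall a, 1 <= t a.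
Hypothesis slack : forall a x, cell D cl a x ->
  (1 + e) * p x <= t a \/ ((a.1 <= k0)%R /\ cl k0 x \in S).

(** The quotient of $F^p$ by $(g/N_a)^{p'}$, the two quantities balanced in Young's inequality. From
    a cell to its child it decreases by a fixed factor, so it is close to $1$ in few generations
    only. *)
Let u a x : R := F x `^ p x * (N a / g x) `^ (p x / (p x - 1)).
Let E a x : R := F x `^ p x * Num.min (u a x) (u a x)^-1 `^ e +
  (a.1 <= k0)%R%:R * s x * (g x / N a) `^ (p x / (p x - 1)).

Let u0 a x : 0 <= u a x.
Proof. by rewrite mulr_ge0 ?powR_ge0. Qed.

Let E0 a x : 0 <= E a x.
Proof. by rewrite addr_ge0 ?mulr_ge0 ?powR_ge0. Qed.

Let mu_ a : measurable_fun setT (u a).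
Proof.
apply: measurable_funM => //; apply: measurable_fun_powR2.
  by apply: measurable_funM => //; apply: measurable_funV_pos => // x; exact: ltW.
exact: measurable_funM.
Qed.

Let mE1 a : measurable_fun setT
  (fun x => F x `^ p x * Num.min (u a x) (u a x)^-1 `^ e).
Proof.
apply: measurable_funM => //; apply: measurable_fun_powR2 => //.
by apply: measurable_minr => //; exact: measurable_funV_pos.
Qed.

Let mE2 a : measurable_fun setT
  (fun x => (a.1 <= k0)%R%:R * s x * (g x / N a) `^ (p x / (p x - 1))).
Proof. by apply: measurable_funM => //; exact: measurable_funM. Qed.

Let mE a : measurable_fun setT (E a).
Proof. exact: measurable_funD. Qed.

Let c a : R := fine (\int[mu]_(x in cell D cl a) (F x * g x / N a)%:E).

Let cE a : (\int[mu]_(x in cell D cl a) (F x * g x / N a)%:E = (c a)%:E)%E.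
Proof.
rewrite fineK// ge0_fin_numE.
  exact: le_lt_trans (cell_avg_le2 a) (ltry _).
by apply: integral_ge0 => x _; rewrite lee_fin.
Qed.

Let c02 a : 0 <= c a <= 2.
Proof.
rewrite -!lee_fin -cE cell_avg_le2 andbT.
by apply: integral_ge0 => x _; rewrite lee_fin.
Qed.

(** Integrating [cell_young] with truncation level [al = c a / 2] gives $2\,al\le al+al^{1-t}\int
    E$, because the modular of [g / N a] is at most [1]. The term $al$ is absorbed and the rest is
    multiplied by $al^{t-1}$. *)
Let c_le a :
  (((c a / 2) `^ t a)%:E <= \int[mu]_(x in cell D cl a) (E a x)%:E)%E.
Proof.
have t_gt0 : 0 < t a by exact: lt_le_trans (t1 a).
have IE0 : (0 <= \int[mu]_(x in cell D cl a) (E a x)%:E)%E.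
  by apply: integral_ge0 => x _; rewrite lee_fin.
have /andP[cge0 cle2] := c02 a.
move: cge0; rewrite le_eqVlt => /predU1P[<-|cgt0].
  by rewrite mul0r powR0 ?gt_eqF.
set al := c a / 2.
have al01 : 0 < al <= 1 by rewrite /al; apply/andP; split; lra.
have al0 : 0 < al by case/andP: al01.
have mEa : measurable_fun (cell D cl a) (EFin \o E a).
  by apply: measurable_funTS; exact/measurable_EFinP.
have mGa : measurable_fun (cell D cl a)
    (fun x => ((g x / N a) `^ (p x / (p x - 1)))%:E).
  by apply: measurable_funTS; exact/measurable_EFinP.
have : ((c a)%:E <= al%:E + (al `^ (1 - t a))%:E *
    \int[mu]_(x in cell D cl a) (E a x)%:E)%E.
  rewrite -cE; apply: (@le_trans _ _ (\int[mu]_(x in cell D cl a)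
    (al%:E * ((g x / N a) `^ (p x / (p x - 1)))%:E +
     (al `^ (1 - t a))%:E * (E a x)%:E))%E).
    apply: le_integral_ge0 => x ax.
      by rewrite lee_fin.
    have px := p1 x; have pV : p x <= p x by [].
    have ep : 0 < e <= 1 - (p x)^-1.
      case/andP: e01 => -> /= h; apply: le_trans h _.
      by rewrite lerB// lef_pV2 ?posrE// (lt_trans ltr01).
    have sl : ((1 + e) * p x <= t a) || ((a.1 <= k0)%R && (cl k0 x \in S)).
      by case: (slack ax) => [->//|[-> ->]]; rewrite orbT.
    rewrite -!EFinM -EFinD lee_fin.
    apply: le_trans (cell_young (F0 x) (g0 x) (N_gt0 a) (p1 x) ep al01 (t1 a) sl) _.
    rewrite lerD2l ler_wpM2l ?powR_ge0// lerD2l ler_wpM2r ?powR_ge0//.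
    case: (a.1 <= k0)%R => /=; last by rewrite mul0r.
    rewrite mul1r; case: (boolP (_ \in S)) => //= xS.
    by apply: s_ge1 => //; case: ax.
  rewrite ge0_integralD//; first last.
  - exact: measurable_funeM.
  - by move=> x _; rewrite -EFinM lee_fin mulr_ge0 ?powR_ge0.
  - exact: measurable_funeM.
  - by move=> x _; rewrite -EFinM lee_fin mulr_ge0 ?powR_ge0 ?ltW.
  rewrite !ge0_integralZl_EFin ?powR_ge0 ?(ltW al0)//; last 2 first.
  - by move=> x _; rewrite lee_fin.
  - by move=> x _; rewrite lee_fin powR_ge0.
  apply: leeD2r; rewrite -[leRHS]mule1; apply: lee_wpmul2l (gN a).
  by rewrite lee_fin ltW.
move: IE0; case: (\int[mu]_(x in cell D cl a) (E a x)%:E)%E => [r| |]//; last first.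
  by move=> *; rewrite leey.
rewrite -EFinM -EFinD !lee_fin => r0 h.
have h1 : al <= al `^ (1 - t a) * r by rewrite /al in h *; lra.
have aN0 : al != 0 by rewrite gt_eqF.
have : al `^ (t a - 1) * al <= al `^ (t a - 1) * (al `^ (1 - t a) * r).
  by rewrite ler_pM2l ?powR_gt0.
rewrite mulrA -powRD ?aN0 ?implybT// addrA subrK subrr powRr0 mul1r.
rewrite -[X in _ * X <= _](powRr1 (ltW al0)) -powRD ?aN0 ?implybT//.
by rewrite subrK.
Qed.

(** Along the chain through [x] the gains add up to a constant, which leaves the integral of $F^p$.
    The exceptional part is [tail_cells] for the exponents $p'\ge1$, whence the bare [kap] in its
    constant. *)
Lemma cell_energy :
  (\esum_(a in [set: int * J]) ((c a / 2) `^ t a)%:E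
   <= (4 / (1 - kap `^ e) + 4 / (1 - kap) * (size S)%:R)%:E)%E.
Proof.
have e0 : 0 < e by case/andP: e01.
have k1 := powR_lt1 kap01 e0.
have C0 : 0 <= 4 / (1 - kap `^ e).
  by rewrite divr_ge0// subr_ge0 ltW//; case/andP: k1.
apply: (@le_trans _ _ (\esum_(a in [set: int * J])
    (\int[mu]_(x in cell D cl a) (F x `^ p x * Num.min (u a x) (u a x)^-1 `^ e)%:E +
     \int[mu]_(x in cell D cl a) ((a.1 <= k0)%R%:R * s x *
        (g x / N a) `^ (p x / (p x - 1)))%:E))%E).
  apply: le_esum => a _; apply: le_trans (c_le a) _.
  rewrite -ge0_integralD//; first last.
  - by apply: measurable_funTS; exact/measurable_EFinP.
  - by move=> x _; rewrite lee_fin !mulr_ge0 ?powR_ge0.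
  - by apply: measurable_funTS; exact/measurable_EFinP.
  - by move=> x _; rewrite lee_fin mulr_ge0 ?powR_ge0.
rewrite esumD; first last.
- by move=> a _; apply: integral_ge0 => x _; rewrite lee_fin !mulr_ge0 ?powR_ge0.
- by move=> a _; apply: integral_ge0 => x _; rewrite lee_fin mulr_ge0 ?powR_ge0.
rewrite EFinD; apply: leeD.
  rewrite (@esum_cells _ _ _ mu D J cl mD mcell
    (fun a x => (F x `^ p x * Num.min (u a x) (u a x)^-1 `^ e)%:E)); first last.
  - by move=> a; exact/measurable_EFinP.
  - by move=> a x; rewrite lee_fin mulr_ge0 ?powR_ge0.
  apply: (@le_trans _ _ (\int[mu]_(x in D)
      ((4 / (1 - kap `^ e))%:E * (F x `^ p x)%:E))%E); last first.
    rewrite ge0_integralZl_EFin//.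
    - by rewrite -[leRHS]mule1 lee_wpmul2l.
    - by move=> x _; rewrite lee_fin powR_ge0.
    - by apply: measurable_funTS; exact/measurable_EFinP.
  apply: le_integral_ge0 => x Dx.
    by apply: esum_ge0 => k _; rewrite lee_fin mulr_ge0 ?powR_ge0.
  under eq_esum do rewrite EFinM.
  rewrite esumZ ?powR_ge0//; last by move=> k; rewrite lee_fin powR_ge0.
  (* [esum_geometric] needs a positive [u]; where [F] vanishes both sides are [0]. *)
  rewrite muleC; have [Fx0|Fx0] := eqVneq (F x) 0.
    by rewrite Fx0 powR0 ?mule0// gt_eqF// (lt_trans ltr01).
  rewrite lee_wpmul2r ?lee_fin ?powR_ge0//.
  have Fp0 : 0 < F x `^ p x by rewrite powR_gt0// lt_neqAle eq_sym Fx0 F0.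
  apply: esum_geometric => // k.
    by rewrite mulr_gt0// powR_gt0 ?divr_gt0.
  rewrite /u mulrCA ler_pM2l//.
  have pp1 : 1 <= p x / (p x - 1).
    by have := p1 x => ?; rewrite ler_pdivlMr; lra.
  have kp : kap `^ (p x / (p x - 1)) <= kap.
    by rewrite ge1r_powR//; case/andP: kap01 => -> /ltW.
  apply: (@le_trans _ _ (kap `^ (p x / (p x - 1)) *
      (N (k, cl k x) / g x) `^ (p x / (p x - 1)))); last by rewrite ler_wpM2r ?powR_ge0.
  have kap0 : 0 < kap by case/andP: kap01.
  rewrite -powRM ?divr_ge0 ?(ltW kap0) ?(ltW (g0 _)) ?(ltW (N_gt0 _))//.
  have Ng k' : 0 <= N (k', cl k' x) / g x.
    by rewrite divr_ge0 ?(ltW (g0 _)) ?(ltW (N_gt0 _)).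
  apply: ge0_ler_powR; rewrite ?nnegrE//.
  - exact: le_trans pp1.
  - by rewrite mulr_ge0// ltW.
  - by rewrite mulrA ler_pM2r ?invr_gt0//; exact: N_decay.
rewrite (@esum_cells _ _ _ mu D J cl mD mcell (fun a x => ((a.1 <= k0)%R%:R * s x *
        (g x / N a) `^ (p x / (p x - 1)))%:E)); first last.
- by move=> a; exact/measurable_EFinP.
- by move=> a x; rewrite lee_fin !mulr_ge0 ?powR_ge0.
rewrite -[X in 4 / (1 - X)](powRr1 (_ : 0 <= kap)); last by case/andP: kap01 => /ltW.
apply: tail_cells => //; first exact: measurable_funM.
by move=> x; have := p1 x => ?; rewrite ler_pdivlMr; lra.
Qed.

End energy.

(** * The modular of the weighted dyadic sum *)

Section assemble.
Variables (q w : T -> R) (c tau : int * J -> R) (qlo qhi e B : R).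
Hypotheses (mq : measurable_fun setT q) (mw : measurable_fun setT w).
Hypotheses (qlo0 : 0 < qlo) (qloq : forall x, qlo <= q x)
  (qqhi : forall x, q x <= qhi).
Hypothesis w0 : forall x, 0 < w x.
Hypothesis wN : forall a,
  (\int[mu]_(x in cell D cl a) ((w x / N a) `^ q x)%:E <= 1)%E.
Hypothesis c01 : forall a, 0 <= c a <= 1.
Hypothesis e01 : 0 < e < 1.
Hypothesis slack : forall a x, cell D cl a x ->
  tau a <= (1 - e) * q x \/ ((a.1 <= k0)%R /\ cl k0 x \in S).
Hypothesis cB : (\esum_(a in [set: int * J]) (c a `^ tau a)%:E <= B%:E)%E.

Let C := 4 / (1 - kap `^ e).

Let C1 : 1 <= C.
Proof.
have /andP[k1 k2] := powR_lt1 kap01 (proj1 (andP e01)).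
by rewrite /C ler_pdivlMr; lra.
Qed.

Let q0 x : 0 < q x. Proof. exact: lt_le_trans (qloq x). Qed.

(* Where the terms decay only because [N] does, [c <= 1] lets a power of [c] be
   traded for geometric summability. *)
Lemma esum_le_sup x b : D x -> 0 < b ->
  (forall k, w x * (c (k, cl k x) `^ (1 - e) / N (k, cl k x)) <= b) ->
  ((w x)%:E * (\esum_(k in [set: int]) (c (k, cl k x) / N (k, cl k x))%:E)
    <= (b * C)%:E)%E.
Proof.
move=> Dx b0 hb; have /andP[e0 e1] := e01.
pose z k := b * N (k, cl k x) / w x.
have z0 k : 0 < z k by rewrite divr_gt0// mulr_gt0.
have zk k : z (k + 1) <= kap * z k.
  rewrite /z mulrA ler_pM2r ?invr_gt0// mulrCA ler_pM2l//; exact: N_decay.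
have := esum_geometric z0 zk kap01 e0; rewrite -/C => zC.
rewrite -esumZ ?(ltW (w0 x))//; last first.
  by move=> k; rewrite lee_fin divr_ge0 ?(ltW (N_gt0 _))//; case/andP: (c01 (k, cl k x)).
apply: (@le_trans _ _ (b%:E * \esum_(k in [set: int])
    (Num.min (z k) (z k)^-1 `^ e)%:E)%E); last first.
  by rewrite EFinM lee_wpmul2l// lee_fin ltW.
rewrite -esumZ ?(ltW b0)//; last by move=> k; rewrite lee_fin powR_ge0.
apply: le_esum => k _; rewrite -!EFinM lee_fin.
have /andP[ck0 ck1] := c01 (k, cl k x).
have Nk0 := N_gt0 (k, cl k x).
have -> : w x * (c (k, cl k x) / N (k, cl k x)) = b * (c (k, cl k x) / z k).
  by rewrite /z; field; rewrite !gt_eqF.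
rewrite ler_pM2l//.
have cz : c (k, cl k x) `^ (1 - e) <= z k.
  rewrite /z ler_pdivlMr// mulrC.
  by have := hb k; rewrite mulrA ler_pdivrMr.
(* Below [1], $c\le z^{1/(1-e)}$ and $1/(1-e)\ge1+e$ give $c/z\le z^e$. Above [1], [c <= 1] gives
   $c/z\le z^{-1}\le z^{-e}$. *)
have [z1|z1] := leP (z k) 1.
  have zV1 : 1 <= (z k)^-1 by rewrite invf_ge1.
  rewrite min_l; last exact: le_trans zV1.
  rewrite ler_pdivrMr// -[X in _ * X](powRr1 (ltW (z0 k))) -powRD; last first.
    by rewrite (gt_eqF (z0 k)) implybT.
  apply: (@le_trans _ _ (z k `^ (1 - e)^-1)).
    have -> : c (k, cl k x) = (c (k, cl k x) `^ (1 - e)) `^ (1 - e)^-1.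
      by rewrite -powRrM divff ?powRr1// gt_eqF// subr_gt0.
    rewrite ge0_ler_powR ?nnegrE ?powR_ge0 ?(ltW (z0 k))//.
    by rewrite invr_ge0 subr_ge0 ltW.
  rewrite ger_powR ?z0//.
  rewrite -[X in _ <= X]div1r ler_pdivlMr; last by rewrite subr_gt0.
  nra.
rewrite min_r; last by rewrite (le_trans _ (ltW z1))// invf_le1// ltW.
apply: (@le_trans _ _ (z k)^-1).
  by rewrite ler_pdivrMr// mulVf ?gt_eqF.
by rewrite ger1_powR ?invr_gt0 ?z0 ?invf_le1 ?(ltW z1) ?(ltW e1).
Qed.

(** Let $r$ be the sum on the right without its constant. Each term is at most $r$, so $r^{1/q}$ is
    an admissible bound [b] in [esum_le_sup]. No triangle inequality intervenes, and exponents $q<1$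
    are covered. *)
Lemma esum_powR_le x : D x ->
  (((w x)%:E * \esum_(k in [set: int]) (c (k, cl k x) / N (k, cl k x))%:E) `^ q x
    <= \esum_(k in [set: int]) (C `^ qhi *
         ((c (k, cl k x) `^ ((1 - e) * q x)) * (w x / N (k, cl k x)) `^ q x))%:E)%E.
Proof.
have C0 : 0 <= C := le_trans ler01 C1.
move=> Dx; have /andP[e0 e1] := e01.
rewrite [leRHS](_ : _ = (C `^ qhi)%:E * \esum_(k in [set: int])
    (c (k, cl k x) `^ ((1 - e) * q x) * (w x / N (k, cl k x)) `^ q x)%:E)%E; last first.
  rewrite -esumZ ?powR_ge0//; last by move=> k; rewrite lee_fin mulr_ge0 ?powR_ge0.
set r := (\esum_(k in _) ((c (k, cl k x) `^ _ * _)%:E))%E.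
have r_ge k : ((c (k, cl k x) `^ ((1 - e) * q x) *
    (w x / N (k, cl k x)) `^ q x)%:E <= r)%E.
  apply: (@esum_ge1 R int (fun k => (c (k, cl k x) `^ ((1 - e) * q x) *
    (w x / N (k, cl k x)) `^ q x)%:E)) => i.
  by rewrite lee_fin mulr_ge0 ?powR_ge0.
have r0 : (0 <= r)%E by apply: esum_ge0 => k _; rewrite lee_fin mulr_ge0 ?powR_ge0.
case: r r0 r_ge => [r| |]// r0 r_ge; last first.
  by rewrite gt0_muley ?leey// lte_fin powR_gt0// (lt_le_trans ltr01).
rewrite lee_fin in r0.
have cN k : 0 <= c (k, cl k x) / N (k, cl k x).
  by rewrite divr_ge0 ?(ltW (N_gt0 _))//; case/andP: (c01 (k, cl k x)).
have hb k : w x * (c (k, cl k x) `^ (1 - e) / N (k, cl k x)) <= r `^ (q x)^-1.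
  have := r_ge k; rewrite lee_fin => h.
  have wc0 : 0 <= w x * (c (k, cl k x) `^ (1 - e) / N (k, cl k x)).
    by rewrite mulr_ge0 ?divr_ge0 ?powR_ge0 ?(ltW (w0 _)) ?(ltW (N_gt0 _)).
  apply: le_powR_root => //.
  rewrite mulrCA powRM ?powR_ge0 ?divr_ge0 ?(ltW (w0 _)) ?(ltW (N_gt0 _))//.
  by rewrite -powRrM.
move: r0; rewrite le_eqVlt => /predU1P[rE|r0].
  rewrite -rE mule0.
  have c0 k : c (k, cl k x) / N (k, cl k x) = 0.
    have := hb k; rewrite -rE powR0 ?invr_eq0 ?gt_eqF// => h.
    have : c (k, cl k x) `^ (1 - e) = 0.
      apply/eqP; rewrite eq_le powR_ge0 andbT.
      by move: h; rewrite pmulr_rle0// ler_pdivrMr// mul0r.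
    by move=> /powR_eq0_eq0 ->; rewrite mul0r.
  under eq_esum do rewrite c0.
  by rewrite esum1// mule0 poweR0r// gt_eqF.
have b0 : 0 < r `^ (q x)^-1 by rewrite powR_gt0.
have := esum_le_sup Dx b0 hb.
have : (0 <= (w x)%:E * \esum_(k in [set: int]) (c (k, cl k x) / N (k, cl k x))%:E)%E.
  by rewrite mule_ge0 ?lee_fin ?(ltW (w0 x))//; apply: esum_ge0 => k _; rewrite lee_fin.
move: ((w x)%:E * _)%E => [y| |]//; rewrite ?leye_eq// !lee_fin => y0 yb.
have -> : r = (r `^ (q x)^-1) `^ q x by rewrite -powRrM mulVf ?gt_eqF// powRr1// ltW.
apply: (@le_trans _ _ ((r `^ (q x)^-1 * C) `^ q x)).
  apply: ge0_ler_powR; rewrite ?nnegrE// ?(ltW (q0 x))//.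
  exact: mulr_ge0 (powR_ge0 _ _) C0.
rewrite (powRM _ (powR_ge0 _ _) C0).
by rewrite mulrC ler_wpM2r ?powR_ge0// ler_powR.
Qed.

(** Since [c <= 1] and [tau a <= (1 - e) * q x] off the exceptional cells, the power of [c] may be
    replaced by $c^{\tau}$, which is constant on the cell. What remains there is the modular of
    [w / N a], at most [1], so that the sum over the cells is the one bounded by [cB]. *)
Lemma cell_assemble :
  (\int[mu]_(x in D) (((w x)%:E * \esum_(k in [set: int])
      (c (k, cl k x) / N (k, cl k x))%:E) `^ q x)
   <= (C `^ qhi * (B + 4 / (1 - kap `^ qlo) * (size S)%:R))%:E)%E.
Proof.
have Cq0 : 0 <= C `^ qhi by exact: powR_ge0.
have mwN a : measurable_fun setT (fun x => (w x / N a) `^ q x).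
  by apply: measurable_fun_powR2 => //; exact: measurable_funM.
pose Psi a x : \bar R := (C `^ qhi * (c a `^ tau a * (w x / N a) `^ q x) +
  C `^ qhi * ((a.1 <= k0)%R%:R * s x * (w x / N a) `^ q x))%:E.
apply: (@le_trans _ _ (\int[mu]_(x in D) (\esum_(k in [set: int])
    Psi (k, cl k x) x))%E).
  apply: le_integral_ge0 => x Dx; first exact: poweR_ge0.
  apply: le_trans (esum_powR_le Dx) _; apply: le_esum => k _.
  rewrite /Psi lee_fin -mulrDr ler_wpM2l// -mulrDl ler_wpM2r ?powR_ge0//.
  have /andP[ck0 ck1] := c01 (k, cl k x).
  have kx : cell D cl (k, cl k x) x by [].
  have ks0 : 0 <= (k <= k0)%R%:R * s x by rewrite mulr_ge0.
  have [tq|[kk0 xS]] := slack kx.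
    apply: ler_wpDr => //; move: ck0; rewrite le_eqVlt => /predU1P[<-|ck0].
      rewrite [leLHS]powR0 ?powR_ge0// mulf_neq0 ?gt_eqF//.
      by rewrite subr_gt0; case/andP: e01.
    by rewrite ger_powR// ck0.
  apply: ler_wpDl; first exact: powR_ge0.
  rewrite kk0 mul1r (le_trans _ (s_ge1 Dx xS))// powR_le1 ?ck0//.
  rewrite mulr_ge0 ?(ltW (q0 x))// subr_ge0 ltW//; by case/andP: e01.
rewrite -(@esum_cells _ _ _ mu D J cl mD mcell Psi); first last.
- move=> a; apply/measurable_EFinP; apply: measurable_funD.
    by apply: measurable_funM => //; exact: measurable_funM.
  apply: measurable_funM => //; apply: measurable_funM => //.
  exact: measurable_funM.
- by move=> a x; rewrite lee_fin addr_ge0// !mulr_ge0 ?powR_ge0.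
apply: (@le_trans _ _ (\esum_(a in [set: int * J]) ((C `^ qhi)%:E *
   ((c a `^ tau a)%:E + \int[mu]_(x in cell D cl a)
      ((a.1 <= k0)%R%:R * s x * (w x / N a) `^ q x)%:E)))%E).
  apply: le_esum => a _.
  have m1 : measurable_fun (cell D cl a) (fun x => ((w x / N a) `^ q x)%:E).
    by apply: measurable_funTS; exact/measurable_EFinP.
  have m2 : measurable_fun (cell D cl a)
      (fun x => ((a.1 <= k0)%R%:R * s x * (w x / N a) `^ q x)%:E).
    apply: measurable_funTS; apply/measurable_EFinP.
    by apply: measurable_funM => //; exact: measurable_funM.
  have -> : (\int[mu]_(x in cell D cl a) Psi a x =
    \int[mu]_(x in cell D cl a) ((C `^ qhi)%:E * ((c a `^ tau a)%:E *
       ((w x / N a) `^ q x)%:E + ((a.1 <= k0)%R%:R * s x * (w x / N a) `^ q x)%:E)))%E.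
    by apply: eq_integral => x _; rewrite /Psi -mulrDr EFinM EFinD.
  have p1 x : cell D cl a x -> (0 <= (c a `^ tau a)%:E * ((w x / N a) `^ q x)%:E)%E.
    by move=> _; rewrite mule_ge0// lee_fin powR_ge0.
  have p2 x : cell D cl a x ->
      (0 <= ((a.1 <= k0)%R%:R * s x * (w x / N a) `^ q x)%:E)%E.
    by move=> _; rewrite lee_fin !mulr_ge0 ?powR_ge0.
  have m3 : measurable_fun (cell D cl a)
      (fun x => (c a `^ tau a)%:E * ((w x / N a) `^ q x)%:E)%E.
    exact: measurable_funeM.
  rewrite ge0_integralZl_EFin//; last 2 first.
  - by move=> x ax; rewrite adde_ge0 ?p1 ?p2.
  - exact: emeasurable_funD.
  rewrite ge0_integralD// ge0_integralZl_EFin ?powR_ge0//; last first.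
    by move=> x _; rewrite lee_fin powR_ge0.
  apply: lee_wpmul2l; first by rewrite lee_fin.
  apply: leeD2r; rewrite -[leRHS]mule1; apply: lee_wpmul2l (wN a).
  by rewrite lee_fin powR_ge0.
have i0 a : (0 <= \int[mu]_(x in cell D cl a)
      ((a.1 <= k0)%R%:R * s x * (w x / N a) `^ q x)%:E)%E.
  by apply: integral_ge0 => x _; rewrite lee_fin !mulr_ge0 ?powR_ge0.
rewrite esumZ//; last by move=> a; rewrite adde_ge0// lee_fin powR_ge0.
rewrite EFinM; apply: lee_wpmul2l; first by rewrite lee_fin.
rewrite esumD; [|by move=> a _; rewrite lee_fin powR_ge0|by move=> a _].
rewrite EFinD; apply: leeD => //.
rewrite (@esum_cells _ _ _ mu D J cl mD mcell (fun a x => ((a.1 <= k0)%R%:R * s x *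
        (w x / N a) `^ q x)%:E)); first exact: tail_cells.
- by move=> a x; rewrite lee_fin !mulr_ge0 ?powR_ge0.
- move=> a; apply/measurable_EFinP; apply: measurable_funM => //.
  exact: measurable_funM.
Qed.

End assemble.

End cell_sums.

(** * Variable exponent norms of positive functions *)

(** Every [a j] is at most the total [M] and the weights add up to [1], so the product is at most
    [M]: a crude weighted arithmetic-geometric mean inequality. *)
Lemma prod_powR_le_sum (R : realType) (J : finType) (a s : J -> R) :
  (forall j, 0 <= a j) -> (forall j, 0 <= s j) -> \sum_j s j = 1 ->
  \prod_j a j `^ s j <= \sum_j a j.
Proof.
move=> a0 s0 s1; set M := \sum_j a j.
have aM j : a j <= M by rewrite /M (bigD1 j)//= lerDl sumr_ge0.
have M0 : 0 <= M by exact: sumr_ge0.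
have [M00|M0'] := eqVneq M 0.
  have [j sj] : exists j, s j != 0.
    apply/existsP; apply: contraT; rewrite negb_exists => /forallP h.
    move: s1; rewrite big1 => [/eqP|j _]; first by rewrite eq_sym oner_eq0.
    by apply/eqP; have := h j; rewrite negbK.
  rewrite (bigD1 j)//= (_ : a j = 0) ?powR0 ?mul0r//.
  by apply/eqP; rewrite eq_le a0 andbT -M00.
apply: (@le_trans _ _ (\prod_j M `^ s j)).
  apply: ler_prod => j _; rewrite powR_ge0 ge0_ler_powR ?nnegrE//.
suff -> : \prod_j M `^ s j = M `^ (\sum_j s j) by rewrite s1 powRr1.
elim/big_rec2 : _ => [|j y z _ ->]; first by rewrite powRr0.
by rewrite powRD// M0' implybT.
Qed.

Lemma powR_prod (R : realType) (J : finType) (a : J -> R) (s : R) :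
  (forall j, 0 <= a j) -> (\prod_j a j) `^ s = \prod_j a j `^ s.
Proof.
move=> a0; suff [] : (\prod_j a j) `^ s = \prod_j a j `^ s /\ 0 <= \prod_j a j by [].
elim/big_rec2 : _ => [|j x y _ [<- x0]]; first by rewrite powR1.
by rewrite powRM// mulr_ge0.
Qed.

Lemma powRV (R : realType) (a s : R) : 0 <= a -> a^-1 `^ s = (a `^ s)^-1.
Proof. by move=> a0; rewrite -powR_inv1// -powRrM mulN1r powRN. Qed.

Lemma powR_gt1 (R : realType) (v t : R) : 1 < v -> 0 < t -> 1 < v `^ t.
Proof.
move=> v1 t0; have : 1 `^ t < v `^ t.
  by rewrite gt0_ltr_powR ?nnegrE ?ler01// (le_trans ler01)// ltW.
by rewrite powR1.
Qed.

Section modular.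
Context d (T : measurableType d) (R : realType) (mu : {measure set T -> \bar R}).
Implicit Types (g r : T -> R) (E : set T) (l k : R).

Definition modular r g E l : \bar R :=
  (\int[mu]_(x in E) ((g x / l) `^ r x)%:E)%E.

(** The Luxemburg norm, with the restriction to [E] placed in the domain of integration instead of
    an indicator, so that [g] remains strictly positive. *)
Definition lnorm r g E : \bar R :=
  ereal_inf [set l%:E | l in [set l | 0 < l /\ (modular r g E l <= 1)%E]].

Lemma modular_ge0 r g E l : (0 <= modular r g E l)%E.
Proof. by apply: integral_ge0 => x _; rewrite lee_fin powR_ge0. Qed.

Lemma lnorm_ge0 r g E : (0 <= lnorm r g E)%E.
Proof. by apply: le_ereal_inf_tmp => _ [l [l0 _] <-]; rewrite lee_fin ltW. Qed.

Lemma lnorm_le r g E l : 0 < l -> (modular r g E l <= 1)%E -> (lnorm r g E <= l%:E)%E.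
Proof. by move=> l0 El; apply: ereal_inf_lbound; exists l. Qed.

Section fixed.
Variables (r g : T -> R) (rlo rhi : R).
Hypotheses (mr : measurable_fun setT r) (mg : measurable_fun setT g).
Hypotheses (rlo0 : 0 < rlo) (rlor : forall x, rlo <= r x)
  (rrhi : forall x, r x <= rhi).
Hypothesis g0 : forall x, 0 < g x.
Local Notation M := (modular r g).
Local Notation L := (lnorm r g).

Let r0 x : 0 < r x. Proof. exact: lt_le_trans (rlor x). Qed.

Lemma measurable_modular E l :
  measurable_fun E (fun x => ((g x / l) `^ r x)%:E).
Proof.
apply: measurable_funTS; apply/measurable_EFinP.
by apply: measurable_fun_powR2 => //; exact: measurable_funM.
Qed.

Lemma modular_anti E l l' : 0 < l -> l <= l' -> (M E l' <= M E l)%E.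
Proof.
move=> l0 ll; apply: le_integral_ge0 => x _; rewrite ?lee_fin ?powR_ge0//.
have l'0 : 0 < l' by exact: lt_le_trans ll.
rewrite ge0_ler_powR ?nnegrE ?(ltW (r0 _)) ?divr_ge0 ?(ltW (g0 _)) ?(ltW l0) ?(ltW l'0)//.
by rewrite ler_pM2l// lef_pV2.
Qed.

Lemma modular_sub E E' l : measurable E -> measurable E' -> E `<=` E' ->
  (M E l <= M E' l)%E.
Proof.
move=> mE mE' EE; apply: ge0_subset_integral => //; first exact: measurable_modular.
by move=> x _; rewrite lee_fin powR_ge0.
Qed.

Lemma modular_scale E l k : measurable E -> 0 < l -> 1 <= k ->
  (M E l <= (k `^ rhi)%:E * M E (l * k))%E.
Proof.
move=> mE l0 k1; have k0 : 0 < k by exact: lt_le_trans k1.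
rewrite -ge0_integralZl_EFin ?powR_ge0//; last 2 first.
- by move=> x _; rewrite lee_fin powR_ge0.
- exact: measurable_modular.
apply: le_integral_ge0 => x _; rewrite -?EFinM lee_fin ?powR_ge0//.
have -> : g x / l = k * (g x / (l * k)) by field; rewrite !gt_eqF.
rewrite powRM ?(ltW k0) ?divr_ge0 ?mulr_ge0 ?(ltW (g0 _)) ?(ltW l0) ?(ltW k0)//.
by rewrite ler_wpM2r ?powR_ge0// ler_powR.
Qed.

Lemma modular_lnorm_lt E l : (L E < l%:E)%E -> (M E l <= 1)%E.
Proof.
move=> /ereal_inf_lt[_ [l' [l'0 h] <-]]; rewrite lte_fin => l'l.
by apply: le_trans h; apply: modular_anti => //; exact: ltW.
Qed.

Lemma lnorm_le_sub E E' : measurable E -> measurable E' -> E `<=` E' ->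
  (L E <= L E')%E.
Proof.
move=> mE mE' EE; apply: le_ereal_inf_tmp => _ [l [l0 h] <-]; apply: lnorm_le => //.
by apply: le_trans h; exact: modular_sub.
Qed.

(** The infimum is attained. Otherwise choose $y$ with $1<y<M(N)$, where $M$ is the modular on [E]:
    at the level $Ny^{1/rhi}$, above the norm, the modular is at most $1$, and returning to [N]
    costs at most the factor $y$. *)
Lemma modular_lnorm E N : measurable E -> 0 < N -> L E = N%:E -> (M E N <= 1)%E.
Proof.
move=> mE N0 LE; rewrite leNgt; apply/negP => h1.
have rhi0 : 0 < rhi by exact: lt_le_trans (r0 point) (rrhi point).
have [y [y1 yM]] : exists y, 1 < y /\ (y%:E < M E N)%E.
  move: h1; case: (M E N) => [z| |]//; last by move=> _; exists 2; rewrite ltry ltr1n.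
  by rewrite lte_fin => z1; exists ((1 + z) / 2); rewrite lte_fin; split; lra.
have y0 : 0 < y by exact: lt_trans y1.
have k1 : 1 < y `^ rhi^-1 by rewrite powR_gt1// invr_gt0.
have k0 : 0 < y `^ rhi^-1 by exact: lt_trans k1.
have := modular_scale mE N0 (ltW k1).
rewrite -powRrM mulVf ?gt_eqF// powRr1 ?(ltW y0)// leNgt => /negP; apply.
apply: le_lt_trans yM; rewrite -[leRHS]mule1 lee_wpmul2l ?lee_fin ?(ltW y0)//.
by apply: modular_lnorm_lt; rewrite LE lte_fin ltr_pMr.
Qed.

(** If the norm vanished, the modular would stay at most [1] at every level; as it grows at least
    like $k^{rlo}$ when the level is divided by $k\ge1$, it would be [0], although [g] is positive
    on a set of positive measure. *)
Lemma lnorm_gt0 E : measurable E -> (0 < mu E)%E -> (0 < L E)%E.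
Proof.
move=> mE E0; rewrite lt_neqAle lnorm_ge0 andbT; apply/negP => /eqP L0.
have h l : 0 < l -> (M E l <= 1)%E.
  by move=> l0; apply: modular_lnorm_lt; rewrite -L0 lte_fin.
have h1 k : 1 <= k -> ((k `^ rlo)%:E * M E 1 <= 1)%E.
  move=> k1; have k0 : 0 < k by exact: lt_le_trans k1.
  apply: le_trans (h k^-1 _); last by rewrite invr_gt0.
  rewrite -ge0_integralZl_EFin ?powR_ge0//; last 2 first.
  - by move=> x _; rewrite lee_fin powR_ge0.
  - exact: measurable_modular.
  apply: le_integral_ge0 => x _; rewrite -?EFinM lee_fin ?mulr_ge0 ?powR_ge0//.
  rewrite invrK divr1 mulrC powRM ?(ltW k0) ?(ltW (g0 _))//.
  by rewrite ler_wpM2l ?powR_ge0// ler_powR.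
have M0 : M E 1 = 0%E.
  apply/eqP; rewrite eq_le modular_ge0 andbT leNgt; apply/negP => M0.
  have [e [e0 eM]] : exists e, 0 < e /\ (e%:E <= M E 1)%E.
    move: M0; case: (M E 1) => [z| |]//; last by move=> _; exists 1; rewrite leey.
    by rewrite lte_fin => z0; exists z; rewrite lexx.
  pose k := (1 + e^-1) `^ rlo^-1.
  have k1 : 1 < 1 + e^-1 by rewrite ltrDl invr_gt0.
  have := h1 k (ltW (powR_gt1 k1 _)); rewrite invr_gt0 => /(_ rlo0).
  rewrite /k -powRrM mulVf ?gt_eqF// powRr1 ?(le_trans ler01 (ltW k1))// => h2.
  have := le_trans (lee_wpmul2l _ eM) h2.
  rewrite !lee_fin (le_trans ler01 (ltW k1)) => /(_ isT).
  by rewrite mulrDl mulVf ?gt_eqF// mul1r; lra.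
have : (\int[mu]_(x in E) `|((g x / 1) `^ r x)%:E| = 0)%E.
  rewrite -M0; apply: eq_integral => x _; by rewrite gee0_abs// lee_fin powR_ge0.
move/(ae_eq_integral_abs mu mE (@measurable_modular E 1)) => [Z [mZ Z0 EZ]].
have : (mu E <= mu Z)%E.
  rewrite le_measure ?inE// => x Ex; apply: EZ => /= hx; have := hx Ex.
  by case => /eqP; rewrite gt_eqF// powR_gt0// divr1.
by rewrite Z0 leNgt E0.
Qed.

(* If removing [E'] costs a fixed fraction of the norm, then [E'] carries
   at most a fixed fraction < 1 of it. *)
Lemma lnorm_decay E E' N c : measurable E -> measurable E' -> E' `<=` E ->
  0 < N -> L E = N%:E -> 0 < c < 1 -> (1 <= M (E `\` E') (c * N))%E ->
  (L E' <= ((1 - c `^ rhi) `^ rhi^-1 * N)%:E)%E.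
Proof.
move=> mE mE' EE N0 LE /andP[c0 c1]; set ME := M _ _ => h.
have rhi0 : 0 < rhi by exact: lt_le_trans (r0 point) (rrhi point).
have /andP[e0 e1] : 0 < c `^ rhi < 1 by rewrite powR_lt1 ?c0.
have mEE : measurable (E `\` E') by exact: measurableD.
set kap := (1 - c `^ rhi) `^ rhi^-1.
have /andP[k0 k1] : 0 < kap < 1 by rewrite powR_lt1 ?invr_gt0//; apply/andP; split; lra.
(* Passing from level [c * N] to [N] costs at most the factor $c^{rhi}$. By additivity at most
   $1-c^{rhi}$ of the modular at [N] is left for [E'], and [kap] is the rescaling that brings this
   back to [1]. *)
have h1 : ((c `^ rhi)%:E <= M (E `\` E') N)%E.
  have cV : 1 <= c^-1 by rewrite invf_ge1// ltW.
  have E1 : c * N * c^-1 = N by rewrite mulrAC divff ?mul1r// gt_eqF.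
  have E2 : c^-1 `^ rhi = (c `^ rhi)^-1 by rewrite powRV// ltW.
  have := le_trans h (modular_scale mEE (mulr_gt0 c0 N0) cV).
  rewrite E1 E2; move: (M (E `\` E') N) => y; clear -e0 => h2.
  have := lee_wpmul2l (_ : 0 <= (c `^ rhi)%:E)%E h2.
  rewrite lee_fin (ltW e0) => /(_ isT).
  by rewrite mule1 muleA -EFinM divff ?gt_eqF// mul1e.
clearbody ME; clear h; have h2 : (M E' N + M (E `\` E') N <= 1)%E.
  apply: le_trans (modular_lnorm mE N0 LE).
  have {2}-> : E = E' `|` (E `\` E') by rewrite setDUK.
  rewrite le_eqVlt; apply/orP; left; apply/eqP; apply/esym.
  apply: ge0_integral_setU => //.
  - exact: measurable_modular.
  - by move=> x _; rewrite lee_fin powR_ge0.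
  - by rewrite disj_set2E setDIK eqxx.
have h3 : (M E' N <= (1 - c `^ rhi)%:E)%E.
  have : (M E' N + (c `^ rhi)%:E <= 1)%E by apply: le_trans h2; exact: leeD2l.
  have := modular_ge0 r g E' N; move: (M E' N) => [z| |]//; rewrite -EFinD !lee_fin; lra.
apply: lnorm_le; first by rewrite mulr_gt0.
have kV : 1 <= kap^-1 by rewrite invf_ge1// ltW.
rewrite mulrC; apply: le_trans (modular_scale mE' (mulr_gt0 N0 k0) kV) _.
rewrite -mulrA divff ?gt_eqF// mulr1.
apply: (@le_trans _ _ ((kap^-1 `^ rhi)%:E * (1 - c `^ rhi)%:E)%E).
  by rewrite lee_wpmul2l// lee_fin powR_ge0.
rewrite -EFinM lee_fin -[kap^-1]powR_inv1 ?(ltW k0)// -!powRrM mulrCA mulVf ?gt_eqF//.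
by rewrite mulr1 powR_inv1 ?mulVf ?gt_eqF//; lra.
Qed.

End fixed.
End modular.

(** * Generalized Hölder inequality for functions with product one *)

Section hoelder_family.
Context d (T : measurableType d) (R : realType) (mu : {measure set T -> \bar R}).
Variables (J : finType) (r g : J -> T -> R) (rlo rhi beta : R).
Hypotheses (mr : forall j, measurable_fun setT (r j))
  (mg : forall j, measurable_fun setT (g j)).
Hypotheses (rlo0 : 0 < rlo) (rlor : forall j x, rlo <= r j x)
  (rrhi : forall j x, r j x <= rhi).
Hypothesis g0 : forall j x, 0 < g j x.
Hypothesis beta0 : 0 < beta.
Hypothesis rbeta : forall x, \sum_j (r j x)^-1 = beta.
Hypothesis g1 : forall x, \prod_j g j x = 1.

Let r0 j x : 0 < r j x. Proof. exact: lt_le_trans (rlor j x). Qed.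

(** Because the [g j] multiply to [1], the product of the [g j / l j] is the constant $P^{-1}$. Its
    power $1/\beta$, distributed with the weights $1/(\beta r_j)$ of sum $1$, is at most the sum of
    the integrands of the modulars; integration over [E] concludes. *)
Lemma prod_modular_ge (E : set T) (l : J -> R) : measurable E ->
  (forall j, 0 < l j) -> (forall j, (modular mu (r j) (g j) E (l j) <= 1)%E) ->
  (mu E <= (#|J|%:R * (\prod_j l j) `^ beta^-1)%:E)%E.
Proof.
move=> mE l0 h; set P := \prod_j l j.
have P0 : 0 < P by apply: prodr_gt0.
have mM j := @measurable_modular _ _ _ _ _ (mr j) (mg j) E (l j).
have : (((P `^ beta^-1)^-1)%:E * mu E <= #|J|%:R%:E)%E.
  rewrite -(integral_cst mu mE); apply: (@le_trans _ _ (\int[mu]_(x in E)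
     \sum_(j : J) ((g j x / l j) `^ r j x)%:E)%E).
    apply: le_integral_ge0 => x _; first by rewrite lee_fin invr_ge0 powR_ge0.
    rewrite sumEFin lee_fin.
    have gl j : 0 < g j x / l j by rewrite divr_gt0.
    have := @prod_powR_le_sum R J (fun j => (g j x / l j) `^ r j x)
      (fun j => (r j x * beta)^-1).
    move=> /(_ (fun j => powR_ge0 _ _)) pp.
    apply: le_trans (pp _ _).
    - have -> : \prod_j ((g j x / l j) `^ r j x) `^ (r j x * beta)^-1 =
          (\prod_j (g j x / l j)) `^ beta^-1.
        rewrite powR_prod; last by move=> j; exact: ltW.
        apply: eq_bigr => j _; rewrite -powRrM invfM mulrA divff ?mul1r//.
        by rewrite gt_eqF.
      by rewrite big_split/= g1 mul1r prodfV -/P (powRV _ (ltW P0)).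
    - by move=> j; rewrite invr_ge0 mulr_ge0 ?ltW.
    - under eq_bigr do rewrite invfM.
      by rewrite -mulr_suml rbeta divff// gt_eqF.
  rewrite ge0_integral_sum//; last by move=> j x _; rewrite lee_fin powR_ge0.
  apply: (@le_trans _ _ (\sum_(j : J) 1%E)%E); first by apply: lee_sum => j _; exact: h.
  by rewrite sumEFin lee_fin sumr_const.
rewrite EFinM => hh.
have := lee_wpmul2l (_ : 0 <= (P `^ beta^-1)%:E)%E hh.
rewrite lee_fin powR_ge0 => /(_ isT).
have Pb : ((P `^ beta^-1)%:E * ((P `^ beta^-1)^-1)%:E = 1)%E.
  by rewrite -EFinM divff// gt_eqF// powR_gt0.
by rewrite muleA Pb mul1e [(#|J|%:R%:E * _)%E]muleC.
Qed.

Variables (B E : set T) (nB : J -> R) (V c0 K : R).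
Hypotheses (mB : measurable B) (mE : measurable E) (EB : E `<=` B).
Hypotheses (nB0 : forall j, 0 < nB j)
  (LB : forall j, lnorm mu (r j) (g j) B = (nB j)%:E).
Hypotheses (V0 : 0 < V) (c00 : 0 < c0) (K0 : 0 < K).
Hypotheses (muE : ((c0 * V)%:E <= mu E)%E) (nBK : \prod_j nB j <= K * V `^ beta).

(** If the modular were less than [1], then [prod_modular_ge], with level [c * nB j] at [j] and
    [nB i] elsewhere, would make [E] too small. Without its factor $1/2$, [c] solves
    $\#J\,(cKV^\beta)^{1/\beta}=c_0V$; the halving makes the contradiction strict. *)
Lemma modular_large_subset j (c := (c0 / #|J|%:R) `^ beta / K / 2) :
  (1 <= modular mu (r j) (g j) E (c * nB j))%E.
Proof.
have J0 : 0 < #|J|%:R :> R by rewrite ltr0n; apply/card_gt0P; exists j.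
have cc0 : 0 < c by rewrite !divr_gt0// powR_gt0// divr_gt0.
rewrite leNgt; apply/negP => /ltW h.
pose l i := if i == j then c * nB j else nB i.
have l0 i : 0 < l i by rewrite /l; case: ifP => _ //; rewrite mulr_gt0.
have hl i : (modular mu (r i) (g i) E (l i) <= 1)%E.
  rewrite /l; case: eqP => [->//|_].
  apply: le_trans (modular_lnorm (mr i) (mg i) rlo0 (rlor i) (rrhi i) (g0 i) mB (nB0 i) (LB i)).
  exact: modular_sub.
have := le_trans muE (prod_modular_ge mE l0 hl); rewrite lee_fin leNgt => /negP; apply.
have -> : \prod_i l i = c * \prod_i nB i.
  rewrite (bigD1 j)//= [in RHS](bigD1 j)//= /l eqxx mulrA; congr (_ * _).
  by apply: eq_bigr => i /negbTE ->.
have cn : c * \prod_i nB i <= (c0 / #|J|%:R) `^ beta * V `^ beta / 2.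
  apply: (@le_trans _ _ (c * (K * V `^ beta))); first by rewrite ler_pM2l.
  rewrite /c le_eqVlt; apply/orP; left; apply/eqP; field; by rewrite gt_eqF.
have W0 : 0 < c0 / #|J|%:R * V by rewrite mulr_gt0// divr_gt0.
have : c * \prod_i nB i < (c0 / #|J|%:R * V) `^ beta.
  apply: le_lt_trans cn _; rewrite -powRM ?(ltW V0) ?divr_ge0 ?(ltW c00)//.
  by have := powR_gt0 beta W0; lra.
have P0 : 0 <= c * \prod_i nB i by rewrite mulr_ge0 ?(ltW cc0)// prodr_ge0// => i _; exact: ltW.
move=> h1; have : (c * \prod_i nB i) `^ beta^-1 < ((c0 / #|J|%:R * V) `^ beta) `^ beta^-1.
  by rewrite gt0_ltr_powR ?invr_gt0 ?nnegrE ?powR_ge0.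
rewrite -[ltRHS]powRrM divff ?gt_eqF// powRr1 ?(ltW W0)// => h2.
have : #|J|%:R * (c * \prod_i nB i) `^ beta^-1 < #|J|%:R * (c0 / #|J|%:R * V).
  by rewrite ltr_pM2l.
by rewrite [ltRHS](_ : _ = c0 * V)//; field; rewrite gt_eqF.
Qed.

Lemma lnorm_decay_family (Q Q' : set T) (N : R) j
    (c := (c0 / #|J|%:R) `^ beta / K / 2) :
  measurable Q -> measurable Q' -> Q' `<=` Q -> Q `\` Q' = E -> c < 1 ->
  Q `<=` B -> 0 < N -> lnorm mu (r j) (g j) Q = N%:E ->
  (lnorm mu (r j) (g j) Q' <= ((1 - c `^ rhi) `^ rhi^-1 * N)%:E)%E.
Proof.
move=> mQ mQ' QQ QE c1 QB N0 LQ.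
have J0 : 0 < #|J|%:R :> R by rewrite ltr0n; apply/card_gt0P; exists j.
have cc0 : 0 < c by rewrite !divr_gt0// powR_gt0// divr_gt0.
apply: (@lnorm_decay _ _ _ mu (r j) (g j) rlo rhi _ _ _ _ _ _ Q) => //; first by rewrite cc0.
rewrite QE; apply: le_trans (modular_large_subset j) _; rewrite -/c.
apply: (@modular_anti _ _ _ mu (r j) (g j) rlo) => //; first by rewrite mulr_gt0.
rewrite ler_pM2l// -lee_fin -LQ -LB.
exact: lnorm_le_sub.
Qed.

End hoelder_family.

(** * The abstract dyadic estimate *)

Lemma big_option (R : Type) (idx : R) (op : Monoid.com_law idx) (I : finType)
    (F : option I -> R) :
  \big[op/idx]_j F j = op (F None) (\big[op/idx]_i F (Some i)).
Proof.
rewrite (bigD1 None)//=; congr (op _ _).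
rewrite (reindex_omap Some id)//=; first by apply: eq_bigl => i; rewrite eqxx.
by case.
Qed.

Section sufficiency.
Context d (T : measurableType d) (R : realType) (mu : {measure set T -> \bar R}).
Variables (D : set T) (J : countType) (cl : int -> T -> J).
Hypothesis mD : measurable D.
Hypothesis mcell : forall a, measurable (cell D cl a).
Local Notation Q := (cell D cl).
Hypothesis Q_gt0 : forall a, (0 < mu (Q a))%E.
Variables (Delta : finType) (sh shV : Delta -> J -> J).
Hypotheses (shK : forall i, cancel (sh i) (shV i))
  (shVK : forall i, cancel (shV i) (sh i)).
Variables (Bs : int * J -> set T) (V : int -> R) (c0 : R).
Hypothesis mBs : forall a, measurable (Bs a).
Hypothesis QBs : forall a, Q a `<=` Bs a.
Hypothesis shBs : forall a i, Q (a.1, sh i a.2) `<=` Bs a.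
Hypothesis V0 : forall k, 0 < V k.
Hypothesis c001 : 0 < c0 <= 1.
Hypothesis Q_nested : forall k x, D x ->
  Q (k + 1, cl (k + 1) x) `<=` Q (k, cl k x).
Hypothesis Q_thick : forall k x, D x -> ((c0 * V k)%:E <=
  mu (Q (k, cl k x) `\` Q ((k + 1)%R, cl (k + 1)%R x)))%E.

Variables (m : nat) (alpha : R) (p : 'I_m -> T -> R) (q : T -> R)
  (w : 'I_m -> T -> R) (plo qlo qhi : R).
Hypothesis m0 : (0 < m)%N.
Hypotheses (mp : forall i, measurable_fun setT (p i)) (mq : measurable_fun setT q)
  (mw : forall i, measurable_fun setT (w i)).
Hypotheses (plo1 : 1 < plo) (plop : forall i x, plo <= p i x).
Hypotheses (qlo0 : 0 < qlo) (qloq : forall x, qlo <= q x)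
  (qqhi : forall x, q x <= qhi).
Hypothesis w0 : forall i x, 0 < w i x.
Hypothesis alpha0m : 0 < alpha < m%:R.
Hypothesis pq : forall x, (q x)^-1 = \sum_i (p i x)^-1 - alpha.

Let W x := \prod_i w i x.
(** The norms of the $A_{\vec p,q}$ condition as one family: [None] carries [q] and the product
    weight, [Some i] the conjugate of [p i] and the inverse of [w i]. In this section [alpha] stands
    for $\alpha/n$. *)
Let r (j : option 'I_m) x := if j is Some i then p i x / (p i x - 1) else q x.
Let g (j : option 'I_m) x := if j is Some i then (w i x)^-1 else W x.
Let beta : R := m%:R - alpha.

Variables (K : R) (nB : int * J -> option 'I_m -> R).
Hypothesis K1 : 1 <= K.
Hypothesis nB0 : forall a j, 0 < nB a j.
Hypothesis LnB : forall a j, lnorm mu (r j) (g j) (Bs a) = (nB a j)%:E.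
Hypothesis nBK : forall a, \prod_j nB a j <= K * V a.1 `^ beta.

(* [rho] are the values of the exponents that are used on the cell [a] (and its
   neighbours); they may be wrong only on a finite set of cells of generation
   [k0], which matters for the coarser cells. *)
Hypothesis rho_ex : forall dl : R, 0 < dl -> exists k0 (S : seq J)
    (rho : 'I_m -> int * J -> R),
  (forall i a, 1 <= rho i a) /\
  forall i a x, (Q a x \/ exists s, Q (a.1, sh s a.2) x) ->
    `|p i x - rho i a| <= dl \/ ((a.1 <= k0)%R /\ cl k0 x \in S).

Let p1 i x : 1 < p i x. Proof. exact: lt_le_trans plo1 (plop i x). Qed.
Let q0 x : 0 < q x. Proof. exact: lt_le_trans qlo0 (qloq x). Qed.
Let beta0 : 0 < beta. Proof. by rewrite subr_gt0; case/andP: alpha0m. Qed.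
Let W0 x : 0 < W x. Proof. exact: prodr_gt0. Qed.
Let g0 j x : 0 < g j x. Proof. by case: j => [i|] //=; rewrite invr_gt0. Qed.

Let mg j : measurable_fun setT (g j).
Proof.
case: j => [i|] /=; first by apply: measurable_funV_pos => // x; exact: ltW.
by apply: measurable_prod => i _.
Qed.

Let mr j : measurable_fun setT (r j).
Proof.
case: j => [i|] //=; apply: measurable_funM => //.
apply: measurable_funV_pos; first by move=> x; rewrite subr_ge0 ltW.
exact: measurable_funB.
Qed.

Let rlo := Num.min 1 qlo.
Let rhi := Num.max (plo / (plo - 1)) qhi.

Let rlo0 : 0 < rlo. Proof. by rewrite lt_min ltr01. Qed.

Let rlor j x : rlo <= r j x.
Proof.
rewrite ge_min; case: j => [i|] /=; last by rewrite qloq orbT.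
by have := p1 i x => ?; rewrite ler_pdivlMr ?mul1r; lra.
Qed.

Let rrhi j x : r j x <= rhi.
Proof.
rewrite le_max; case: j => [i|] /=; last by rewrite qqhi orbT.
have := p1 i x; have := plop i x; have := plo1 => h0 h1 h2; apply/orP; left.
rewrite ler_pdivrMr; last lra.
rewrite mulrAC ler_pdivlMr; last lra.
nra.
Qed.

Let rbeta x : \sum_j (r j x)^-1 = beta.
Proof.
rewrite big_option /= pq /beta.
have -> : \sum_i (p i x / (p i x - 1))^-1 = \sum_(i < m) (1 - (p i x)^-1).
  apply: eq_bigr => i _; rewrite invf_div mulrBl mul1r divff// gt_eqF//.
  exact: lt_trans (p1 i x).
by rewrite sumrB sumr_const card_ord; ring.
Qed.

Let g1 x : \prod_j g j x = 1.
Proof.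
by rewrite big_option /= prodfV divff// gt_eqF.
Qed.

Let N j a : R := fine (lnorm mu (r j) (g j) (Q a)).

Let NB j a : (lnorm mu (r j) (g j) (Q a) <= (nB a j)%:E)%E.
Proof.
rewrite -LnB.
exact: (@lnorm_le_sub _ _ _ mu (r j) (g j)).
Qed.

Let NE j a : lnorm mu (r j) (g j) (Q a) = (N j a)%:E.
Proof.
rewrite fineK// ge0_fin_numE ?lnorm_ge0//.
exact: le_lt_trans (NB j a) (ltry _).
Qed.

Let N0 j a : 0 < N j a.
Proof.
rewrite -lte_fin -NE.
exact: (lnorm_gt0 (mr j) (mg j) rlo0 (rlor j) (g0 j) (mcell a) (Q_gt0 a)).
Qed.

Let NleB j a : N j a <= nB a j. Proof. by rewrite -lee_fin -NE. Qed.

Let NshB j a s : N j (a.1, sh s a.2) <= nB a j.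
Proof.
rewrite -lee_fin -NE -LnB.
exact: (@lnorm_le_sub _ _ _ mu (r j) (g j)).
Qed.

Let modN j a : (\int[mu]_(x in Q a) ((g j x / N j a) `^ r j x)%:E <= 1)%E.
Proof.
exact: (modular_lnorm (mr j) (mg j) rlo0 (rlor j) (rrhi j) (g0 j) (mcell a) (N0 j a) (NE j a)).
Qed.

Let cc := (c0 / #|{: option 'I_m}|%:R) `^ beta / K / 2.
Let kap := (1 - cc `^ rhi) `^ rhi^-1.

Let card_gt0 : 0 < #|{: option 'I_m}|%:R :> R.
Proof. by rewrite card_option ltr0n. Qed.

Let rhi0 : 0 < rhi.
Proof. by rewrite lt_max divr_gt0//; [exact: lt_trans plo1|rewrite subr_gt0]. Qed.

Let cc01 : 0 < cc < 1.
Proof.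
have /andP[c00 c01] := c001.
have h0 : 0 < c0 / #|{: option 'I_m}|%:R by rewrite divr_gt0.
have h1 : c0 / #|{: option 'I_m}|%:R <= 1.
  by rewrite ler_pdivrMr// mul1r (le_trans c01)// card_option ler1n.
have h2 := powR_gt0 beta h0.
have h3 : (c0 / #|{: option 'I_m}|%:R) `^ beta <= 1 by rewrite powR_le1 ?(ltW h0) ?(ltW beta0).
have KV : 0 < K^-1 <= 1 by rewrite invr_gt0 invf_le1 ?K1 ?(lt_le_trans ltr01).
rewrite /cc; move: (_ `^ beta) h2 h3 => y y0 y1; case/andP: KV => KV0 KV1.
have : 0 < y * K^-1 by rewrite mulr_gt0.
have : y * K^-1 <= 1 * 1 by apply: ler_pM => //; exact: ltW.
by move=> ? ?; apply/andP; split; lra.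
Qed.

Let kap01 : 0 < kap < 1.
Proof.
rewrite powR_lt1 ?invr_gt0//; have /andP[a b] := powR_lt1 cc01 rhi0.
by apply/andP; split; lra.
Qed.

(** Inside the ball of the parent cell, the part of that cell outside the child is a set of
    proportional measure, so its norms are bounded below by Hölder's inequality. *)
Let N_decay j k x : D x -> N j (k + 1, cl (k + 1) x) <= kap * N j (k, cl k x).
Proof.
move=> Dx; rewrite -lee_fin -NE.
have mE : measurable (Q (k, cl k x) `\` Q (k + 1, cl (k + 1) x)).
  exact: measurableD.
have EB : Q (k, cl k x) `\` Q (k + 1, cl (k + 1) x) `<=` Bs (k, cl k x).
  by move=> y [/QBs].
have /andP[c00 _] := c001; have K0 := lt_le_trans ltr01 K1.
apply: (@lnorm_decay_family _ _ _ mu _ r g rlo rhi beta mr mg rlo0 rlor rrhi g0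
  beta0 rbeta g1 _ _ _ _ _ _ (mBs _) mE EB (nB0 _) (LnB _) (V0 k) c00 K0
  (Q_thick k Dx) (nBK _) (Q (k, cl k x)) _ (N j (k, cl k x)) j) => //.
- exact: Q_nested.
- by case/andP: cc01.
Qed.

Hypothesis Delta0 : (0 < #|Delta|)%N.

Let M : R := #|Delta|%:R.
Let M0 : 0 < M. Proof. by rewrite ltr0n. Qed.

(** Shifting permutes the labels of a generation, so the averages over a neighbour are summed as
    averages over the cell itself, with the exponent of the cell shifted back. For this reason the
    reference exponents have to fit on the neighbours too. *)
Let esum_shift (c t : int * J -> R) s :
  \esum_(a in [set: int * J]) ((c (a.1, sh s a.2) / 2) `^ t a)%:E =
  \esum_(a in [set: int * J]) ((c a / 2) `^ t (a.1, shV s a.2))%:E.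
Proof.
have bij : set_bij [set: int * J] [set: int * J] (fun a => (a.1, sh s a.2)).
  split => //; first by move=> [a1 a2] [b1 b2] _ _ /= [-> /(can_inj (shK s)) ->].
  by move=> [a1 a2] _; exists (a1, shV s a2) => //=; rewrite shVK.
rewrite [RHS](@reindex_esum R _ _ _ _ _
  (fun a => ((c a / 2) `^ t (a.1, shV s a.2))%:E) bij).
by apply: eq_esum => -[a1 a2] _ /=; rewrite shK.
Qed.

(** Each integral near a cell is a norm of [1 / w i] times a normalized average, and the product
    bound [nBK] turns $V^{-\beta}$ times these norms into a multiple of [1 / N None a]. The sum
    thereby takes the form treated by [cell_assemble], with [c] the product of the averages. *)
Theorem sum_cells_bounded : exists2 C : R, 0 < C & forall F : 'I_m -> T -> R,
  (forall i, measurable_fun setT (F i)) -> (forall i x, 0 <= F i x) ->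
  (forall i, \int[mu]_(x in D) (F i x `^ p i x)%:E <= 1)%E ->
  (forall i a, (\int[mu]_(x in Q a) (F i x * (w i x)^-1)%:E < +oo)%E) /\
  (\int[mu]_(x in D) (((W x)%:E * \esum_(k in [set: int])
      ((V k `^ beta)^-1 * \prod_i \sum_s
        fine (\int[mu]_(y in Q (k, sh s (cl k x)))
          (F i y * (w i y)^-1)%:E))%:E) `^ q x)
   <= C%:E)%E.
Proof.
have /andP[al0 alm] := alpha0m.
have mR0 : 0 < m%:R :> R by rewrite ltr0n.
(* The first bound is the room provided by [alpha > 0], the second is what Young's inequality
   requires. *)
pose e := Num.min (alpha / (8 * m%:R)) (1 - plo^-1).
have plo0 : 0 < plo by exact: lt_trans plo1.
have e0 : 0 < e.
  by rewrite lt_min divr_gt0 ?mulr_gt0// subr_gt0 invf_lt1.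
have e1 : e <= alpha / (8 * m%:R) by rewrite ge_min lexx.
have e2 : e <= 1 - plo^-1 by rewrite ge_min lexx orbT.
have em : 8 * (e * m%:R) <= alpha.
  by move: e1; rewrite ler_pdivlMr ?mulr_gt0// mulrCA.
have m1 : 1 <= m%:R :> R by rewrite ler1n.
have e8 : e < 8^-1.
  apply: le_lt_trans e1 _; rewrite ltr_pdivrMr ?mulr_gt0// mulrA mulVf ?mul1r//.
have [k0 [S [rho [rho1 rhoP]]]] := rho_ex (divr_gt0 e0 (ltr0Sn _ 1)).
(* With [rho >= 1] within [e / 2] of [p i], the factor [1 + 2 * e] ensures
   [(1 + e) * p i x <= t i a]. *)
pose t i a := (1 + 2 * e) * rho i a.
have t1 i a : 1 <= t i a by have := rho1 i a; rewrite /t; nra.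
have t0 i a : 0 < t i a by exact: lt_le_trans (t1 i a).
pose itau a := \sum_i (t i a)^-1.
have itau0 a : 0 < itau a.
  rewrite /itau (bigD1 (Ordinal m0))//= ltr_wpDr ?invr_gt0//.
  by apply: sumr_ge0 => i _; rewrite invr_ge0 ltW.
(* The weights [tau a / t i a] add up to [1], so the power [tau] of the product of the averages is
   at most the sum of their powers [t i]. *)
pose tau a := (itau a)^-1.
(* Up to an error [m e / 2], $(1+2e)/\tau$ is at least $\sum_i1/p_i=\alpha+1/q$. Since $1/q\le m$,
   the surplus $\alpha\ge8em$ pays for this error and for the factors $1+2e$ and $1-e$. *)
have slack_q a x : Q a x -> tau a <= (1 - e) * q x \/ ((a.1 <= k0)%R /\ cl k0 x \in S).
  move=> ax; case: (boolP ((a.1 <= k0)%R && (cl k0 x \in S))) => [/andP[]|/negP nS].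
    by right.
  have rl i : `|p i x - rho i a| <= e / 2.
    case: (rhoP i a x (or_introl ax)) => // -[h1 h2].
    by exfalso; apply: nS; rewrite h1 h2.
  have rV i : (p i x)^-1 - e / 2 <= (rho i a)^-1.
    have h1 := p1 i x; have h2 := rho1 i a; have h3 := rl i.
    have pi0 : 0 < p i x by lra.
    have rh0 : 0 < rho i a by lra.
    rewrite lerBlDr -lerBlDl.
    have -> : (p i x)^-1 - (rho i a)^-1 = (rho i a - p i x) / (p i x * rho i a).
      by field; rewrite !gt_eqF.
    rewrite ler_pdivrMr ?mulr_gt0//.
    have : rho i a - p i x <= e / 2 by move: h3; rewrite ler_norml; lra.
    have : 1 <= p i x * rho i a by nra.
    nra.
  left; rewrite /tau -[X in _ <= X]invrK lef_pV2 ?posrE ?invr_gt0//; last first.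
    by rewrite mulr_gt0 ?q0//; lra.
  have itauE : (1 + 2 * e) * itau a = \sum_i (rho i a)^-1.
    rewrite mulr_sumr; apply: eq_bigr => i _; rewrite invfM mulrA divff ?mul1r//.
    by rewrite gt_eqF//; lra.
  have h1 : \sum_i ((p i x)^-1 - e / 2) <= \sum_i (rho i a)^-1.
    by apply: ler_sum => i _.
  rewrite sumrB sumr_const card_ord -itauE in h1.
  have h2 := pq x.
  have qV0 : 0 < (q x)^-1 by rewrite invr_gt0.
  have h3 : \sum_i (p i x)^-1 <= m%:R.
    apply: (@le_trans _ _ (\sum_(i < m) 1)); last by rewrite sumr_const card_ord.
    by apply: ler_sum => i _; rewrite invf_le1 ?ltW// (lt_trans ltr01).
  rewrite invfM ler_pdivrMl; last lra.
  rewrite -mulr_natr in h1.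
  move: (itau a) (\sum_i _) (q x)^-1 h1 h2 h3 qV0 (itau0 a) => y P Z h1 h2 h3 Z0 y0.
  have hA : alpha - m%:R * e / 2 + Z <= (1 + 2 * e) * y by lra.
  have : (1 + 2 * e) * Z <= (1 - e) * ((1 + 2 * e) * y).
    apply: (@le_trans _ _ ((1 - e) * (alpha - m%:R * e / 2 + Z))); last first.
      by rewrite ler_pM2l//; lra.
    have : e * Z <= e * m%:R by rewrite ler_pM2l//; lra.
    have : 0 <= (8^-1 - e) * (alpha - m%:R * e / 2) by rewrite mulr_ge0//; nra.
    nra.
  rewrite mulrCA ler_pM2l//; lra.
have slack_p i a x s : Q a x ->
    (1 + e) * p i x <= t i (a.1, shV s a.2) \/ ((a.1 <= k0)%R /\ cl k0 x \in S).
  move=> ax; have := rhoP i (a.1, shV s a.2) x; case.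
  - by right; exists s; rewrite /= shVK -surjective_pairing.
  - move=> h; left; rewrite /t; have h1 := rho1 i (a.1, shV s a.2).
    have : p i x <= rho i (a.1, shV s a.2) + e / 2.
      by move: h; rewrite ler_norml; lra.
    nra.
  - by right.
pose Ce := 4 / (1 - kap `^ e) + 4 / (1 - kap) * (size S)%:R.
have Ce0 : 0 <= Ce.
  have /andP[h1 h2] := powR_lt1 kap01 e0; have /andP[h3 h4] := kap01.
  apply: addr_ge0; first by apply: divr_ge0 => //; rewrite subr_ge0 ltW.
  by apply: mulr_ge0 => //; apply: divr_ge0 => //; rewrite subr_ge0 ltW.
pose B := \sum_(i < m) \sum_(s : Delta) Ce.
pose A := (4 / (1 - kap `^ e)) `^ qhi * (B + 4 / (1 - kap `^ qlo) * (size S)%:R).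
pose K' := K * (2 * M) ^+ m.
have K'1 : 1 <= K'.
  rewrite -[1]mulr1 ler_pM// exprn_ege1//.
  have : 1 <= M by rewrite ler1n.
  lra.
have K'0 : 0 < K' by exact: lt_le_trans K'1.
exists (K' `^ qhi * (A + 1)).
  rewrite mulr_gt0 ?powR_gt0// ltr_wpDl// mulr_ge0 ?powR_ge0// addr_ge0//.
    by rewrite /B sumr_ge0// => i _; rewrite sumr_ge0.
  rewrite mulr_ge0// divr_ge0// subr_ge0 ltW//.
  by case/andP: (powR_lt1 kap01 qlo0).
move=> F mF F0 F1.
pose c' i a : R := fine (\int[mu]_(x in Q a) (F i x * g (Some i) x / N (Some i) a)%:E).
have Fg0 i x : 0 <= F i x * g (Some i) x by rewrite mulr_ge0// ltW.
have FgN0 i a x : 0 <= F i x * g (Some i) x / N (Some i) a.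
  by rewrite divr_ge0// ltW.
have c'2 i a : (\int[mu]_(x in Q a) (F i x * g (Some i) x / N (Some i) a)%:E <= 2%:E)%E.
  apply: (@cell_avg_le2 _ _ _ mu D J cl mD mcell (N (Some i)) _ (p i) (F i)
    (g (Some i)) plo) => // b; exact: (modN (Some i) b).
have c'E i a : (\int[mu]_(x in Q a) (F i x * g (Some i) x / N (Some i) a)%:E = (c' i a)%:E)%E.
  rewrite fineK// ge0_fin_numE; first exact: le_lt_trans (c'2 i a) (ltry _).
  by apply: integral_ge0 => x _; rewrite lee_fin.
have c'02 i a : 0 <= c' i a <= 2.
  rewrite -!lee_fin -c'E c'2 andbT.
  by apply: integral_ge0 => x _; rewrite lee_fin.
have intE i a : (\int[mu]_(x in Q a) (F i x * (w i x)^-1)%:E =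
    (N (Some i) a * c' i a)%:E)%E.
  rewrite EFinM -c'E -integralZl_ge0//; last by move=> x _; rewrite lee_fin.
  apply: eq_integral => x _; rewrite -EFinM; congr EFin.
  by rewrite mulrCA divff ?mulr1// gt_eqF.
split; first by move=> i a; rewrite intE ltry.
have energy i s : (\esum_(a in [set: int * J])
    ((c' i (a.1, sh s a.2) / 2) `^ t i a)%:E <= Ce%:E)%E.
  have e02 : 0 < e <= 1 - plo^-1 by rewrite e0.
  have en : (\esum_(a in [set: int * J])
      ((c' i a / 2) `^ t i (a.1, shV s a.2))%:E <= Ce%:E)%E.
    exact: (@cell_energy _ _ _ mu D J cl mD mcell k0 S (N (Some i)) kap (N0 (Some i))
      kap01 (N_decay (Some i)) (p i) (F i) (g (Some i))
      (fun a => t i (a.1, shV s a.2)) plo e (mp i) (mF i) (mg (Some i)) plo1 (plop i)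
      (F0 i) (g0 (Some i)) (modN (Some i)) (F1 i) e02 (fun a => t1 _ _)
      (fun a x => @slack_p i a x s)).
  by rewrite (esum_shift (c' i) (t i) s).
(* Each [c'] is at most [2]; halving and averaging over the [M] neighbours gives a number in
   $[0,1]$. The power of [2 * M] in [K'] undoes this. *)
pose ci i a := (\sum_s c' i (a.1, sh s a.2) / 2) / M.
have ci0 i a : 0 <= ci i a.
  rewrite /ci divr_ge0 ?(ltW M0)// sumr_ge0// => s _.
  by rewrite divr_ge0//; case/andP: (c'02 i (a.1, sh s a.2)).
have ci_le i a y : (forall s, c' i (a.1, sh s a.2) / 2 <= y) -> ci i a <= y.
  move=> h; rewrite /ci ler_pdivrMr//.
  apply: (@le_trans _ _ (\sum_(s : Delta) y)); first exact: ler_sum.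
  by rewrite sumr_const mulr_natr.
have ci1 i a : ci i a <= 1.
  apply: ci_le => s; have /andP[_] := c'02 i (a.1, sh s a.2); lra.
have cit i a : ci i a `^ t i a <= \sum_s (c' i (a.1, sh s a.2) / 2) `^ t i a.
  set Y := \sum_s _.
  have Y0 : 0 <= Y by apply: sumr_ge0 => s _; exact: powR_ge0.
  have ciY : ci i a <= Y `^ (t i a)^-1.
    apply: ci_le => s; apply: le_powR_root => //.
      by rewrite divr_ge0//; case/andP: (c'02 i (a.1, sh s a.2)).
    rewrite /Y (bigD1 s)//= lerDl sumr_ge0// => s' _; exact: powR_ge0.
  have -> : Y = (Y `^ (t i a)^-1) `^ t i a by rewrite -powRrM mulVf ?powRr1// gt_eqF.
  by rewrite ge0_ler_powR ?nnegrE ?powR_ge0// ltW.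
pose cP a := \prod_i ci i a.
have cP01 a : 0 <= cP a <= 1.
  rewrite prodr_ge0//=; apply: (@le_trans _ _ (\prod_(i < m) 1)); last by rewrite big1.
  by apply: ler_prod => i _; rewrite ci0 ci1.
have cPN0 a : 0 <= cP a / N None a.
  by rewrite divr_ge0 ?(ltW (N0 _ _))//; case/andP: (cP01 a).
have cPB : (\esum_(a in [set: int * J]) (cP a `^ tau a)%:E <= B%:E)%E.
  apply: (@le_trans _ _ (\esum_(a in [set: int * J]) \sum_(i < m) \sum_(s : Delta)
      ((c' i (a.1, sh s a.2) / 2) `^ t i a)%:E)%E).
    apply: le_esum => a _; under eq_bigr do rewrite sumEFin.
    rewrite sumEFin lee_fin.
    apply: (@le_trans _ _ (\sum_(i < m) ci i a `^ t i a)); last exact: ler_sum.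
    have := @prod_powR_le_sum R 'I_m (fun i => ci i a `^ t i a) (fun i => tau a / t i a)
      (fun i => powR_ge0 _ _).
    have -> : \prod_(j < m) (ci j a `^ t j a) `^ (tau a / t j a) = cP a `^ tau a.
      rewrite powR_prod//; apply: eq_bigr => i _; rewrite -powRrM; congr (_ `^ _).
      by field; rewrite gt_eqF.
    apply.
      by move=> i; rewrite divr_ge0 ?ltW// invr_gt0.
    by rewrite -mulr_sumr /tau mulVf// gt_eqF.
  rewrite esum_sum; last first.
    by move=> a i _ _; apply: sume_ge0 => s _; rewrite lee_fin powR_ge0.
  rewrite /B -sumEFin; apply: lee_sum => i _.
  rewrite esum_sum; last by move=> a s _ _; rewrite lee_fin powR_ge0.
  by rewrite -sumEFin; apply: lee_sum => s _; exact: energy.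
have := @cell_assemble _ _ _ mu D J cl mD mcell k0 S (N None) kap (N0 None) kap01
  (N_decay None) q W cP tau qlo qhi e B mq (mg None) qlo0 qloq qqhi W0 (modN None) cP01.
have -> : 0 < e < 1 by rewrite e0 /=; lra.
move=> /(_ isT slack_q cPB); rewrite -/A => hA.
apply: (@le_trans _ _ (\int[mu]_(x in D) ((K' `^ qhi)%:E *
  ((W x)%:E * \esum_(k in [set: int]) (cP (k, cl k x) / N None (k, cl k x))%:E) `^ q x))%E).
  apply: le_integral_ge0 => x Dx; first exact: poweR_ge0.
  have e0' : (0 <= \esum_(k in [set: int]) (cP (k, cl k x) / N None (k, cl k x))%:E)%E.
    by apply: esum_ge0 => k _; rewrite lee_fin.
  apply: (@le_trans _ _ (((K')%:E * ((W x)%:E * \esum_(k in [set: int])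
      (cP (k, cl k x) / N None (k, cl k x))%:E)) `^ q x)%E); last first.
    rewrite poweRM ?mule_ge0 ?lee_fin ?(ltW (W0 _)) ?(ltW K'0)//.
    by rewrite lee_wpmul2r ?poweR_ge0// poweR_EFin lee_fin ler_powR.
  apply: gt0_ler_poweR; rewrite ?(ltW (q0 x))// ?in_itv/= ?leey ?andbT.
  - rewrite mule_ge0 ?lee_fin ?(ltW (W0 _))//; apply: esum_ge0 => k _.
    rewrite lee_fin mulr_ge0 ?invr_ge0 ?powR_ge0// prodr_ge0// => i _.
    by rewrite sumr_ge0// => s _; rewrite intE /= mulr_ge0 ?(ltW (N0 _ _))//;
      case/andP: (c'02 i (k, sh s (cl k x))).
  - by rewrite !mule_ge0 ?lee_fin ?(ltW (W0 _)) ?(ltW K'0).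
  rewrite muleCA lee_wpmul2l ?lee_fin ?(ltW (W0 _))// -esumZ ?(ltW K'0)//; last first.
    by move=> k; rewrite lee_fin.
  apply: le_esum => k _; rewrite -EFinM lee_fin.
  set a := (k, cl k x).
  have Vb0 : 0 < V k `^ beta by rewrite powR_gt0.
  rewrite ler_pdivrMl//.
  have h1 i : \sum_s fine (\int[mu]_(y in Q (k, sh s (cl k x))) (F i y * (w i y)^-1)%:E)
      <= nB a (Some i) * (2 * M * ci i a).
    have -> : 2 * M * ci i a = \sum_s c' i (k, sh s (cl k x)).
      rewrite /ci -mulr_suml /=; field; by rewrite gt_eqF.
    rewrite mulr_sumr; apply: ler_sum => s _; rewrite intE /=.
    rewrite ler_wpM2r//; first by case/andP: (c'02 i (k, sh s (cl k x))).
    exact: (NshB (Some i) a s).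
  apply: (@le_trans _ _ (\prod_i (nB a (Some i) * (2 * M * ci i a)))).
    apply: ler_prod => i _; rewrite h1 andbT sumr_ge0// => s _.
    rewrite intE /= mulr_ge0 ?(ltW (N0 _ _))//.
    by case/andP: (c'02 i (k, sh s (cl k x))).
  have -> : \prod_i (nB a (Some i) * (2 * M * ci i a)) =
      \prod_(i < m) nB a (Some i) * ((2 * M) ^+ m * cP a).
    by rewrite /cP big_split/= [in X in _ * X]big_split/= prodr_const card_ord.
  (* The norms over the ball dominate the norm of the product weight on the cell itself, which may
     thus replace the factor of index [None]. *)
  have := nBK a; rewrite big_option /= => h2.
  have n0 := N0 None a; have nl := NleB None a.
  have P0 : 0 < \prod_(i < m) nB a (Some i) by apply: prodr_gt0.
  have h3 : N None a * \prod_(i < m) nB a (Some i) <= K * V k `^ beta.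
    by apply: le_trans h2; rewrite ler_pM2r.
  have /andP[cPa _] := cP01 a.
  have -> : V k `^ beta * (K' * (cP a / N None a)) =
      (K * V k `^ beta / N None a) * ((2 * M) ^+ m * cP a) by rewrite /K'; ring.
  rewrite ler_wpM2r ?mulr_ge0// ?exprn_ge0 ?mulr_ge0 ?(ltW M0)//.
  by rewrite ler_pdivlMr// mulrC.
rewrite integralZl_ge0 ?powR_gt0//; last by move=> x _; exact: poweR_ge0.
rewrite EFinM; apply: lee_wpmul2l; first by rewrite lee_fin powR_ge0.
by apply: le_trans hA _; rewrite lee_fin lerDl.
Qed.

End sufficiency.

(** * Dyadic cells and balls in Euclidean space *)

Section euclid.
Context {R : realType} {n : nat}.
Local Notation E := 'Eucl_(n, R).
Implicit Types (x y : E) (k : int) (j : n.-tuple int).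

Definition co x i : R := tnth x i.

Lemma measurable_co i : measurable_fun [set: E] (fun x => co x i).
Proof. exact: measurable_tnth. Qed.

Lemma measurable_box (A : 'I_n -> set R) : (forall i, measurable (A i)) ->
  measurable [set x : E | forall i, A i (co x i)].
Proof.
move=> mA; rewrite (_ : [set _ | _] = \bigcap_(i in [set: 'I_n])
    ((fun x : E => co x i) @^-1` A i)); last first.
  by apply/seteqP; split=> [t tA i _|t tA i]; exact: tA.
apply: fin_bigcap_measurable => // i _; rewrite -[X in measurable X]setTI.
exact: measurable_co.
Qed.

Lemma leb_box (A : 'I_n -> set R) : (forall i, measurable (A i)) ->
  leb R n [set x : E | forall i, A i (co x i)] =
  (\prod_(i < n) lebesgue_measure (A i))%E.
Proof. by move=> mA; rewrite /leb (tuple_measureX (@lebesgue_measure R)). Qed.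

Lemma eucl_dist_ge x y i : `|co x i - co y i| <= eucl_dist x y.
Proof.
rewrite /eucl_dist -sqrtr_sqr ler_wsqrtr// (bigD1 i)//= lerDl.
by apply: sumr_ge0 => l _; exact: sqr_ge0.
Qed.

Lemma eucl_dist_le x y : eucl_dist x y <= \sum_i `|co x i - co y i|.
Proof.
rewrite /eucl_dist; set s := \sum_i `|_|.
have s0 : 0 <= s by apply: sumr_ge0.
rewrite -[leRHS](ger0_norm s0) -sqrtr_sqr ler_wsqrtr//.
rewrite expr2 {1}/s mulr_suml; apply: ler_sum => i _.
rewrite -real_normK ?num_real// expr2 ler_wpM2l//.
by rewrite /s (bigD1 i)//= lerDl sumr_ge0.
Qed.

Lemma eucl_dist_ge0 x y : 0 <= eucl_dist x y.
Proof. exact: sqrtr_ge0. Qed.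

Lemma eucl_dist_le_max x y (e : R) : (forall i, `|co x i - co y i| <= e) ->
  eucl_dist x y <= n%:R * e.
Proof.
move=> h; apply: le_trans (eucl_dist_le x y) _.
apply: (@le_trans _ _ (\sum_(i < n) e)); first exact: ler_sum.
by rewrite sumr_const card_ord mulr_natl.
Qed.

Lemma eucl_norm_ge x i : `|co x i| <= eucl_norm x.
Proof.
rewrite /eucl_norm -sqrtr_sqr ler_wsqrtr// (bigD1 i)//= lerDl.
by apply: sumr_ge0 => l _; exact: sqr_ge0.
Qed.

Lemma measurable_eucl_dist x : measurable_fun [set: E] (fun y => eucl_dist x y).
Proof.
rewrite (_ : (fun y => _) = (fun y => (\sum_(i < n) (co x i - co y i) ^+ 2) `^ 2^-1)).
  apply: measurable_fun_powR2 => //; apply: measurable_sum => i.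
  apply: measurable_funX; apply: measurable_funB => //; exact: measurable_co.
apply/funext => y; rewrite powR12_sqrt// sumr_ge0// => i _; exact: sqr_ge0.
Qed.

Lemma measurable_eucl_ball x r : measurable (eucl_ball x r).
Proof.
rewrite (_ : eucl_ball x r = (fun y => eucl_dist x y) @^-1` [set` `]-oo, r[]).
  rewrite -[X in measurable X]setTI; exact: measurable_eucl_dist.
by apply/seteqP; split => y /=; rewrite in_itv.
Qed.

Definition side k : R := 2 ^ (- k).

Lemma side_gt0 k : 0 < side k. Proof. by rewrite exprz_gt0. Qed.

Lemma sideS k : side k = side (k + 1) * 2.
Proof.
have two0 : (2 : R) != 0 by rewrite pnatr_eq0.
by rewrite /side opprD (expfzDr _ _ two0) -mulrA exprN1 mulVf// mulr1.
Qed.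

Lemma side_between (r : R) : 0 < r -> exists k, side (k + 1) <= r < side k.
Proof.
move=> r0; have l2 : 0 < ln (2 : R) by rewrite ln_gt0// ltr1n.
pose z : int := Num.floor (ln r / ln 2).
have E z' : (2 : R) ^ z' = expR (z'%:~R * ln 2).
  by rewrite -powR_intmul// /powR pnatr_eq0.
exists (- z - 1); rewrite /side subrK opprK opprB opprK [(1 + z)%R]addrC.
have /andP[h1 h2] := floor_itv (ln r / ln 2).
rewrite !E -[r in _ <= r](lnK (r0 : r \is Num.pos)) -[r in r < _](lnK (r0 : r \is Num.pos)).
by rewrite ler_expR ltr_expR -ler_pdivlMr// -ltr_pdivrMr// h1.
Qed.

Lemma side_small (r : R) : 0 < r -> exists k0, forall k, (k0 < k)%R -> side k <= r.
Proof.
move=> r0; have [k /andP[h _]] := side_between r0.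
exists k => l kl; apply: le_trans h; rewrite /side.
by rewrite ler_weXz2l// ?ler1n//; lia.
Qed.

Definition cl k x : n.-tuple int := [tuple Num.floor (co x i / side k) | i < n].

Lemma clE k x j : cl k x = j <->
  forall i, (tnth j i)%:~R * side k <= co x i < (tnth j i + 1)%:~R * side k.
Proof.
have s0 := side_gt0 k; split => [<- i|h].
  by rewrite /cl tnth_mktuple -ler_pdivlMr// -ltr_pdivrMr// floor_itv.
apply: eq_from_tnth => i; rewrite tnth_mktuple; apply/eqP.
by rewrite floor_eq ler_pdivlMr// ltr_pdivrMr.
Qed.

Variable (D : set E).
Hypotheses (mD : measurable D) (D0 : leb R n (~` D) = 0%E).
Local Notation Q := (cell D cl).

Lemma leb_setID (A : set E) : measurable A -> leb R n (D `&` A) = leb R n A.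
Proof.
move=> mA; rewrite -[A in RHS](setIT A) -(setUv D) setIUr measureU//.
- rewrite [X in (_ + X)%E](_ : _ = 0%E) ?adde0 1?setIC//.
  apply/eqP; rewrite eq_le measure_ge0 andbT -D0.
  apply: le_measure; rewrite ?inE//; [apply: measurableI => //|]; exact: measurableC.
- exact: measurableI.
- by apply: measurableI => //; exact: measurableC.
- by rewrite setIACA setICr setI0.
Qed.

Let itv k (z : int) : set R := [set` `[z%:~R * side k, (z + 1)%:~R * side k[].

Let cl_box a : cl a.1 @^-1` [set a.2] =
  [set x : E | forall i, itv a.1 (tnth a.2 i) (co x i)].
Proof.
apply/seteqP; split => x /=; rewrite clE => h i; have := h i; by rewrite /itv /= in_itv.
Qed.

Let mitv k z : measurable (itv k z). Proof. exact: measurable_itv. Qed.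

Lemma measurable_cell a : measurable (Q a).
Proof.
apply: measurableI => //; rewrite cl_box.
exact: (measurable_box (fun i => mitv a.1 (tnth a.2 i))).
Qed.

Lemma leb_cell a : leb R n (Q a) = (side a.1 ^+ n)%:E.
Proof.
rewrite leb_setID; last by rewrite cl_box; exact: (measurable_box (fun i => mitv a.1 (tnth a.2 i))).
rewrite cl_box (leb_box (fun i => mitv a.1 (tnth a.2 i))).
rewrite (eq_bigr (fun=> (side a.1)%:E)); last first.
  move=> i _; rewrite /itv lebesgue_measure_itv/= lte_fin ltr_pM2r ?side_gt0//.
  rewrite ltr_int ltrDl ltr01 -EFinB -mulrBl intrD [X in X * _](_ : _ = 1) ?mul1r//.
  by rewrite addrAC subrr add0r.
by rewrite prodEFin prodr_const card_ord.
Qed.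

Lemma cell_nested k x : cl (k + 1) @^-1` [set cl (k + 1) x] `<=` cl k @^-1` [set cl k x].
Proof.
move=> y /= /clE h; apply/clE => i; have := h i; rewrite !tnth_mktuple.
have s0 := side_gt0 (k + 1); rewrite (sideS k).
set s := side (k + 1) in s0 *; set xi := co x i; set yi := co y i.
have s20 : 0 < s * 2 by rewrite mulr_gt0.
have := floor_itv (xi / s); have := floor_itv (xi / (s * 2)).
rewrite ler_pdivlMr// ltr_pdivrMr// ler_pdivlMr// ltr_pdivrMr//.
set z2 := Num.floor (xi / (s * 2)); set z1 := Num.floor (xi / s).
move=> /andP[a1 a2] /andP[b1 b2] /andP[c1 c2].
(* Comparisons of multiples of [s] are read off on integers, where strictness gains a unit; hence
   the finer interval lies inside the coarser one. *)
have e1 : 2 * z2 < z1 + 1.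
  rewrite -(ltr_int R) -(ltr_pM2r s0); apply: le_lt_trans b2.
  by rewrite intrM; lra.
have e2 : z1 < 2 * (z2 + 1).
  rewrite -(ltr_int R) -(ltr_pM2r s0); apply: le_lt_trans b1 _.
  by rewrite intrM; lra.
have e1' : 2 * z2 <= z1 by lia.
have e2' : z1 + 1 <= 2 * (z2 + 1) by lia.
rewrite -(ler_int R) -(ler_pM2r s0) intrM in e1'.
rewrite -(ler_int R) -(ler_pM2r s0) intrM in e2'.
apply/andP; split; lra.
Qed.

(** Offsets $0,1,2$ lowered by $1$ give the $3^n$ cells adjacent to the given one, itself
    included. *)
Definition shift_index (s : n.-tuple 'I_3) j : n.-tuple int :=
  [tuple tnth j i + (tnth s i : nat)%:Z - 1 | i < n].

Definition unshift_index (s : n.-tuple 'I_3) j : n.-tuple int :=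
  [tuple tnth j i - ((tnth s i : nat)%:Z - 1) | i < n].

Lemma shift_indexK s : cancel (shift_index s) (unshift_index s).
Proof. by move=> j; apply: eq_from_tnth => i; rewrite !tnth_mktuple; lia. Qed.

Lemma unshift_indexK s : cancel (unshift_index s) (shift_index s).
Proof. by move=> j; apply: eq_from_tnth => i; rewrite !tnth_mktuple; lia. Qed.

Lemma near_cell k x y : (forall i, `|co x i - co y i| < side k) ->
  exists s, cl k y = shift_index s (cl k x).
Proof.
move=> h; pose z i := (Num.floor (co y i / side k) - Num.floor (co x i / side k) + 1)%R.
have s0 := side_gt0 k.
have hz i : (0 <= z i <= 2)%R.
  have := h i; rewrite ltr_norml => /andP[h1 h2].
  have := floor_itv (co y i / side k); have := floor_itv (co x i / side k).
  rewrite !ler_pdivlMr// !ltr_pdivrMr// /z.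
  set a := Num.floor (co x i / side k); set b := Num.floor (co y i / side k).
  move=> /andP[a1 a2] /andP[b1 b2].
  have : (b < a + 1 + 1)%R.
    by rewrite -(ltr_int R) -(ltr_pM2r s0); apply: le_lt_trans b1 _; rewrite (intrD _ (a + 1)); lra.
  have : (a < b + 1 + 1)%R.
    by rewrite -(ltr_int R) -(ltr_pM2r s0); apply: le_lt_trans a1 _; rewrite (intrD _ (b + 1)); lra.
  lia.
exists [tuple inord `|z i|%N | i < n]; apply: eq_from_tnth => i.
rewrite !tnth_mktuple inordK; last by have := hz i; lia.
by have := hz i; rewrite /z; lia.
Qed.

Definition corner a : E := [tuple (tnth a.2 i)%:~R * side a.1 | i < n].

Lemma corner_near a x : cl a.1 x = a.2 \/ (exists s, cl a.1 x = shift_index s a.2) ->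
  eucl_dist (corner a) x <= n%:R * (2 * side a.1).
Proof.
have s0 := side_gt0 a.1.
move=> h; apply: eucl_dist_le_max => i; rewrite {1}/co tnth_mktuple ler_norml.
case: h => [/clE /(_ i)|[s /clE /(_ i)]].
  by rewrite intrD mulrDl mul1r; lra.
rewrite tnth_mktuple !intrD !mulrDl.
have : (0 <= (tnth s i : nat)%:Z%:~R :> R) by rewrite ler0z.
have : ((tnth s i : nat)%:Z%:~R <= 2 :> R).
  by have := ltn_ord (tnth s i); rewrite -[2]/(2%:Z%:~R) ler_int; lia.
move: ((tnth s i : nat)%:Z%:~R) => u u2 u0.
have : u * side a.1 <= 2 * side a.1 by rewrite ler_pM2r.
have : 0 <= u * side a.1 by rewrite mulr_ge0// ltW.
rewrite rmorphN/= !mulNr !mul1r; lra.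
Qed.

(** The corner is within $2n$ sides of each point of the cell and its neighbours; the factor $3n$
    leaves room for the strict inequality of an open ball. *)
Definition big_ball a : set E := D `&` eucl_ball (corner a) (3 * n%:R * side a.1).

Lemma leb_ball_le x r : 0 < r -> (leb R n (eucl_ball x r) <= ((2 * r) ^+ n)%:E)%E.
Proof.
move=> r0; pose A i : set R := [set` `]co x i - r, co x i + r[].
have mA i : measurable (A i) by exact: measurable_itv.
apply: (@le_trans _ _ (leb R n [set y : E | forall i, A i (co y i)])).
  apply: le_measure; rewrite ?inE//; [exact: measurable_eucl_ball|exact: measurable_box mA|].
  move=> y /= h i; rewrite /A /= in_itv/=.
  have := le_lt_trans (eucl_dist_ge x y i) h; rewrite ltr_norml; lra.
rewrite (leb_box mA) (eq_bigr (fun=> (2 * r)%:E)); last first.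
  move=> i _; rewrite /A lebesgue_measure_itv/= lte_fin ifT; last lra.
  by rewrite -EFinB; congr EFin; ring.
by rewrite prodEFin prodr_const card_ord.
Qed.

Hypothesis n0 : (0 < n)%N.

(** A child has $2^{-n}$ times the measure of its parent, hence at most half of it. *)
Lemma cell_thick k x : D x ->
  ((2^-1 * side k ^+ n)%:E <= leb R n (Q (k, cl k x) `\` Q ((k + 1)%R, cl (k + 1)%R x)))%E.
Proof.
move=> Dx; have s0 := side_gt0 (k + 1).
have QQ : Q ((k + 1)%R, cl (k + 1)%R x) `<=` Q (k, cl k x).
  by move=> y [Dy /cell_nested].
have mQ := measurable_cell (k, cl k x).
have mQ' := measurable_cell ((k + 1)%R, cl (k + 1)%R x).
have fQ : (leb R n (Q (k, cl k x)) < +oo)%E by rewrite leb_cell ltry.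
have -> : leb R n (Q (k, cl k x) `\` Q ((k + 1)%R, cl (k + 1)%R x)) =
    (leb R n (Q (k, cl k x)) - leb R n (Q ((k + 1)%R, cl (k + 1)%R x)))%E.
  by rewrite -[X in (_ - leb R n X)%E](setIidr QQ); exact: measureD.
rewrite !leb_cell -EFinB lee_fin /= (sideS k) exprMn.
have sn : 0 < side (k + 1) ^+ n by rewrite exprn_gt0.
have : (2 : R) <= 2 ^+ n.
  by rewrite -[leLHS]expr1 ler_weXn2l ?ler1n.
move: (side (k + 1) ^+ n) (2 ^+ n) sn => s t sn ht.
have : s * 2 <= s * t by rewrite ler_pM2l.
lra.
Qed.

Lemma corner_near_ball a : [set x | cl a.1 x = a.2 \/ (exists s, cl a.1 x = shift_index s a.2)]
  `<=` eucl_ball (corner a) (3 * n%:R * side a.1).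
Proof.
move=> x /corner_near h; rewrite /eucl_ball /=; apply: le_lt_trans h _.
rewrite mulrA ltr_pM2r ?side_gt0//.
have : 0 < n%:R :> R by rewrite ltr0n.
lra.
Qed.

(** By comparison with the sum of the coordinate distances, the ball contains the cube of half-side
    [r / n]. Two crude cubes replace the exact volume throughout. *)
Lemma leb_ball_ge x r : 0 < r -> (((2 * r / n%:R) ^+ n)%:E <= leb R n (eucl_ball x r))%E.
Proof.
move=> r0; have nR : 0 < n%:R :> R by rewrite ltr0n.
set e := r / n%:R; have e0 : 0 < e by rewrite divr_gt0.
have ne : n%:R * e = r by rewrite /e mulrC divfK// gt_eqF.
pose A i : set R := [set` `]co x i - e, co x i + e[].
have mA i : measurable (A i) by exact: measurable_itv.
apply: (@le_trans _ _ (leb R n [set y : E | forall i, A i (co y i)])); last first.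
  apply: le_measure; rewrite ?inE//; [exact: measurable_box mA|exact: measurable_eucl_ball|].
  move=> y h; rewrite /eucl_ball /=; apply: le_lt_trans (eucl_dist_le x y) _.
  rewrite -ne (_ : n%:R * e = \sum_(i < n) e); last by rewrite sumr_const card_ord mulr_natl.
  apply: ltr_sum; first by apply/hasP; exists (Ordinal n0); rewrite ?mem_index_enum.
  move=> i _; have := h i; rewrite /A /= in_itv/= ltr_norml; lra.
rewrite (leb_box mA) (eq_bigr (fun=> (2 * r / n%:R)%:E)); last first.
  move=> i _; rewrite /A lebesgue_measure_itv/= lte_fin ifT; last lra.
  by rewrite -EFinB; congr EFin; rewrite /e; ring.
by rewrite prodEFin prodr_const card_ord.
Qed.

End euclid.

(** * Borel versions and integrals off null sets *)

Section null_sets.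
Import HBNNSimple.
Context d (T : measurableType d) (R : realType) (mu : {measure set T -> \bar R}).

(** For each rational level the superlevel set is Borel up to a null set. These countably many null
    sets lie in one Borel null set [Z], off which the rational levels determine all others. *)
Lemma ereal_borel_version (f : T -> \bar R) :
  (forall Y : set (\bar R), measurable Y -> completed_algebra_gen mu (f @^-1` Y)) ->
  exists Z, [/\ measurable Z, mu Z = 0%E & measurable_fun (~` Z) f].
Proof.
move=> mf; pose q_ n : R := odflt 0 (omap (@ratr R) (unpickle n)).
have /choice[BN hBN] n : exists BN : set T * set T,
    [/\ measurable BN.1, mu.-negligible BN.2 &
      BN.1 `|` BN.2 = f @^-1` [set y | ((q_ n)%:E < y)%E]].
  have [|B mB [N hN e]] := mf [set y | ((q_ n)%:E < y)%E].
    have := @emeasurable_fun_o_infty _ _ R setT id measurableT (@measurable_id _ _ _) (q_ n)%:E.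
    by rewrite setTI.
  by exists (B, N).
have [Z [mZ Z0 NZ]] : mu.-negligible (\bigcup_n (BN n).2).
  by apply: negligible_bigcup => n; case: (hBN n).
exists Z; split => //.
have mZC : measurable (~` Z) by exact: measurableC.
have mq n : measurable (~` Z `&` f @^-1` [set y | ((q_ n)%:E < y)%E]).
  case: (hBN n) => mB _ <-; rewrite setIUr [X in _ `|` X](_ : _ = set0).
    by rewrite setU0; exact: measurableI.
  by rewrite -subset0 => x [nZ Nx]; apply: nZ; apply: NZ; exists n.
apply: (measurability _ (ErealGenOInfty.measurableE R)) => // _ [_ [r ->] <-].
rewrite [X in measurable X](_ : _ = \bigcup_(n in [set n | r <= q_ n])
    (~` Z `&` f @^-1` [set y | ((q_ n)%:E < y)%E])).
  by apply: bigcup_measurable => n _; exact: mq.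
apply/seteqP; split => x /=.
  move=> [nZ]; rewrite in_itv/= andbT => rf.
  have [s [rs sf]] : exists s : rat, r <= ratr s /\ ((ratr s)%:E < f x)%E.
    move: rf; case: (f x) => [y| |]//; last first.
      have /rat_in_itvoo[s] : r < r + 1 by rewrite ltrDl.
      by rewrite in_itv/= => /andP[rs _] _; exists s; rewrite ltry ltW.
    rewrite lte_fin => /rat_in_itvoo[s]; rewrite in_itv/= => /andP[rs sy].
    by exists s; rewrite lte_fin sy ltW.
  have qs : q_ (pickle s) = ratr s by rewrite /q_ pickleK.
  by exists (pickle s); rewrite /= qs.
move=> [n /= rq [nZ qf]]; split => //; rewrite in_itv/= andbT.
by apply: le_lt_trans qf; rewrite lee_fin.
Qed.

Variable (D : set T).
Hypotheses (mD : measurable D) (D0 : mu (~` D) = 0%E).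

(* [f] need not be measurable: its integral is a supremum over simple functions
   below it, and these may be cut off outside [D]. *)
Lemma integral_conull (f : T -> \bar R) : (forall x, 0 <= f x)%E ->
  (\int[mu]_x f x = \int[mu]_(x in D) f x)%E.
Proof.
move=> f0; apply/eqP; rewrite eq_le; apply/andP; split.
  rewrite ge0_integralTE//; apply: ge_ereal_sup => _ [h hf <-].
  have h0 x : (0 <= (h x)%:E)%E by rewrite lee_fin fun_ge0.
  rewrite -integralT_nnsfun (@ge0_negligible_integral _ _ _ mu setT (~` D))//.
  - by rewrite setTD setCK; apply: le_integral_ge0 => x _; [exact: h0|exact: hf].
  - exact: measurableC.
  - exact/measurable_EFinP.
rewrite (integral_mkcond D); apply: le_integral_ge0 => x _; rewrite /patch; case: ifP => //.
Qed.

Lemma integral_conull_in (A : set T) (f : T -> \bar R) :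
  (forall x, A x -> 0 <= f x)%E ->
  (\int[mu]_(x in A) f x = \int[mu]_(x in D `&` A) f x)%E.
Proof.
move=> f0; rewrite integral_mkcond integral_conull; last first.
  by move=> x; rewrite /patch; case: ifPn => //; rewrite inE => /f0.
by rewrite integral_mkcondr.
Qed.

Lemma integral_eq_conull (A : set T) (f g : T -> \bar R) :
  (forall x, A x -> 0 <= f x)%E -> (forall x, A x -> 0 <= g x)%E ->
  (forall x, D x -> A x -> f x = g x) ->
  (\int[mu]_(x in A) f x = \int[mu]_(x in A) g x)%E.
Proof.
move=> f0 g0 fg; rewrite (integral_conull_in f0) (integral_conull_in g0).
by apply: eq_integral => x; rewrite inE => -[Dx Ax]; exact: fg.
Qed.

(** The positive and the negative part are bounded by [|f|] separately, hence the factor 2; adding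
    their integrals exactly would call for measurability of [f]. *)
Lemma abs_integral_le (f : T -> \bar R) :
  (`|\int[mu]_x f x| <= 2%:E * \int[mu]_x `|f x|)%E.
Proof.
rewrite integralE; apply: le_trans (lee_abs_sub _ _) _.
have h g : (forall x, 0 <= g x)%E -> (forall x, g x <= `|f x|)%E ->
    (`|\int[mu]_x g x| <= \int[mu]_x `|f x|)%E.
  move=> g0 gf; rewrite gee0_abs; last exact: integral_ge0.
  exact: le_integral_ge0.
have -> : 2%:E = (1 + 1)%E :> \bar R by rewrite -EFinD.
rewrite ge0_muleDl//.
rewrite !mul1e; apply: leeD; apply: h => x.
- exact: funepos_ge0.
- have -> : `|f x|%E = (f^\+ x + f^\- x)%E by have /(congr1 (@^~ x)) := fune_abse f.
  by rewrite leeDl// funeneg_ge0.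
- exact: funeneg_ge0.
- have -> : `|f x|%E = (f^\+ x + f^\- x)%E by have /(congr1 (@^~ x)) := fune_abse f.
  by rewrite leeDr// funepos_ge0.
Qed.

End null_sets.

(** * Tonelli's theorem for products on tuples *)

Section tonelli.
Context d (T : measurableType d) (R : realType) (mu : {sigma_finite_measure set T -> \bar R}).

Lemma integral_tuple_prod m (h : 'I_m -> T -> R) :
  (forall i, measurable_fun setT (h i)) -> (forall i x, 0 <= h i x) ->
  (\int[tuple_measure mu m]_y (\prod_(i < m) h i (tnth y i))%:E =
   \prod_(i < m) \int[mu]_x (h i x)%:E)%E.
Proof.
have mprod k (g : 'I_k -> T -> R) : (forall i, measurable_fun setT (g i)) ->
    measurable_fun [set: k.-tuple T] (fun y => (\prod_(i < k) g i (tnth y i))%:E).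
  move=> mg; apply/measurable_EFinP; apply: measurable_prod => i _.
  by apply: measurableT_comp => //; exact: measurable_tnth.
elim: m h => [|m IH] h mh h0.
  rewrite [LHS]/= integral_dirac//; last exact: (mprod 0%N h).
  by rewrite diracT mul1e !big_ord0.
have P0 k (g : 'I_k -> T -> R) (y : k.-tuple T) : (forall i x, 0 <= g i x) ->
    (0 <= (\prod_(i < k) g i (tnth y i))%:E)%E.
  by move=> g0; rewrite lee_fin prodr_ge0.
rewrite [LHS]/= /cons_measure.
rewrite (ge0_integral_pushforward (@measurable_tcons _ T m))//; last 2 first.
- exact: mprod.
- by move=> y _; exact: P0.
rewrite preimage_setT.
pose G (z : T * m.-tuple T) : \bar R :=
  (h ord0 z.1 * \prod_(i < m) h (lift ord0 i) (tnth z.2 i))%:E.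
transitivity (\int[mu \x tuple_measure mu m]_z G z)%E.
  apply: eq_integral => -[x t] _; rewrite /G /= big_ord_recl; congr (_ * _)%:E.
  by apply: eq_bigr => i _; rewrite /tcons /= tnthS.
rewrite fubini_tonelli1; first last.
- by move=> z; rewrite /G lee_fin mulr_ge0// prodr_ge0.
- apply/measurable_EFinP; apply: measurable_funM.
    by apply: measurableT_comp.
  apply: measurable_prod => i _; apply: measurableT_comp => //.
  exact: (measurableT_comp (measurable_tnth i) (@measurable_snd _ _ T (m.-tuple T))).
rewrite big_ord_recl /= -IH//.
have I0 : (0 <= \int[tuple_measure mu m]_y (\prod_(i < m) h (lift ord0 i) (tnth y i))%:E)%E.
  apply: integral_ge0 => y _; by apply: (P0 _ (fun i => h (lift ord0 i))) => i z.
rewrite muleC -ge0_integralZl//; last 2 first.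
- exact/measurable_EFinP.
- by move=> x _; rewrite lee_fin.
apply: eq_integral => x _; rewrite /fubini_F /G /=.
under eq_integral do rewrite EFinM.
rewrite ge0_integralZl_EFin//; first by rewrite muleC.
- move=> y _; by apply: (P0 _ (fun i => h (lift ord0 i))) => i z.
- by apply: (mprod _ (fun i => h (lift ord0 i))) => i.
Qed.

End tonelli.

(** * Variable exponent norms off a null set *)

Section var_norm_facts.
Context {R : realType} {n : nat}.
Local Notation E := 'Eucl_(n, R).
Implicit Types (p q : E -> R) (f : E -> \bar R) (D : set E).

Lemma var_modular D p q f (F : E -> R) (l : R) :
  measurable D -> leb R n (~` D) = 0%E -> 0 < l ->
  (forall x, D x -> p x = q x) -> (forall x, D x -> f x = (F x)%:E) ->
  (\int[leb R n]_x ((`|f x| / l%:E) `^ p x) =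
   \int[leb R n]_(x in D) ((`|F x| / l) `^ q x)%:E)%E.
Proof.
move=> mD D0 l0 pq fF; rewrite (integral_conull mD D0); last by move=> x; exact: poweR_ge0.
apply: eq_integral => x; rewrite inE => Dx; rewrite fF// pq//.
by rewrite inver gt_eqF.
Qed.

(** Off [B] the integrand is a positive power of [0], so an indicator inside the norm amounts to
    restricting the integral. *)
Lemma var_norm_lnorm D p q f (g : E -> R) (B : set E) :
  measurable D -> leb R n (~` D) = 0%E ->
  (forall x, D x -> p x = q x) -> (forall x, D x -> f x = (g x)%:E) ->
  (forall x, 0 < q x) -> (forall x, 0 <= g x) ->
  var_norm p (fun x => f x * (\1_B x)%:E)%E = lnorm (leb R n) q g (D `&` B).
Proof.
move=> mD D0 pq fg q0 g0; rewrite /var_norm /lnorm; congr ereal_inf.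
have M l : 0 < l ->
    (\int[leb R n]_x ((`|f x * (\1_B x)%:E| / l%:E) `^ p x) =
     modular (leb R n) q g (D `&` B) l)%E.
  move=> l0; have fB x : D x -> (f x * (\1_B x)%:E = (g x * \1_B x)%:E)%E.
    by move=> Dx; rewrite fg.
  rewrite (var_modular mD D0 l0 pq fB) /modular integral_mkcondr.
  apply: eq_integral => x _; rewrite /patch indicE; case: ifP => _.
    by rewrite mulr1 ger0_norm.
  by rewrite mulr0 normr0 mul0r powR0// gt_eqF.
by apply/seteqP; split => _ [l [l0 h] <-]; exists l => //; split => //; move: h; rewrite M.
Qed.

Lemma var_norm_ge0 p f : (0 <= var_norm p f)%E.
Proof. by apply: le_ereal_inf_tmp => _ [l [l0 _] <-]; rewrite lee_fin ltW. Qed.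

Lemma var_norm_le p f (l : R) : 0 < l ->
  (\int[leb R n]_x ((`|f x| / l%:E) `^ p x) <= 1)%E -> (var_norm p f <= l%:E)%E.
Proof. by move=> l0 h; apply: ereal_inf_lbound; exists l. Qed.

Lemma modular_var_norm_lt p f (l : R) : (forall x, 0 < p x) -> 0 < l ->
  (var_norm p f < l%:E)%E -> (\int[leb R n]_x ((`|f x| / l%:E) `^ p x) <= 1)%E.
Proof.
move=> p0 l0 /ereal_inf_lt[_ [k [k0 h] <-]]; rewrite lte_fin => kl.
apply: le_trans h; apply: le_integral_ge0 => x _; first exact: poweR_ge0.
have H z : 0 < z -> (0 <= `|f x| / z%:E)%E.
  by move=> z0; rewrite mule_ge0// inver gt_eqF// lee_fin invr_ge0 ltW.
apply: gt0_ler_poweR; rewrite ?(ltW (p0 x))// ?in_itv/= ?leey ?andbT ?H//.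
by rewrite lee_wpmul2l// !inver !gt_eqF// lee_fin lef_pV2// ltW.
Qed.

End var_norm_facts.

(** * A conull Borel set on which the data are regular *)

Section good_set.
Context {R : realType} {n : nat}.
Local Notation E := 'Eucl_(n, R).

Lemma leb_measurable_fun_real (f : E -> R) :
  leb_measurable_fun (f : _ -> measurableTypeR R) ->
  exists Z, [/\ measurable Z, leb R n Z = 0%E & measurable_fun (~` Z) f].
Proof.
move=> mf; have [|Z [mZ Z0 h]] := @ereal_borel_version _ _ _ (leb R n) (EFin \o f).
  move=> Y mY; have := mf (EFin @^-1` Y); apply.
  have /measurable_EFinP h : measurable_fun [set: R] (@id R) by [].
  by rewrite -[X in measurable X]setTI; exact: h.
by exists Z; split => //; apply/measurable_EFinP.
Qed.

Lemma negligible_bigcup_ord d (T : measurableType d)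
    (mu : {measure set T -> \bar R}) m (F : 'I_m -> set T) :
  (forall i, mu.-negligible (F i)) -> mu.-negligible (\bigcup_i F i).
Proof.
move=> hF; apply: (@negligibleS _ _ _ _ (\bigcup_k oapp F set0 (insub k))).
  by move=> x [i _ Fx]; exists (i : nat) => //; rewrite valK.
apply: negligible_bigcup => k; case: insubP => [i _ _|_] /=; first exact: hF.
exact: negligible_set0.
Qed.

Lemma null_negligible (Z : set E) : measurable Z -> leb R n Z = 0%E ->
  (leb R n).-negligible Z.
Proof. by move=> mZ Z0; exists Z; split. Qed.

Lemma good_set m (p_ : 'I_m -> E -> R) (q : E -> R) (w : 'I_m -> E -> \bar R) :
  (forall i, P_exponent (p_ i)) -> P0_exponent q -> (forall i, weight (w i)) ->
  exists (D : set E) (plo phi qlo qhi : R),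
    [/\ measurable D, leb R n (~` D) = 0%E, 1 < plo & 0 < qlo] /\
    [/\ forall i, measurable_fun D (p_ i), measurable_fun D q &
        forall i, measurable_fun D (w i)] /\
    [/\ forall i x, D x -> plo <= p_ i x <= phi,
        forall x, D x -> qlo <= q x <= qhi &
        forall i x, D x -> (0 < w i x < +oo)%E].
Proof.
move=> hp hq hw.
have ess_lo (f : E -> R) (a : R) : (a%:E < ess_inf (leb R n) (EFin \o f))%E ->
    exists lo, a < lo /\ (leb R n).-negligible [set x | ~ lo <= f x].
  move=> h; have [lo [alo hlo]] : exists lo, a < lo /\ (lo%:E <= ess_inf (leb R n) (EFin \o f))%E.
    move: h; case: (ess_inf _ _) => [z| |]//.
      by rewrite lte_fin => az; exists z; rewrite lexx.
    by move=> _; exists (a + 1); rewrite leey ltrDl.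
  exists lo; split => //.
  have [Z [mZ Z0 hZ]] := @ess_inf_le _ _ _ (leb R n) (EFin \o f).
  exists Z; split => // x /= nlo; apply: hZ => /= h1; apply: nlo.
  by rewrite -lee_fin (le_trans hlo).
have ess_hi (f : E -> R) : (ess_sup (leb R n) (EFin \o f) < +oo)%E ->
    exists hi : R, (leb R n).-negligible [set x | ~ f x <= hi].
  move=> h; have [hi hhi] : exists hi : R, (ess_sup (leb R n) (EFin \o f) <= hi%:E)%E.
    move: h; case: (ess_sup _ _) => [z| |]//; last by move=> _; exists 0; rewrite leNye.
    by move=> _; exists z.
  exists hi; have [Z [mZ Z0 hZ]] := @ess_sup_ge _ _ _ (leb R n) (EFin \o f).
  exists Z; split => // x /= nhi; apply: hZ => /= h1; apply: nhi.
  by rewrite -lee_fin (le_trans h1).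
have /choice[pd hpd] i : exists d : (R * R) * set E, [/\ 1 < d.1.1, measurable d.2,
    leb R n d.2 = 0%E, measurable_fun (~` d.2) (p_ i) /\ measurable_fun (~` d.2) (w i) &
    forall x, ~ d.2 x -> d.1.1 <= p_ i x <= d.1.2 /\ (0 < w i x < +oo)%E].
  have [mp _ /ess_lo[lo [lo1 nlo]] /ess_hi[hi nhi]] := hp i.
  have [mw _ _ nw] := hw i.
  have [Z1 [mZ1 Z10 m1]] := leb_measurable_fun_real mp.
  have [Z2 [mZ2 Z20 m2]] := ereal_borel_version mw.
  have /= := negligibleU (negligibleU (null_negligible mZ1 Z10) (null_negligible mZ2 Z20))
    (negligibleU (negligibleU nlo nhi) nw).
  move=> [Z [mZ Z0 hZ]]; exists ((lo, hi), Z); split => //=; first split.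
  - apply: measurable_funS m1; first exact: measurableC.
    by move=> x nZ Z1x; apply: nZ; apply: hZ; left; left.
  - apply: measurable_funS m2; first exact: measurableC.
    by move=> x nZ Z2x; apply: nZ; apply: hZ; left; right.
  - move=> x nZ; split.
      apply/andP; split; apply: contrapT => h; apply: nZ; apply: hZ; right; left.
        by left.
      by right.
    by apply: contrapT => h; apply: nZ; apply: hZ; right; right.
have [mq _ /ess_lo[qlo [qlo0 nqlo]] /ess_hi[qhi nqhi]] := hq.
have [Zq [mZq Zq0 mq']] := leb_measurable_fun_real mq.
have npd i : (leb R n).-negligible (pd i).2.
  by case: (hpd i) => _ mZ Z0 _ _; exact: null_negligible.
have /= := negligibleU (negligible_bigcup_ord npd)
  (negligibleU (null_negligible mZq Zq0) (negligibleU nqlo nqhi)).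
move=> [Z [mZ Z0 hZ]].
have nZi i x : ~ Z x -> ~ (pd i).2 x.
  by move=> nZ h; apply: nZ; apply: hZ; left; exists i.
(* $1+1/(1+s)$ is a common lower bound above $1$: every summand is at most [s], so $1/(1+s)$ is at
   most each $lo_i-1$, also for an empty family. *)
pose s := \sum_i ((pd i).1.1 - 1)^-1.
have s0 i : 0 < ((pd i).1.1 - 1)^-1.
  by rewrite invr_gt0 subr_gt0; case: (hpd i).
have si i : ((pd i).1.1 - 1)^-1 <= s.
  by rewrite /s (bigD1 i)//= lerDl sumr_ge0// => j _; exact: ltW.
have sge0 : 0 <= s by rewrite sumr_ge0// => j _; exact: ltW.
exists (~` Z), (1 + (1 + s)^-1), (\sum_i `|(pd i).1.2|), qlo, qhi.
split; first split => //.
- exact: measurableC.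
- by rewrite setCK.
- by rewrite ltrDl invr_gt0 ltr_wpDr.
split; first split.
- move=> i; case: (hpd i) => _ mZi _ [h _] _.
  by apply: measurable_funS h; [exact: measurableC|move=> x; exact: nZi].
- apply: measurable_funS mq'; first exact: measurableC.
  by move=> x nZ h; apply: nZ; apply: hZ; right; left.
- move=> i; case: (hpd i) => _ mZi _ [_ h] _.
  by apply: measurable_funS h; [exact: measurableC|move=> x; exact: nZi].
split.
- move=> i x nZ; case: (hpd i) => lo1 _ _ _ /(_ x (nZi i x nZ))[/andP[h1 h2] _].
  apply/andP; split.
    apply: le_trans h1; rewrite -lerBrDl -[leRHS]invrK lef_pV2 ?posrE//.
      by apply: le_trans (si i) _; rewrite lerDr.
    by rewrite ltr_wpDr.
  apply: le_trans h2 _; apply: le_trans (ler_norm _) _.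
  by rewrite (bigD1 i)//= lerDl sumr_ge0.
- move=> x nZ; apply/andP; split; apply: contrapT => h; apply: nZ; apply: hZ; right; right.
    by left.
  by right.
- by move=> i x nZ; case: (hpd i) => _ _ _ _ /(_ x (nZi i x nZ))[].
Qed.

End good_set.

(** * Log-Hölder continuity on dyadic cells *)

Section log_holder_reference.
Context {R : realType} {n : nat}.
Hypothesis n0 : (0 < n)%N.
Local Notation E := 'Eucl_(n, R).

(** Truncating a reference value from below at [1] brings it no farther from an exponent [>= 1]. It
    is applied to values at corners, which may lie outside [D], and to limits at infinity. *)
Lemma dist_max1 (a y : R) : 1 <= a -> `|a - Num.max 1 y| <= `|a - y|.
Proof.
move=> a1; case: (leP 1 y) => // y1.
rewrite ger0_norm ?subr_ge0// ger0_norm; lra.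
Qed.

Lemma finite_cells k (r : R) : 0 < r -> exists S : seq (n.-tuple int),
  forall x : E, eucl_norm x <= r -> cl k x \in S.
Proof.
move=> r0; have s0 := side_gt0 (R := R) k.
pose M := (Num.truncn (r / side k)).+1.
have rM : r / side k < M%:R by rewrite /M truncnS_gt.
exists [seq [tuple (tnth t i : nat)%:Z - M%:Z | i < n] | t : n.-tuple 'I_(M + M).+1].
move=> x xr; apply/mapP.
have hz i : (- M%:Z <= Num.floor (co x i / side k) <= M%:Z)%R.
  have := le_trans (eucl_norm_ge x i) xr; rewrite ler_norml => /andP[h1 h2].
  have h3 : co x i / side k <= r / side k by rewrite ler_pM2r ?invr_gt0.
  have h4 : - (r / side k) <= co x i / side k by rewrite -mulNr ler_pM2r ?invr_gt0.
  apply/andP; split.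
    by rewrite floor_ge_int rmorphN /=; lra.
  rewrite -(ler_int R); apply: le_trans (floor_le _) _; lra.
exists [tuple inord `|(Num.floor (co x i / side k) + M%:Z)%R|%N | i < n].
  by rewrite mem_enum.
apply: eq_from_tnth => i; rewrite !tnth_mktuple.
by rewrite inordK; have := hz i; lia.
Qed.

(** Cells finer than [k0] are so small that the local condition allows the value at the corner. On
    coarser cells the limit at infinity is used; it is accurate outside a ball that meets only
    finitely many cells of generation [k0]. *)
Lemma log_holder_reference m (p_ : 'I_m -> E -> R) (D : set E) (dl : R) :
  (forall i, log_holder (p_ i)) -> (forall i x, D x -> 1 <= p_ i x) -> 0 < dl ->
  exists k0 (S : seq (n.-tuple int)) (rho : 'I_m -> int * n.-tuple int -> R),
  (forall i a, 1 <= rho i a) /\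
  forall i a x, (cell D cl a x \/ exists s, cell D cl (a.1, shift_index s a.2) x) ->
    `|p_ i x - rho i a| <= dl \/ ((a.1 <= k0)%R /\ cl k0 x \in S).
Proof.
move=> lh p1 dl0.
have /choice[Cp hCp] i : exists Cp : R * R, [/\ 0 < Cp.1,
    forall x y, eucl_dist x y < 2^-1 -> `|p_ i x - p_ i y| <= Cp.1 / (- ln (eucl_dist x y)) &
    forall x, `|p_ i x - Cp.2| <= Cp.1 / ln (expR 1 + eucl_norm x)].
  by have [C [pinf [C0 _ h1 h2]]] := lh i; exists (C, pinf).
pose C : R := 1 + \sum_i (Cp i).1.
have Ci i : (Cp i).1 <= C.
  rewrite /C (bigD1 i)//= addrCA lerDl addr_ge0// sumr_ge0// => j _.
  by case: (hCp j) => /ltW.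
have C0 : 0 < C.
  rewrite /C ltr_pwDl// sumr_ge0// => j _; by case: (hCp j) => /ltW.
have Cdl : 0 < C / dl by rewrite divr_gt0.
(* Distances below [eta] have $-\log$ above $C/dl$; the extra [1] ensures [eta <= 2^-1]. Likewise
   [expR (C / dl)] is the radius beyond which the condition at infinity gives [dl]. *)
pose eta := expR (- (C / dl + 1)) : R.
have eta0 : 0 < eta by rewrite expR_gt0.
have eta1 : eta <= 2^-1.
  rewrite /eta expRN lef_pV2 ?posrE ?expR_gt0//.
  have := expR_ge1Dx (C / dl + 1); lra.
have nR : 0 < n%:R :> R by rewrite ltr0n.
have [k0 hk0] : exists k0, forall k, (k0 < k)%R -> side k <= eta / (4 * n%:R).
  have e4 : 0 < eta / (4 * n%:R) by rewrite divr_gt0 ?mulr_gt0.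
  exact: side_small e4.
have [S hS] := finite_cells k0 (expR_gt0 (C / dl)).
exists k0, S, (fun i a => Num.max 1 (if (a.1 <= k0)%R then (Cp i).2 else p_ i (corner a))).
split; first by move=> i a; rewrite le_max lexx.
move=> i a x hx.
have Dx : D x by case: hx => [[]//|[s []]].
have hx' : cl a.1 x = a.2 \/ (exists s, cl a.1 x = shift_index s a.2).
  by case: hx => [[_ h]|[s [_ h]]]; [left|right; exists s].
have [_ h1 h2] := hCp i.
case: (lerP a.1 k0) => ak; last first.
  left; apply: le_trans (dist_max1 _ (p1 i x Dx)) _.
  have dx : eucl_dist (corner a) x <= eta / 2.
    apply: le_trans (corner_near hx') _.
    have := hk0 _ ak; rewrite ler_pdivlMr ?mulr_gt0//; lra.
  have d12 : eucl_dist (corner a) x < 2^-1 by lra.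
  rewrite distrC; apply: le_trans (h1 _ _ d12) _.
  (* At the corner itself [ln 0 = 0] and [0^-1 = 0] make the bound [0]. *)
  have := eucl_dist_ge0 (corner a) x; rewrite le_eqVlt => /predU1P[<-|d0].
    by rewrite ln0// oppr0 invr0 mulr0 ltW.
  have ld : C / dl <= - ln (eucl_dist (corner a) x).
    rewrite lerNr -ler_expR lnK ?posrE//.
    apply: le_trans dx _; apply: (@le_trans _ _ eta); first by lra.
    by rewrite /eta ler_expR; lra.
  have l0 : 0 < - ln (eucl_dist (corner a) x) by exact: lt_le_trans ld.
  rewrite ler_pdivrMr//; apply: le_trans (Ci i) _.
  by move: ld; rewrite ler_pdivrMr// mulrC.
case: (leP (eucl_norm x) (expR (C / dl))) => xn.
  by right; split => //; exact: hS.
left; apply: le_trans (dist_max1 _ (p1 i x Dx)) _.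
apply: le_trans (h2 x) _.
have ld : C / dl <= ln (expR 1 + eucl_norm x).
  rewrite -ler_expR lnK ?posrE; last by rewrite addr_gt0 ?expR_gt0// (lt_trans (expR_gt0 _) xn).
  by have := expR_gt0 (1 : R); lra.
have l0 : 0 < ln (expR 1 + eucl_norm x) by exact: lt_le_trans ld.
rewrite ler_pdivrMr//; apply: le_trans (Ci i) _.
by move: ld; rewrite ler_pdivrMr// mulrC.
Qed.

End log_holder_reference.

(** * Domination of the operators by dyadic sums *)

Lemma lee_prod (R : realDomainType) m (f g : 'I_m -> \bar R) :
  (forall i, 0 <= f i <= g i)%E -> (\prod_i f i <= \prod_i g i)%E.
Proof.
move=> fg; suff /andP[] : (0 <= \prod_i f i <= \prod_i g i)%E by [].
elim/big_rec2: _ => [|i x y _ /andP[y0 yx]]; first by rewrite lee01 lexx.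
have /andP[f0 fgi] := fg i.
by rewrite mule_ge0//= lee_pmul.
Qed.

Section tuple_all.
Context d (T : measurableType d) (R : realType).
Variable mu : {sigma_finite_measure set T -> \bar R}.

Lemma measurable_tuple_all m (A : set T) : measurable A ->
  measurable [set y : m.-tuple T | forall i, A (tnth y i)].
Proof.
move=> mA; rewrite (_ : [set _ | _] =
    \bigcap_(i in [set: 'I_m]) ((fun y : m.-tuple T => tnth y i) @^-1` A)).
  apply: fin_bigcap_measurable => // i _; rewrite -[X in measurable X]setTI.
  exact: measurable_tnth.
by apply/seteqP; split=> [t tA i _|t tA i]; exact: tA.
Qed.

Lemma tuple_all_conull m (A : set T) : measurable A -> mu (~` A) = 0%E ->
  tuple_measure mu m (~` [set y : m.-tuple T | forall i, A (tnth y i)]) = 0%E.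
Proof.
move=> mA A0.
have [Z [mZ Z0 hZ]] : (tuple_measure mu m).-negligible
    (\bigcup_i (fun y : m.-tuple T => tnth y i) @^-1` (~` A)).
  apply: negligible_bigcup_ord => i.
  pose B (j : 'I_m) : set T := if j == i then ~` A else setT.
  have mB j : measurable (B j) by rewrite /B; case: ifP => _ //; exact: measurableC.
  exists ((fun y : m.-tuple T => tnth y i) @^-1` (~` A)); split => //.
    by rewrite -[X in measurable X]setTI; apply: measurable_tnth => //; exact: measurableC.
  rewrite (_ : _ @^-1` _ = [set t : m.-tuple T | forall j, B j (tnth t j)]).
    apply: (etrans (tuple_measureX mu mB)); rewrite (bigD1 i)//= {1}/B eqxx.
    by rewrite (_ : mu (~` A) = 0%E) ?mul0e.
  apply/seteqP; split => y /=.
    by move=> yi j; rewrite /B; case: eqP => [->|].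
  by move=> /(_ i); rewrite /B eqxx.
apply/eqP; rewrite eq_le measure_ge0 andbT -Z0; apply: le_measure; rewrite ?inE//.
  by apply: measurableC; exact: measurable_tuple_all.
move=> y /= ny; apply: hZ; apply: contrapT => nU; apply: ny => i.
by apply: contrapT => nD; apply: nU; exists i.
Qed.

End tuple_all.

Section domination.
Context {R : realType} {n m : nat}.
Local Notation E := 'Eucl_(n, R).
Variables (alpha : R) (D D3 : set E) (f : 'I_m -> E -> R) (h : 'I_m -> E -> R).
Hypothesis n0 : (0 < n)%N.
Hypothesis alpha_lt : alpha / n%:R < m%:R.
Hypothesis mD : measurable D.
Hypotheses (mD3 : measurable D3) (D30 : leb R n (~` D3) = 0%E).
Hypotheses (mh : forall i, measurable_fun setT (h i)) (h0 : forall i y, 0 <= h i y)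
  (hD : forall i y, ~ D y -> h i y = 0)
  (fh : forall i y, D3 y -> `|f i y| = h i y).
Local Notation Q := (cell D cl).
Hypothesis hfin : forall i a, (\int[leb R n]_(y in Q a) (h i y)%:E < +oo)%E.

Let beta : R := m%:R - alpha / n%:R.
Let V (k : int) : R := side k ^+ n.
Let H (i : 'I_m) (k : int) (x : E) : R :=
  \sum_s fine (\int[leb R n]_(y in Q (k, shift_index s (cl k x))) (h i y)%:E).
Let S (x : E) : \bar R := (\esum_(k in [set: int])
  ((V k `^ beta)^-1 * \prod_i H i k x)%:E)%E.
Let G (i : 'I_m) (k : int) (x y : E) : R := \sum_s h i y * \1_(Q (k, shift_index s (cl k x))) y.

Let nR : 0 < n%:R :> R. Proof. by rewrite ltr0n. Qed.
Let beta0 : 0 < beta. Proof. by rewrite subr_gt0. Qed.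
Let V0 k : 0 < V k. Proof. by rewrite exprn_gt0// side_gt0. Qed.
Let mQ a : measurable (Q a). Proof. exact: measurable_cell. Qed.

Let H0 i k x : 0 <= H i k x.
Proof.
apply: sumr_ge0 => s _; apply: fine_ge0; apply: integral_ge0 => y _.
by rewrite lee_fin.
Qed.

Let G0 i k x y : 0 <= G i k x y.
Proof. by apply: sumr_ge0 => s _; rewrite mulr_ge0. Qed.

Let mG i k x : measurable_fun setT (G i k x).
Proof.
by apply: measurable_sum => s; apply: measurable_funM.
Qed.

Let intG i k x : (\int[leb R n]_y (G i k x y)%:E = (H i k x)%:E)%E.
Proof.
under eq_integral do rewrite /G -sumEFin.
rewrite ge0_integral_sum//; last 2 first.
- by move=> s; apply/measurable_EFinP; apply: measurable_funM.
- by move=> s y _; rewrite lee_fin mulr_ge0.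
rewrite /H -sumEFin; apply: eq_bigr => s _.
rewrite fineK; last first.
  by rewrite ge0_fin_numE ?hfin//; apply: integral_ge0 => y _; rewrite lee_fin.
rewrite [RHS]integral_mkcond; apply: eq_integral => y _.
rewrite /patch indicE; case: ifP => _; first by rewrite mulr1.
by rewrite mulr0.
Qed.

Let hG i k x y : (forall l, `|co x l - co y l| < side k) -> h i y <= G i k x y.
Proof.
move=> xy; case: (pselect (D y)) => [Dy|nDy]; last by rewrite hD.
have [s hs] := near_cell xy.
rewrite /G (bigD1 s)//= indicE mem_set ?mulr1; last by split.
by rewrite lerDl; apply: sumr_ge0 => s' _; rewrite mulr_ge0.
Qed.

Let term_le_S x k : (((V k `^ beta)^-1 * \prod_i H i k x)%:E <= S x)%E.
Proof.
apply: (@esum_ge1 R int (fun k => ((V k `^ beta)^-1 * \prod_i H i k x)%:E)) => l.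
by rewrite lee_fin mulr_ge0 ?invr_ge0 ?powR_ge0// prodr_ge0.
Qed.

(** For [r] between [side (k + 1)] and [side k], the ball is covered, up to a null set, by the cells
    of generation [k] near [x] together with points where [h] vanishes, and [V k] is at most $n^n$
    times its measure. A single term of [S] suffices. *)
Lemma frac_max_dominated x :
  (frac_max alpha f x <= ((n%:R ^+ n) `^ beta)%:E * S x)%E.
Proof.
apply: ge_ereal_sup => _ [r [r0 ->]]; set B := eucl_ball x r.
have mB : measurable B by exact: measurable_eucl_ball.
have [k /andP[kr rk]] := side_between r0.
have hle i : (\int[leb R n]_(y in B) `|f i y|%:E <= (H i k x)%:E)%E.
  rewrite (@integral_eq_conull _ _ _ (leb R n) D3 mD3 D30 B _ (fun y => (h i y)%:E)); first last.
  - by move=> y D3y _; rewrite fh.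
  - by move=> y _; rewrite lee_fin.
  - by move=> y _; rewrite lee_fin.
  rewrite -intG integral_mkcond; apply: le_integral_ge0 => y _.
    by rewrite /patch; case: ifP => // _; rewrite lee_fin.
  rewrite /patch; case: ifPn => [|_]; last by rewrite lee_fin.
  rewrite inE => By; rewrite lee_fin; apply: hG => l.
  exact: le_lt_trans (eucl_dist_ge x y l) (lt_trans By rk).
have b1 := leb_ball_ge n0 x r0; have b2 := leb_ball_le x r0.
have [b [bE bge]] : exists b : R, leb R n B = b%:E /\ (2 * r / n%:R) ^+ n <= b.
  move: b1 b2; rewrite -/B; case: (leb R n B) => [b| |]//.
  by rewrite lee_fin => ? _; exists b.
have e0 : 0 < (2 * r / n%:R) ^+ n by rewrite exprn_gt0// divr_gt0// mulr_gt0.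
have b0 : 0 < b by exact: lt_le_trans bge.
have bb0 : 0 < b `^ beta by rewrite powR_gt0.
have Vb : V k <= n%:R ^+ n * b.
  apply: (@le_trans _ _ (n%:R ^+ n * (2 * r / n%:R) ^+ n)); last first.
    by rewrite ler_pM2l// exprn_gt0.
  rewrite -exprMn mulrC divfK ?gt_eqF// /V lerXn2r ?nnegrE ?(ltW (side_gt0 _))//.
    by rewrite mulr_ge0// ltW.
  by rewrite sideS mulrC ler_pM2l.
apply: (@le_trans _ _
  (((n%:R ^+ n) `^ beta * ((V k `^ beta)^-1 * \prod_i H i k x))%:E)); last first.
  by rewrite EFinM lee_wpmul2l// lee_fin powR_ge0.
rewrite bE poweR_EFin inver gt_eqF//.
apply: (@le_trans _ _ ((b `^ beta)^-1%:E * (\prod_i H i k x)%:E)%E).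
  apply: lee_wpmul2l; first by rewrite lee_fin invr_ge0 ltW.
  rewrite -prodEFin; apply: lee_prod => i; rewrite hle andbT.
  by apply: integral_ge0 => y _; rewrite lee_fin.
rewrite -EFinM lee_fin mulrA ler_wpM2r ?prodr_ge0//.
rewrite ler_pdivlMr ?powR_gt0// mulrC ler_pdivrMr//.
rewrite -powRM ?exprn_ge0 ?(ltW b0)//.
by rewrite ge0_ler_powR ?nnegrE ?(ltW beta0) ?(ltW (V0 k)) ?mulr_ge0 ?exprn_ge0// ltW.
Qed.

Let DD : set (m.-tuple E) := [set y | forall i, D3 (tnth y i)].
Let mDD : measurable DD. Proof. exact: measurable_tuple_all. Qed.
Let DD0 : tuple_measure (leb R n) m (~` DD) = 0%E.
Proof. exact: tuple_all_conull. Qed.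

(** Tuples are sorted by the [k] for which the sum of distances lies in $[side(k+1),side(k))$: there
    the kernel is at most $2^\gamma V_k^{-\beta}$, with $\gamma=n\beta=mn-\alpha$, and every entry
    is near [x]. Tonelli then separates the variables. The leading 2 comes from
    [abs_integral_le]. *)
Lemma frac_int_dominated x :
  (`|frac_int alpha f x| <= (2 * 2 `^ (n%:R * beta))%:E * S x)%E.
Proof.
set gam := n%:R * beta.
have gam0 : 0 < gam by rewrite mulr_gt0.
have gamE : m%:R * n%:R - alpha = gam.
  by rewrite /gam /beta mulrBr mulrCA divff ?gt_eqF// mulr1 mulrC.
have Vgam k : V k `^ beta = side k `^ gam.
  by rewrite /V -powR_mulrn ?(ltW (side_gt0 _))// -powRrM.
rewrite /frac_int gamE; apply: le_trans (abs_integral_le _ _) _.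
rewrite EFinM -muleA; apply: lee_wpmul2l; first by rewrite lee_fin.
pose dst (y : m.-tuple E) := \sum_(i < m) eucl_dist x (tnth y i).
have dst0 y : 0 <= dst y by apply: sumr_ge0 => i _; exact: eucl_dist_ge0.
have hh0 (y : m.-tuple E) : 0 <= \prod_(i < m) h i (tnth y i) by apply: prodr_ge0.
have -> : (\int[tuple_measure (leb R n) m]_y
    `|((\prod_(i < m) f i (tnth y i)) / (\sum_(i < m) eucl_dist x (tnth y i)) `^ gam)%:E| =
  \int[tuple_measure (leb R n) m]_y ((\prod_(i < m) h i (tnth y i)) / dst y `^ gam)%:E)%E.
  apply: (integral_eq_conull mDD DD0) => y.
  - by move=> _; exact: abse_ge0.
  - by move=> _; rewrite lee_fin divr_ge0 ?powR_ge0.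
  - move=> Dy _ /=; rewrite normrM normr_prod ger0_norm ?invr_ge0 ?powR_ge0//.
    by congr (_ * _)%:E; apply: eq_bigr => i _; rewrite fh.
pose Psi k (y : m.-tuple E) : \bar R :=
  ((2 `^ gam * (V k `^ beta)^-1)%:E * (\prod_(i < m) G i k x (tnth y i))%:E)%E.
have c0 k : 0 <= 2 `^ gam * (V k `^ beta)^-1 by rewrite mulr_ge0 ?invr_ge0 ?powR_ge0.
have GG0 k (y : m.-tuple E) : 0 <= \prod_(i < m) G i k x (tnth y i) by apply: prodr_ge0.
have Psi0 k y : (0 <= Psi k y)%E by rewrite mule_ge0// lee_fin.
have mGG k : measurable_fun [set: m.-tuple E] (fun y => (\prod_(i < m) G i k x (tnth y i))%:E).
  apply/measurable_EFinP; apply: measurable_prod => i _.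
  by apply: measurableT_comp => //; exact: measurable_tnth.
apply: (@le_trans _ _ (\int[tuple_measure (leb R n) m]_y
    (\esum_(k in [set: int]) Psi k y))%E).
  apply: le_integral_ge0 => y _; first by rewrite lee_fin divr_ge0 ?powR_ge0.
  (* If all entries equal [x], the kernel is [0^-1 = 0]. *)
  have := dst0 y; rewrite le_eqVlt => /predU1P[d0|d0].
    rewrite -d0 powR0 ?gt_eqF// invr0 mulr0.
    by apply: esum_ge0 => k _; exact: Psi0.
  have [k /andP[k1 k2]] := side_between d0.
  apply: le_trans (_ : Psi k y <= _)%E; last first.
    by apply: (@esum_ge1 R int (fun k => Psi k y)) => l; exact: Psi0.
  rewrite /Psi -EFinM lee_fin mulrC; apply: ler_pM => //.
  - by rewrite invr_ge0 powR_ge0.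
  - rewrite Vgam -[2 `^ gam]invrK -invfM lef_pV2 ?posrE ?mulr_gt0 ?invr_gt0 ?powR_gt0 ?side_gt0//.
    rewrite -(powRV _ (ltW (ltr0Sn _ 1)))  -powRM ?invr_ge0 ?(ltW (side_gt0 _))//.
    rewrite ge0_ler_powR ?nnegrE ?(ltW gam0) ?mulr_ge0 ?invr_ge0 ?(ltW (side_gt0 _))//.
    by apply: le_trans k1; rewrite [in leLHS]sideS mulrC mulfK.
  - apply: ler_prod => i _; rewrite h0 /=; apply: hG => l.
    apply: le_lt_trans (eucl_dist_ge x (tnth y i) l) _; apply: le_lt_trans k2.
    by rewrite /dst (bigD1 i)//= lerDl sumr_ge0// => j _; exact: eucl_dist_ge0.
rewrite integral_esum//; last by move=> k; exact: measurable_funeM.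
rewrite -esumZ ?powR_ge0//; last first.
  by move=> k; rewrite lee_fin mulr_ge0 ?invr_ge0 ?powR_ge0// prodr_ge0.
apply: le_esum => k _; rewrite le_eqVlt; apply/orP; left; apply/eqP.
rewrite ge0_integralZl_EFin//; last by move=> y _; rewrite lee_fin.
rewrite (integral_tuple_prod (leb R n) (fun i => mG i k x) (fun i => G0 i k x)).
rewrite (eq_bigr (fun i => (H i k x)%:E)); last by move=> i _; rewrite intG.
by rewrite prodEFin -!EFinM mulrA.
Qed.

End domination.

(** * The two implications *)

(** Composing with a retraction onto [D] extends all the data at once, so bounds and identities
    between them that hold on [D] hold everywhere. *)
Lemma measurable_fun_retract d d' (T : measurableType d) (U : measurableType d')
    (D : set T) (x0 : T) (f : T -> U) : measurable D -> measurable_fun D f ->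
  measurable_fun setT (fun x => f (if x \in D then x else x0)).
Proof.
move=> mD mf; rewrite -(setUv D); apply/measurable_funU => //; first exact: measurableC.
split.
  by apply: (eq_measurable_fun f) => // x xD; rewrite xD.
apply: (eq_measurable_fun (fun=> f x0)) => // x; rewrite inE => /= nD.
by rewrite memNset.
Qed.

Lemma prode_gt0_lty (R : realType) (J : finType) (f : J -> \bar R) :
  (forall j, 0 < f j)%E -> (\prod_j f j < +oo)%E -> forall j, (f j < +oo)%E.
Proof.
move=> f0 h j; rewrite ltNge leye_eq; apply/negP => /eqP fj.
move: h; rewrite (bigD1 j)//= fj gt0_mulye ?ltxx//.
by elim/big_rec: _ => [|i x _ x0]; [exact: lte01|exact: mule_gt0].
Qed.

(** A norm may vanish, and the modular is controlled only strictly above it; norms are therefore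
    enlarged by [e], and this linear bound lets [e] tend to [0]. *)
Lemma prod_addr_le (R : realType) (J : finType) (a : J -> R) :
  (forall j, 0 <= a j) ->
  exists2 M : R, 0 <= M &
    forall e, 0 <= e <= 1 -> \prod_j (a j + e) <= \prod_j a j + e * M.
Proof.
move=> a0; elim: (index_enum J) => [|j s [M M0 IH]].
  by exists 0 => // e _; rewrite !big_nil mulr0 addr0.
set P := \prod_(i <- s) a i in IH; have P0 : 0 <= P by exact: prodr_ge0.
exists (a j * M + P + M); first by rewrite !addr_ge0// mulr_ge0.
move=> e /andP[e0 e1]; rewrite !big_cons -/P.
apply: (@le_trans _ _ ((a j + e) * (P + e * M))).
  by rewrite ler_wpM2l ?addr_ge0// IH// e0.
have : e * (e * M) <= e * M by rewrite ler_piMl// mulr_ge0.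
lra.
Qed.

(** The factors, later dual norms, may a priori be infinite, so they are approached by reals from
    below, one at a time. A single admissible real already forces the rest of the product to be
    finite. *)
Lemma prode_le_of_lt (R : realType) m (L : 'I_m -> \bar R) (A : \bar R) (K : R) :
  (0 < A)%E -> (forall i, 0 < L i)%E ->
  (forall l : 'I_m -> R, (forall i, 0 < l i /\ ((l i)%:E < L i)%E) ->
    (A * (\prod_i l i)%:E <= K%:E)%E) ->
  (A * \prod_i L i <= K%:E)%E.
Proof.
elim: m L A => [|m IH] L A A0 L0 h.
  by have := h (fun=> 0); rewrite !big_ord0; apply; case.
rewrite big_ord_recl muleA [(A * _)%E]muleC -muleA.
have pos (x y : \bar R) : (0 < x)%E -> (0 < y)%E ->
    (forall t : R, 0 < t -> (t%:E < x)%E -> (t%:E * y <= K%:E)%E) -> (x * y <= K%:E)%E.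
  move=> x0 y0 hx.
  have [t0 t00 t0x] : exists2 t : R, 0 < t & (t%:E < x)%E.
    move: x0 {hx}; case: x => [x| |]//; last by exists 1 => //; rewrite ltry.
    by rewrite lte_fin => x0; exists (x / 2); rewrite ?lte_fin; lra.
  have [y' yE y'0] : exists2 y' : R, y = y'%:E & 0 < y'.
    move: y0 (hx _ t00 t0x); case: y {hx} => [y| |]//; first by exists y.
    by rewrite mulry gtr0_sg// mul1e.
  rewrite {}yE in hx *; rewrite -lee_pdivlMr// -EFinM.
  rewrite leNgt; apply/negP => Kx.
  have [t /andP[Kt t0']] : exists t : R, ((K / y')%:E < t%:E < x)%E.
    move: Kx; case: x {x0 hx t0x} => [x| |]//; rewrite ?lte_fin.
      by move=> Kx; exists ((K / y' + x) / 2); rewrite !lte_fin; lra.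
    by move=> _; exists (K / y' + 1); rewrite ltry lte_fin ltrDl ltr01.
  have K0 : 0 < K.
    by have := hx _ t00 t0x; rewrite -EFinM lee_fin; apply: lt_le_trans; rewrite mulr_gt0.
  rewrite lte_fin in Kt.
  have tp : 0 < t by apply: lt_trans Kt; rewrite divr_gt0.
  have := hx _ tp t0'; rewrite -EFinM lee_fin leNgt.
  by rewrite -ltr_pdivrMr// Kt.
apply: pos => //.
  rewrite mule_gt0//; elim/big_rec: _ => [|i x _ x0]; [exact: lte01|exact: mule_gt0].
move=> t tt0 tL; rewrite muleA [(_ * A)%E]muleC.
apply: IH => // [|l hl]; first by rewrite mule_gt0.
have := h (fun i => if unlift ord0 i is Some j then l j else t).
rewrite big_ord_recl unlift_none EFinM muleA.
rewrite [X in (_ * X%:E)%E](eq_bigr l); last by move=> i _; rewrite liftK.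
by apply => i; case: unliftP => [j ->|->].
Qed.

Lemma Borel_leb_measurable (R : realType) n (f : 'Eucl_(n, R) -> R) :
  measurable_fun setT f -> leb_measurable_fun (f : _ -> measurableTypeR R).
Proof.
move=> mf Y mY; exists (f @^-1` Y); first by rewrite -[X in measurable X]setTI; exact: mf.
by exists set0; [exact: negligible_set0|rewrite setU0].
Qed.

(** Monotone convergence along the sets where [u] is at most [k + 1]. The cut-off makes the integral
    of the test function finite. *)
Lemma truncated_integral_gt1 d (T : measurableType d) (R : realType)
    (mu : {measure set T -> \bar R}) (B : set T) (u h : T -> R) :
  measurable B -> measurable_fun setT u -> measurable_fun setT h ->
  (forall x, 0 <= h x) -> (1 < \int[mu]_(x in B) (h x)%:E)%E ->
  exists2 M : R, 0 < M & (1 < \int[mu]_(x in B `&` [set x | u x <= M]%R) (h x)%:E)%E.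
Proof.
move=> mB mu_ mh h0 h1; pose F (k : nat) := B `&` [set x | u x <= k.+1%:R].
have mF k : measurable (F k).
  by apply: measurableI => //; rewrite -[X in measurable X]setTI; exact: measurable_fun_le.
have UF : \bigcup_k F k = B.
  apply/seteqP; split=> [x [k _ []]//|x Bx].
  exists (Num.truncn `|u x|) => //; split=> //=.
  by apply: le_trans (ler_norm _) _; apply: ltW; exact: truncnS_gt.
have ndF : {homo F : k l / (k <= l)%N >-> (k <= l)%O}.
  move=> k l kl; apply/subsetPset => x [Bx /= xk]; split=> //=.
  by apply: le_trans xk _; rewrite ler_nat.
have cv := @ge0_nondecreasing_set_cvg_integral _ _ _ F (fun x => (h x)%:E) mu ndF mF _ _.
rewrite UF in cv; apply: contrapT => nM; move: h1; rewrite ltNge => /negP; apply.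
rewrite -(cvg_lim _ (cv _ _))//; last 2 first.
- by move=> k; apply/measurable_EFinP; exact: measurable_funS mh.
- by move=> k x _; rewrite lee_fin.
apply: lime_le.
  apply: cvgP; apply: cv => [k|k x _]; last by rewrite lee_fin.
  by apply/measurable_EFinP; exact: measurable_funS mh.
apply: nearW => k; rewrite leNgt; apply/negP => hk; apply: nM.
by exists k.+1%:R.
Qed.

Section main.
Context {R : realType} {n m : nat}.
Local Notation E := 'Eucl_(n, R).
Local Notation mu := (leb R n).
Variables (alpha : R) (p_ : 'I_m -> E -> R) (q : E -> R) (w : 'I_m -> E -> \bar R).
Variables (D : set E) (x0 : E) (plo phi qlo qhi : R).
Hypotheses (n0 : (0 < n)%N) (m0 : (0 < m)%N).
Hypothesis lh : forall i, log_holder (p_ i).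
Hypothesis p_gt0 : forall i x, 0 < p_ i x.
Hypothesis pq : forall x, (q x)^-1 = \sum_i (p_ i x)^-1 - alpha / n%:R.
Hypothesis alpha0m : 0 < alpha / n%:R < m%:R.
Hypotheses (mD : measurable D) (D0 : mu (~` D) = 0%E) (Dx0 : D x0).
Hypotheses (plo1 : 1 < plo) (qlo0 : 0 < qlo).
Hypotheses (mp_ : forall i, measurable_fun D (p_ i)) (mq_ : measurable_fun D q)
  (mw_ : forall i, measurable_fun D (w i)).
Hypotheses (pD : forall i x, D x -> plo <= p_ i x <= phi)
  (qD : forall x, D x -> qlo <= q x <= qhi)
  (wD : forall i x, D x -> (0 < w i x < +oo)%E).

Let pi x : E := if x \in D then x else x0.
Let P i x := p_ i (pi x).
Let Qe x := q (pi x).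
Let wr i x := fine (w i (pi x)).
Let W x := \prod_i wr i x.
Let beta : R := m%:R - alpha / n%:R.
Let V (k : int) : R := side k ^+ n.
Let r (j : option 'I_m) x := if j is Some i then P i x / (P i x - 1) else Qe x.
Let g (j : option 'I_m) x := if j is Some i then (wr i x)^-1 else W x.

Let nR : 0 < n%:R :> R. Proof. by rewrite ltr0n. Qed.
Let beta0 : 0 < beta. Proof. by rewrite subr_gt0; case/andP: alpha0m. Qed.
Let piD x : D (pi x). Proof. by rewrite /pi; case: ifPn => //; rewrite inE. Qed.
Let piE x : D x -> pi x = x. Proof. by move=> Dx; rewrite /pi mem_set. Qed.
Let mP i : measurable_fun setT (P i). Proof. exact: measurable_fun_retract. Qed.
Let mQe : measurable_fun setT Qe. Proof. exact: measurable_fun_retract. Qed.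
Let mwr i : measurable_fun setT (wr i).
Proof.
have h : measurable_fun setT (fun x => w i (pi x)) by exact: measurable_fun_retract.
by apply: measurableT_comp => //; exact: measurable_fine.
Qed.
Let wrE i x : w i (pi x) = (wr i x)%:E.
Proof.
rewrite /wr fineK//; have /andP[h1 h2] := wD i (piD x).
by rewrite ge0_fin_numE// ltW. Qed.
Let wr0 i x : 0 < wr i x.
Proof. by rewrite -lte_fin -wrE; case/andP: (wD i (piD x)). Qed.
Let W0 x : 0 < W x. Proof. exact: prodr_gt0. Qed.
Let mW : measurable_fun setT W. Proof. by apply: measurable_prod => i _. Qed.
Let plop i x : plo <= P i x. Proof. by case/andP: (pD i (piD x)). Qed.
Let qloq x : qlo <= Qe x. Proof. by case/andP: (qD (piD x)). Qed.
Let qqhi x : Qe x <= qhi. Proof. by case/andP: (qD (piD x)). Qed.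
Let P1 i x : 1 < P i x. Proof. exact: lt_le_trans plo1 (plop i x). Qed.
Let weight_prodE x : weight_prod w (pi x) = (W x)%:E.
Proof. by rewrite /weight_prod -prodEFin; apply: eq_bigr => i _; exact: wrE. Qed.

Let g0 j x : 0 < g j x. Proof. by case: j => [i|] //=; rewrite invr_gt0. Qed.
Let mg j : measurable_fun setT (g j).
Proof.
case: j => [i|] //=; by apply: measurable_funV_pos => // x; exact: ltW.
Qed.
Let mr j : measurable_fun setT (r j).
Proof.
case: j => [i|] //=; apply: measurable_funM => //.
apply: measurable_funV_pos; first by move=> x; rewrite subr_ge0 ltW.
exact: measurable_funB.
Qed.
Let rlo0 : 0 < Num.min qlo 1. Proof. by rewrite lt_min qlo0 ltr01. Qed.
Let rlor j x : Num.min qlo 1 <= r j x.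
Proof.
case: j => [i|] /=; rewrite ge_min ?qloq//.
by apply/orP; right; rewrite ler_pdivlMr ?mul1r ?subr_gt0// gerBl.
Qed.
Let r0 j x : 0 < r j x. Proof. exact: lt_le_trans rlo0 (rlor j x). Qed.

Let mB x s : measurable (D `&` eucl_ball x s).
Proof. by apply: measurableI => //; exact: measurable_eucl_ball. Qed.

Let leb_ball x (s : R) : 0 < s -> exists2 b : R, mu (eucl_ball x s) = b%:E &
  0 < b /\ b <= (2 * s) ^+ n.
Proof.
move=> s0; have := leb_ball_le x s0; have := leb_ball_ge n0 x s0.
case: (mu _) => [b| |]//; rewrite !lee_fin => h1 h2; exists b => //; split=> //.
by apply: lt_le_trans h1; rewrite exprn_gt0// divr_gt0// mulr_gt0.
Qed.

Let lnorm_ball_gt0 j x (s : R) : 0 < s -> (0 < lnorm mu (r j) (g j) (D `&` eucl_ball x s))%E.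
Proof.
move=> s0; apply: (lnorm_gt0 (mr j) (mg j) rlo0 (rlor j) (g0 j) (mB x s)).
have h : (0 < mu (D `&` eucl_ball x s))%E; last exact: h.
rewrite (leb_setID mD D0); last exact: measurable_eucl_ball.
by have [b -> [b0 _]] := leb_ball x s0; rewrite lte_fin.
Qed.

Let Apq_term x (s b : R) : 0 < s -> mu (eucl_ball x s) = b%:E -> 
  (mu (eucl_ball x s) `^ (alpha / n%:R - m%:R)
      * var_norm q (fun y => weight_prod w y * (\1_(eucl_ball x s) y)%:E)
      * \prod_(i < m) var_norm (conj_exponent (p_ i))
          (fun y => (w i y)^-1 * (\1_(eucl_ball x s) y)%:E) =
  (b `^ (- beta))%:E * \prod_j lnorm mu (r j) (g j) (D `&` eucl_ball x s))%E.
Proof.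
move=> s0 ->; rewrite poweR_EFin big_option muleA opprB; congr (_ * _ * _)%E.
  apply: (var_norm_lnorm (q := r None) (g := g None)) => //.
  - by move=> y Dy; rewrite /= /Qe piE.
  - by move=> y Dy; rewrite -weight_prodE piE.
  - by move=> y; exact: ltW.
apply: eq_bigr => i _.
apply: (var_norm_lnorm (q := r (Some i)) (g := g (Some i))) => //.
- by move=> y Dy; rewrite /= /P piE.
- by move=> y Dy; rewrite -[y in LHS]piE// wrE inver gt_eqF.
- by move=> y; exact: ltW.
Qed.

(** * Sufficiency of the weight condition *)

Section sufficiency.
Hypothesis hA : Apq alpha p_ q w.

Let core : exists2 C : R, 0 < C & forall F : 'I_m -> E -> R,
  (forall i, measurable_fun setT (F i)) -> (forall i x, 0 <= F i x) ->
  (forall i, \int[mu]_(x in D) (F i x `^ P i x)%:E <= 1)%E ->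
  (forall i a, (\int[mu]_(x in cell D cl a) (F i x * (wr i x)^-1)%:E < +oo)%E) /\
  (\int[mu]_(x in D) (((W x)%:E * \esum_(k in [set: int])
      ((V k `^ beta)^-1 * \prod_i \sum_s
        fine (\int[mu]_(y in cell D cl (k, shift_index s (cl k x)))
          (F i y * (wr i y)^-1)%:E))%:E) `^ Qe x)
   <= C%:E)%E.
Proof.
have V0 k : 0 < V k by rewrite exprn_gt0// side_gt0.
pose rad (a : int * n.-tuple int) := 3 * n%:R * side a.1 : R.
have rad0 a : 0 < rad a by rewrite !mulr_gt0// side_gt0.
pose L a j := lnorm mu (r j) (g j) (big_ball D a).
have L0 a j : (0 < L a j)%E by exact: (lnorm_ball_gt0 j (corner a) (rad0 a)).
have [K0 K01 hK0] : exists2 K0 : R, 1 <= K0 & (Apq_const alpha p_ q w <= K0%:E)%E.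
  move: hA; rewrite /Apq; case: (Apq_const _ _ _ _) => [c| |]//.
  - by exists (Num.max 1 c); rewrite ?lee_fin le_max lexx ?orbT.
  - by exists 1; rewrite ?leNye.
(* A ball of radius $3n\,side$ lies in a cube of side $6n\,side$, so its measure is at most
   $(6n)^nV$. *)
have hL a : (\prod_j L a j <= (K0 * ((6 * n%:R) ^+ n) `^ beta * V a.1 `^ beta)%:E)%E.
  have [b bE [b0 ble]] := leb_ball (corner a) (rad0 a).
  have bb0 : 0 < b `^ beta by rewrite powR_gt0.
  have : ((b `^ (- beta))%:E * \prod_j L a j <= K0%:E)%E.
    apply: le_trans hK0; rewrite -(Apq_term (rad0 a) bE).
    by apply: ereal_sup_ubound; exists (corner a), (rad a).
  rewrite powRN muleC lee_pdivrMr// => h.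
  apply: le_trans h _; rewrite -EFinM lee_fin -mulrA ler_pM2l; last exact: lt_le_trans K01.
  have c6 : 0 <= (6 * n%:R) ^+ n :> R by rewrite exprn_ge0// mulr_ge0.
  rewrite -(powRM _ c6 (ltW (V0 _))).
  rewrite (ge0_ler_powR (ltW beta0)) ?nnegrE ?(ltW b0) ?mulr_ge0 ?(ltW (V0 _))//.
  apply: le_trans ble _; rewrite /V -exprMn /rad.
  by rewrite (_ : 2 * (3 * n%:R * side a.1) = 6 * n%:R * side a.1)//; ring.
(* All the norms are positive, so a finite product forces each of them to be finite. *)
have Lfin a j : L a j \is a fin_num.
  rewrite ge0_fin_numE ?(ltW (L0 a j))//; apply: (prode_gt0_lty (L0 a)).
  by apply: le_lt_trans (hL a) _; rewrite ltry.
pose K := Num.max 1 (K0 * ((6 * n%:R) ^+ n) `^ beta).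
apply: (@sum_cells_bounded _ _ _ mu D _ cl mD (measurable_cell mD) _ _ shift_index
  unshift_index shift_indexK unshift_indexK (big_ball D) V 2^-1 _ _ _ V0 _ _ _
  m (alpha / n%:R) P Qe wr plo qlo qhi m0 mP mQe mwr plo1 plop qlo0 qloq qqhi wr0
  alpha0m _ K (fun a j => fine (L a j))).
- move=> a; have h : (0 < mu (cell D cl a))%E by rewrite (leb_cell mD D0) lte_fin V0.
  exact: h.
- by move=> a; exact: mB.
- move=> a x [Dx xa]; split=> //; apply: (corner_near_ball n0); left; exact: xa.
- move=> a s x [Dx xa]; split=> //; apply: (corner_near_ball n0); right; exists s; exact: xa.
- by rewrite invr_gt0 ltr0n/= invf_le1// ler1n.
- by move=> k x Dx y [Dy hy]; split => //; exact: (cell_nested hy).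
- by move=> k x Dx; have h := cell_thick mD D0 n0 k Dx; exact: h.
- by move=> x; exact: pq.
- by rewrite le_max lexx.
- by move=> a j; rewrite fine_gt0// L0 -ge0_fin_numE ?Lfin// ltW.
- by move=> a j; rewrite fineK.
- move=> a; rewrite -lee_fin -prodEFin (eq_bigr (L a)); last by move=> j _; rewrite fineK.
  apply: le_trans (hL a) _; rewrite lee_fin ler_wpM2r ?powR_ge0//.
  by rewrite /K le_max lexx orbT.
- move=> dl dl0; have [|k0 [S [rho [h1 h2]]]] := log_holder_reference n0 (D := D) lh _ dl0.
    by move=> i x Dx; apply: le_trans (ltW plo1) _; case/andP: (pD i Dx).
  exists k0, S, rho; split=> // i a x hx.
  have Dx : D x by case: hx => [[]//|[s []]].
  by rewrite /P piE//; exact: h2.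
- by apply/card_gt0P; exists [tuple ord0 | i < n].
Qed.

Let S (h : 'I_m -> E -> R) (x : E) : \bar R := (\esum_(k in [set: int])
  ((V k `^ beta)^-1 * \prod_i \sum_s
     fine (\int[mu]_(y in cell D cl (k, shift_index s (cl k x))) (h i y)%:E))%:E)%E.

Let S_ge0 h x : (forall i y, 0 <= h i y) -> (0 <= S h x)%E.
Proof.
move=> h0; apply: esum_ge0 => k _; rewrite lee_fin mulr_ge0 ?invr_ge0 ?powR_ge0//.
apply: prodr_ge0 => i _; apply: sumr_ge0 => s _; apply: fine_ge0.
by apply: integral_ge0 => y _; rewrite lee_fin.
Qed.

(** After division by numbers [l i] slightly above the norms, the functions $|f_i|\omega_i/l_i$ have
    modular at most $1$, and [core] bounds the modular of $\omega S$. Homogeneity of [S] restores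
    the product of the [l i]. *)
Lemma bounded_of_domination (T : ('I_m -> E -> R) -> E -> \bar R) (C1 : R) :
  0 < C1 ->
  (forall (f h : 'I_m -> E -> R) (D3 : set E), measurable D3 -> mu (~` D3) = 0%E ->
    (forall i, measurable_fun setT (h i)) -> (forall i y, 0 <= h i y) ->
    (forall i y, ~ D y -> h i y = 0) ->
    (forall i y, D3 y -> `|f i y| = h i y) ->
    (forall i a, \int[mu]_(y in cell D cl a) (h i y)%:E < +oo)%E ->
    forall x, (`|T f x| <= C1%:E * S h x)%E) ->
  bounded_mop T p_ w q (weight_prod w).
Proof.
move=> C10 hT; have [C C0 hC] := core.
(* Division by [La >= 1] divides the modular by at least $La^{qlo}\ge C$, which turns the modular
   bound into a norm bound. *)
pose La : R := Num.max 1 (C `^ qlo^-1).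
have La1 : 1 <= La by rewrite le_max lexx.
have La0 : 0 < La by exact: lt_le_trans La1.
have LaC : C <= La `^ qlo.
  apply: (@le_trans _ _ ((C `^ qlo^-1) `^ qlo)).
    by rewrite -powRrM mulVf ?gt_eqF// powRr1// ltW.
  rewrite (ge0_ler_powR (ltW qlo0)) ?nnegrE ?powR_ge0 ?(ltW La0)//.
  by rewrite le_max lexx orbT.
exists (La * C1) => f hf.
pose N i := wvar_norm (p_ i) (w i) (EFin \o f i).
have N0 i : (0 <= N i)%E by exact: var_norm_ge0.
have Nfin i : N i \is a fin_num by rewrite ge0_fin_numE//; case: (hf i).
pose a i := fine (N i); have a0 i : 0 <= a i by exact: fine_ge0.
have Na i : N i = (a i)%:E by rewrite fineK.
rewrite (eq_bigr (fun i => (a i)%:E)); last by move=> i _; exact: Na.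
rewrite prodEFin -EFinM.
have [M M0 hM] := prod_addr_le a0.
suff main e : 0 < e <= 1 ->
    (wvar_norm q (weight_prod w) (T f) <= (La * C1 * \prod_i (a i + e))%:E)%E.
  apply/lee_addgt0Pr => e e0.
  have c0 : 0 < La * C1 * M + 1 by rewrite ltr_wpDl// !mulr_ge0// ltW.
  pose e' := Num.min 1 (e / (La * C1 * M + 1)).
  have e'0 : 0 < e' by rewrite lt_min ltr01 divr_gt0.
  have e'1 : e' <= 1 by rewrite ge_min lexx.
  have e'e : e' * (La * C1 * M + 1) <= e by rewrite -ler_pdivlMr// ge_min lexx orbT.
  apply: le_trans (main e' _) _; first by rewrite e'0.
  rewrite -EFinD lee_fin.
  apply: (@le_trans _ _ (La * C1 * (\prod_i a i + e' * M))).
    by apply: ler_wpM2l; [rewrite mulr_ge0// ltW|apply: hM; rewrite e'1 ltW].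
  by rewrite mulrDr lerD2l mulrCA; nra.
move=> /andP[e0 e1].
pose l i := a i + e; have l0 i : 0 < l i by rewrite ltr_wpDl.
have Nl i : (N i < (l i)%:E)%E by rewrite Na lte_fin ltrDl.
have /choice[Z hZ] i : exists Z, [/\ measurable Z, mu Z = 0%E & measurable_fun (~` Z) (f i)].
  by apply: leb_measurable_fun_real; case: (hf i).
have [Z' [mZ' Z'0 ZZ']] : mu.-negligible (\bigcup_i Z i).
  by apply: negligible_bigcup_ord => i; case: (hZ i) => mZ Zi0 _; exact: null_negligible.
(* The functions [f i] are Borel only off a null set that depends on them; it is removed as well,
   and [h] is [0] there. *)
pose D3 := D `\` Z'.
have mD3 : measurable D3 by exact: measurableD.
have D30 : mu (~` D3) = 0%E.
  have [A [mA A0 hA']] : mu.-negligible (~` D `|` Z').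
    by apply: negligibleU; apply: null_negligible => //; exact: measurableC.
  apply/eqP; rewrite eq_le measure_ge0 andbT -A0; apply: le_measure; rewrite ?inE//.
    exact: measurableC.
  move=> y /= ny; apply: hA'; have [Dy|] := pselect (D y); last by left.
  by right; apply: contrapT => nZ; apply: ny.
have D3D : D3 `<=` D by move=> y [].
pose h i y := if y \in D3 then `|f i y| else 0.
have mh i : measurable_fun setT (h i).
  rewrite -(setUv D3); apply/measurable_funU => //; first exact: measurableC.
  split.
    apply: (eq_measurable_fun (fun y => `|f i y|)); first by move=> y yD; rewrite /h yD.
    apply: measurableT_comp => //; case: (hZ i) => mZ _ mf.
    apply: measurable_funS mf; first exact: measurableC.
    by move=> y [_ nZ] Zy; apply: nZ; apply: ZZ'; exists i.
  apply: (eq_measurable_fun (fun=> 0 : R)) => // y; rewrite inE => /= nD.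
  by rewrite /h memNset.
have h0 i y : 0 <= h i y by rewrite /h; case: ifP.
have hD i y : ~ D y -> h i y = 0.
  by move=> nD; rewrite /h memNset// => /D3D.
have fh i y : D3 y -> `|f i y| = h i y by move=> Dy; rewrite /h mem_set.
pose F i y := h i y * wr i y / l i.
have F0 i y : 0 <= F i y by rewrite !mulr_ge0 ?invr_ge0// ltW.
have mF i : measurable_fun setT (F i) by apply: measurable_funM => //; exact: measurable_funM.
have IF i : (\int[mu]_(x in D) (F i x `^ P i x)%:E <= 1)%E.
  rewrite (integral_conull_in mD3 D30); last by move=> x _; rewrite lee_fin powR_ge0.
  rewrite setIidl//.
  have pP x : D3 x -> p_ i x = P i x by move=> /D3D Dx; rewrite /P piE.
  have wf x : D3 x -> (w i x * (EFin \o f i) x)%E = (wr i x * f i x)%:E.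
    by move=> /D3D Dx; rewrite -[x in w i x]piE// wrE.
  have := modular_var_norm_lt (p_gt0 i) (l0 i) (Nl i).
  rewrite (var_modular mD3 D30 (l0 i) pP wf).
  apply: le_trans; rewrite le_eqVlt; apply/orP; left; apply/eqP.
  apply: eq_integral => x; rewrite inE => D3x; rewrite normrM fh// gtr0_norm//.
  by rewrite /F [wr i x * _]mulrC.
have [cfin hW] := hC F mF F0 IF.
have Fh i y : F i y * (wr i y)^-1 = (l i)^-1 * h i y.
  by rewrite /F; field; rewrite !gt_eqF.
have intF i A : (\int[mu]_(y in A) (F i y * (wr i y)^-1)%:E =
    ((l i)^-1)%:E * \int[mu]_(y in A) (h i y)%:E)%E.
  rewrite -integralZl_ge0 ?invr_gt0//; last by move=> y _; rewrite lee_fin.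
  by apply: eq_integral => y _; rewrite Fh EFinM.
have hfin i b : (\int[mu]_(y in cell D cl b) (h i y)%:E < +oo)%E.
  have := cfin i b; rewrite intF.
  have : (0 <= \int[mu]_(y in cell D cl b) (h i y)%:E)%E.
    by apply: integral_ge0 => y _; rewrite lee_fin.
  move: (\int[mu]_(y in cell D cl b) (h i y)%:E)%E => [z _ _|_|]//; first exact: ltry.
  by rewrite mulry gtr0_sg ?invr_gt0// mul1e.
have Lp : 0 < \prod_i l i by exact: prodr_gt0.
pose SS := S (fun i y => F i y * (wr i y)^-1).
have SF x : S h x = ((\prod_i l i)%:E * SS x)%E.
  rewrite /SS /S -esumZ ?(ltW Lp)//; last first.
    move=> k; rewrite lee_fin mulr_ge0 ?invr_ge0 ?powR_ge0//.
    apply: prodr_ge0 => i _; apply: sumr_ge0 => s _; apply: fine_ge0.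
    by apply: integral_ge0 => y _; rewrite lee_fin Fh mulr_ge0// invr_ge0 ltW.
  apply: eq_esum => k _; rewrite -EFinM mulrCA; congr (_ * _)%:E.
  rewrite -big_split; apply: eq_bigr => i _ /=; rewrite mulr_sumr; apply: eq_bigr => s _.
  rewrite intF fineM//; first by rewrite mulrA divff ?mul1r ?gt_eqF.
  by rewrite ge0_fin_numE//; apply: integral_ge0 => y _; rewrite lee_fin.
have dom := hT f h D3 mD3 D30 mh h0 hD fh hfin.
have c0 : 0 < La * C1 * \prod_i l i by rewrite !mulr_gt0.
apply: var_norm_le => //.
rewrite (integral_conull mD D0); last by move=> x; exact: poweR_ge0.
apply: (@le_trans _ _ (\int[mu]_(x in D)
   ((La `^ (- qlo))%:E * ((W x)%:E * SS x) `^ Qe x))%E).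
  apply: le_integral_ge0 => x Dx; first exact: poweR_ge0.
  have SS0 : (0 <= SS x)%E.
    by apply: S_ge0 => i y; rewrite Fh mulr_ge0// invr_ge0 ltW.
  have -> : q x = Qe x by rewrite /Qe piE.
  have Q0 : 0 < Qe x by exact: lt_le_trans (qloq x).
  apply: (@le_trans _ _ ((La^-1%:E * ((W x)%:E * SS x)) `^ Qe x)%E).
    apply: gt0_ler_poweR; rewrite ?(ltW Q0)// ?in_itv/= ?leey ?andbT.
    - by rewrite mule_ge0// inver gt_eqF// lee_fin invr_ge0 ltW.
    - by rewrite !mule_ge0// lee_fin ?invr_ge0 ltW.
    - rewrite abseM -[x in weight_prod w x]piE// weight_prodE gee0_abs ?lee_fin ?(ltW (W0 x))//.
      rewrite inver gt_eqF// lee_pdivrMr//.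
      apply: (@le_trans _ _ ((W x)%:E * (C1%:E * S h x))%E).
        by rewrite lee_wpmul2l// lee_fin ltW.
      rewrite SF [leRHS]muleC !muleA -!EFinM.
      rewrite (_ : La * C1 * \prod_i l i * La^-1 * W x = W x * C1 * \prod_i l i)//.
      by field; rewrite gt_eqF.
  rewrite poweRM ?mule_ge0 ?lee_fin ?invr_ge0 ?(ltW La0) ?(ltW (W0 x))//.
  rewrite poweR_EFin lee_wpmul2r ?poweR_ge0// lee_fin powRV ?(ltW La0)// powRN.
  by rewrite lef_pV2 ?posrE ?powR_gt0// ler_powR.
rewrite integralZl_ge0 ?powR_gt0//; last by move=> x _; exact: poweR_ge0.
apply: (@le_trans _ _ ((La `^ (- qlo))%:E * C%:E)%E).
  by rewrite lee_wpmul2l ?lee_fin ?powR_ge0.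
by rewrite -EFinM lee_fin powRN mulrC ler_pdivrMr ?powR_gt0// mul1r.
Qed.

Lemma frac_max_bounded : bounded_mop (frac_max alpha) p_ w q (weight_prod w).
Proof.
have alm : alpha / n%:R < m%:R by case/andP: alpha0m.
apply: (@bounded_of_domination _ ((n%:R ^+ n) `^ beta)).
  by rewrite powR_gt0// exprn_gt0.
move=> f h D3 mD3 D30 mh h0 hD fh hfin x.
have max0 : (0 <= frac_max alpha f x)%E.
  apply: (@le_trans _ _ ((mu (eucl_ball x 1) `^ (m%:R - alpha / n%:R))^-1
      * \prod_(i < m) \int[mu]_(y in eucl_ball x 1) `|f i y|%:E)%E).
    rewrite mule_ge0//; first by rewrite inve_ge0 poweR_ge0.
    by apply: prode_ge0 => i _; apply: integral_ge0 => y _; rewrite lee_fin.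
  by apply: ereal_sup_ubound; exists 1; split.
rewrite gee0_abs//.
exact: (frac_max_dominated n0 alm mD mD3 D30 mh h0 hD fh hfin).
Qed.

Lemma frac_int_bounded : bounded_mop (frac_int alpha) p_ w q (weight_prod w).
Proof.
have alm : alpha / n%:R < m%:R by case/andP: alpha0m.
apply: (@bounded_of_domination _ (2 * 2 `^ (n%:R * beta))).
  by rewrite mulr_gt0// powR_gt0.
move=> f h D3 mD3 D30 mh h0 hD fh hfin x.
exact: (frac_int_dominated n0 alm mD mD3 D30 mh h0 hD fh hfin).
Qed.

End sufficiency.

(** * Necessity of the weight condition *)

Section necessity.

(* For [u = 1 / (w_i l)] on a set where it is bounded, the function
   [u ^ (p_i' - 1) / w_i] nearly attains the dual norm of [1 / w_i]. *)
Let near_extremal i (l : R) z s : 0 < s -> 0 < l ->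
  (l%:E < lnorm mu (r (Some i)) (g (Some i)) (D `&` eucl_ball z s))%E ->
  exists (f : E -> R) (J : R),
    [/\ 0 < J, measurable_fun setT f,
        forall y, 0 <= f y /\ (~ (D `&` eucl_ball z s) y -> f y = 0),
        (wvar_norm (p_ i) (w i) (EFin \o f) <= J%:E)%E &
        (\int[mu]_y (f y)%:E = (l * J)%:E)%E].
Proof.
move=> s0 l0 lL; set B := D `&` eucl_ball z s in lL *.
have mBB : measurable B by exact: mB.
pose u x := g (Some i) x / l; pose h x := u x `^ r (Some i) x.
have u0 x : 0 < u x by rewrite divr_gt0.
have mu_ : measurable_fun setT u by apply: measurable_funM.
have mh : measurable_fun setT h by apply: measurable_fun_powR2 => // x; exact: u0.
have h0 x : 0 <= h x by exact: powR_ge0.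
have h1 : (1 < \int[mu]_(x in B) (h x)%:E)%E.
  by rewrite ltNge; apply: contraTN lL => hle; rewrite -leNgt lnorm_le.
have [M M0 hM] := truncated_integral_gt1 mBB mu_ mh h0 h1.
set A := B `&` _ in hM.
have mA : measurable A.
  by apply: measurableI => //; rewrite -[X in measurable X]setTI; exact: measurable_fun_le.
have rle x : r (Some i) x <= plo / (plo - 1).
  rewrite /= ler_pdivlMr ?subr_gt0// mulrAC ler_pdivrMr ?subr_gt0//.
  by have := plop i x; nra.
have r1 x : 1 < r (Some i) x by rewrite /= ltr_pdivlMr ?subr_gt0// mul1r gtrBl.
have Ifin : (\int[mu]_(x in A) (h x)%:E < +oo)%E.
  apply: (@le_lt_trans _ _ (\int[mu]_(x in A) (cst (Num.max 1 M `^ (plo / (plo - 1)))%:E x))%E).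
    apply: le_integral_ge0 => x; first by rewrite lee_fin.
    move=> [_ /= uM]; rewrite lee_fin; apply: (@le_trans _ _ (Num.max 1 M `^ r (Some i) x)).
      rewrite ge0_ler_powR ?nnegrE ?(ltW (r0 _ _)) ?(ltW (u0 _))// ?le_max ?ler01//.
      by rewrite uM orbT.
    by apply: ler_powR => //; rewrite le_max lexx.
  rewrite integral_cst// lte_mul_pinfty ?lee_fin ?powR_ge0//.
  have [b bE _] := leb_ball z s0.
  apply: (@le_lt_trans _ _ (mu (eucl_ball z s))); last by rewrite bE ltry.
  apply: le_measure; rewrite ?inE//; first exact: measurable_eucl_ball.
  by move=> x [[]].
have [J JE J1] : exists2 J : R, (\int[mu]_(x in A) (h x)%:E = J%:E)%E & 1 < J.
  move: hM Ifin; case: (\int[mu]_(x in A) (h x)%:E)%E => [J| |]//.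
  by rewrite lte_fin => J1 _; exists J.
have J0 : 0 < J by exact: lt_trans J1.
pose f x := if x \in A then u x `^ (r (Some i) x - 1) / wr i x else 0.
have hu x : u x `^ (r (Some i) x - 1) * u x = h x.
  by rewrite /h -{2}[u x]powRr1 ?(ltW (u0 x))// -powRD ?subrK// gt_eqF ?implybT.
have fu x : A x -> f x = l * h x.
  move=> Ax; rewrite /f mem_set// -hu /u /g /=; field.
  by rewrite !gt_eqF.
exists f, J; split => //.
- rewrite -(setUv A); apply/measurable_funU => //; first exact: measurableC.
  split.
    apply: (eq_measurable_fun (fun x => l * h x)).
      by move=> x; rewrite inE => Ax; rewrite fu.
    by apply: measurable_funM => //; exact: measurable_funS mh.
  apply: (eq_measurable_fun (fun=> 0 : R)) => // y; rewrite inE => /= nA.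
  by rewrite /f memNset.
- move=> y; split.
    by rewrite /f; case: ifP => // _; rewrite mulr_ge0 ?powR_ge0// invr_ge0 ltW.
  by move=> nB; rewrite /f memNset// => -[].
- apply: var_norm_le => //.
  rewrite (var_modular mD D0 J0 (q := P i) (F := fun x => wr i x * f x)); last 2 first.
  + by move=> x Dx; rewrite /P piE.
  + by move=> x Dx; rewrite -[x in w i x]piE// wrE.
  apply: (@le_trans _ _ ((J^-1)%:E * \int[mu]_(x in A) (h x)%:E)%E); last first.
    by rewrite JE -EFinM mulVf ?gt_eqF.
  rewrite -integralZl_ge0 ?invr_gt0//; last by move=> x _; rewrite lee_fin.
  rewrite [leLHS]integral_mkcond [leRHS]integral_mkcond; apply: le_integral_ge0 => x _.
    by rewrite /patch; case: ifP => // _; rewrite lee_fin powR_ge0.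
  rewrite /patch; have [xA|xA] := boolP (x \in A); last first.
    case: ifP => // _; rewrite /f (negbTE xA) mulr0 normr0 mul0r powR0//.
    by rewrite gt_eqF// (lt_trans ltr01).
  have Ax : A x by rewrite inE in xA.
  rewrite ifT; last by rewrite inE; case: Ax => -[].
  rewrite -EFinM lee_fin /f xA mulrCA divff ?gt_eqF// mulr1.
  rewrite ger0_norm ?powR_ge0// powRM ?powR_ge0 ?invr_ge0 ?(ltW J0)// -powRrM.
  have -> : (r (Some i) x - 1) * P i x = r (Some i) x.
    by rewrite /=; field; rewrite gt_eqF// subr_gt0.
  rewrite -/(h x) mulrC ler_wpM2r// powRV ?(ltW J0)// lef_pV2 ?posrE ?powR_gt0//.
  by rewrite -[leLHS]powRr1 ?(ltW J0)//; apply: ler_powR; exact: ltW.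
- rewrite EFinM -JE -integralZl_ge0//; last by move=> x _; rewrite lee_fin.
  rewrite [RHS]integral_mkcond; apply: eq_integral => x _.
  rewrite /patch; case: ifPn => xA; first by rewrite -EFinM fu//; rewrite inE in xA.
  by rewrite /f (negbTE xA).
Qed.

(** On the ball [T f] is at least the constant [k], so [k] times the norm of the product weight is
    at most the norm of [T f], hence at most [C'] times the product of the [J i]. This product
    cancels, leaving the $A_{\vec p,q}$ term with the [l i] in place of the dual norms. *)
Lemma Apq_of_bounded (T : ('I_m -> E -> R) -> E -> \bar R) (c : R) : 0 < c ->
  (forall (f : 'I_m -> E -> R) z (s b : R), 0 < s -> mu (eucl_ball z s) = b%:E ->
    (forall i, measurable_fun setT (f i)) ->
    (forall i y, 0 <= f i y) -> (forall i y, ~ eucl_ball z s y -> f i y = 0) ->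
    forall x, eucl_ball z s x ->
      ((c * b `^ (- beta))%:E * \prod_i \int[mu]_y (f i y)%:E <= T f x)%E) ->
  bounded_mop T p_ w q (weight_prod w) -> Apq alpha p_ q w.
Proof.
move=> c0 hT [C hC]; pose C' : R := Num.max 0 C.
have C'0 : 0 <= C' by rewrite le_max lexx.
suff : (Apq_const alpha p_ q w <= (C' / c)%:E)%E by move=> h; apply: le_lt_trans h (ltry _).
apply: ge_ereal_sup => _ [z [s [s0 ->]]].
have [b bE [b0 _]] := leb_ball z s0.
rewrite (Apq_term s0 bE) big_option muleA.
set B := D `&` eucl_ball z s.
have bb : 0 < b `^ (- beta) by rewrite powR_gt0.
apply: prode_le_of_lt.
- by rewrite mule_gt0 ?lte_fin//; exact: lnorm_ball_gt0.
- by move=> i; exact: lnorm_ball_gt0.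
move=> l hl.
have /choice[fJ hfJ] i : exists fJ : (E -> R) * R,
    [/\ 0 < fJ.2, measurable_fun setT fJ.1,
        forall y, 0 <= fJ.1 y /\ (~ B y -> fJ.1 y = 0),
        (wvar_norm (p_ i) (w i) (EFin \o fJ.1) <= (fJ.2)%:E)%E &
        (\int[mu]_y (fJ.1 y)%:E = (l i * fJ.2)%:E)%E].
  have [li0 li] := hl i.
  by have [f [J h]] := near_extremal s0 li0 li; exists (f, J).
pose f i := (fJ i).1; pose J i := (fJ i).2.
have J0 i : 0 < J i by case: (hfJ i).
have Jp : 0 < \prod_i J i by exact: prodr_gt0.
have lp : 0 < \prod_i l i by apply: prodr_gt0 => i _; case: (hl i).
pose k := c * b `^ (- beta) * \prod_i (l i * J i).
have kE : k = c * b `^ (- beta) * \prod_i l i * \prod_i J i by rewrite /k big_split/= mulrA.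
have k0 : 0 < k by rewrite kE !mulr_gt0.
have Tk x : B x -> (k%:E <= T f x)%E.
  move=> [_ Bx]; have := hT f z s b s0 bE _ _ _ x Bx.
  rewrite (eq_bigr (fun i => (l i * J i)%:E)); last by move=> i _; case: (hfJ i).
  rewrite prodEFin -EFinM; apply.
  - by move=> i; case: (hfJ i).
  - by move=> i y; case: (hfJ i) => _ _ /(_ y)[].
  - by move=> i y ny; case: (hfJ i) => _ _ /(_ y)[_ +] _ _; apply => -[].
have up : (wvar_norm q (weight_prod w) (T f) <= (C' * \prod_i J i)%:E)%E.
  apply: (@le_trans _ _ (C'%:E * \prod_i wvar_norm (p_ i) (w i) (EFin \o f i))%E).
    apply: le_trans (hC f _) _.
      move=> i; split; first by apply: Borel_leb_measurable; case: (hfJ i).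
      by case: (hfJ i) => _ _ _ h _; apply: le_lt_trans h (ltry _).
    rewrite lee_wpmul2r ?lee_fin ?le_max ?lexx ?orbT//.
    by apply: prode_ge0 => i _; exact: var_norm_ge0.
  rewrite EFinM lee_wpmul2l// -prodEFin; apply: lee_prod => i.
  by rewrite var_norm_ge0; case: (hfJ i).
have low : (k%:E * lnorm mu (r None) (g None) B <= wvar_norm q (weight_prod w) (T f))%E.
  apply: le_ereal_inf_tmp => _ [t [t0 ht] <-].
  rewrite muleC -lee_pdivlMr// -EFinM; apply: lnorm_le; first by rewrite divr_gt0.
  apply: le_trans ht; rewrite (integral_conull mD D0); last by move=> x; exact: poweR_ge0.
  rewrite /modular integral_mkcondr; apply: le_integral_ge0 => x Dx.
    by rewrite /patch; case: ifP => // _; rewrite lee_fin powR_ge0.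
  rewrite /patch; case: ifPn => [|_]; last exact: poweR_ge0.
  rewrite inE => Bx.
  have -> : q x = Qe x by rewrite /Qe piE.
  have Q0 : 0 < Qe x by exact: lt_le_trans (qloq x).
  have kT := Tk x (conj Dx Bx).
  rewrite -poweR_EFin; apply: gt0_ler_poweR; rewrite ?(ltW Q0)// ?in_itv/= ?leey ?andbT.
  - by rewrite lee_fin !divr_ge0// ltW.
  - by rewrite mule_ge0// inver gt_eqF// lee_fin invr_ge0 ltW.
  - rewrite abseM -[x in weight_prod w x]piE// weight_prodE gee0_abs ?lee_fin ?(ltW (W0 x))//.
    rewrite inver gt_eqF// lee_pdivlMr//.
    apply: (@le_trans _ _ ((W x)%:E * k%:E)%E).
      by rewrite -!EFinM lee_fin invfM invrK mulrA mulrAC divfK ?gt_eqF// mulrC.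
    rewrite lee_wpmul2l ?lee_fin ?(ltW (W0 x))//; apply: le_trans kT _; exact: lee_abs.
move: (le_trans low up); rewrite kE.
have := lnorm_ball_gt0 None z s0; rewrite -/B.
(* An infinite norm of the product weight would contradict the finite bound [up], as [k > 0]. *)
case: (lnorm _ _ _ _) => [L| |]//.
- rewrite !lte_fin -!EFinM !lee_fin => L0 h.
  rewrite ler_pdivlMr// -(ler_pM2r Jp); apply: le_trans h; rewrite le_eqVlt; apply/orP; left.
  by apply/eqP; ring.
- by rewrite mulry gtr0_sg ?mul1e -?kE.
Qed.

Let ball_dist (z : E) (s : R) (x y : E) : eucl_ball z s x -> eucl_ball z s y ->
  eucl_dist x y <= n%:R * (2 * s).
Proof.
move=> hx hy; apply: eucl_dist_le_max => i.
have := le_lt_trans (eucl_dist_ge z x i) hx.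
have := le_lt_trans (eucl_dist_ge z y i) hy.
by rewrite !ltr_norml ler_norml; lra.
Qed.

Let ball_volume (z : E) (s b t : R) : 0 < s -> 0 < t -> mu (eucl_ball z s) = b%:E ->
  (t * (2 * s)) ^+ n <= (t * n%:R) ^+ n * b.
Proof.
move=> s0 t0 bE; have := leb_ball_ge n0 z s0; rewrite bE lee_fin => hb.
apply: le_trans (ler_wpM2l _ hb); last by rewrite exprn_ge0// mulr_ge0// ltW.
rewrite -exprMn (_ : t * n%:R * (2 * s / n%:R) = t * (2 * s))//.
by field; rewrite gt_eqF.
Qed.

Let integral_supp (f : E -> R) (A : set E) :
  (forall y, ~ A y -> f y = 0) ->
  (\int[mu]_y (f y)%:E = \int[mu]_(y in A) (f y)%:E)%E.
Proof.
move=> fA; rewrite [RHS]integral_mkcond; apply: eq_integral => y _.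
by rewrite /patch; case: ifPn => // /negP; rewrite inE => nA; rewrite fA.
Qed.

Lemma Apq_of_frac_max :
  bounded_mop (frac_max alpha) p_ w q (weight_prod w) -> Apq alpha p_ q w.
Proof.
have t0 : 0 < 3 * n%:R :> R by rewrite mulr_gt0.
have c0 : 0 < (3 * n%:R * n%:R) ^+ n :> R by rewrite exprn_gt0// mulr_gt0.
apply: (@Apq_of_bounded _ (((3 * n%:R * n%:R) ^+ n) `^ (- beta))).
  by rewrite powR_gt0.
move=> f z s b s0 bE mf f0 fB x Bx.
have b0 : 0 < b.
  by have [b' + [b'0 _]] := leb_ball z s0; rewrite bE => -[->].
(* Points of the ball are at most [2 n s] apart, so this radius around [x] covers it, strict
   inequality included. *)
pose rho := 3 * n%:R * s.
have rho0 : 0 < rho by rewrite mulr_gt0.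
have [b' b'E [b'0 b'le]] := leb_ball x rho0.
have BB : eucl_ball z s `<=` eucl_ball x rho.
  move=> y By; apply: le_lt_trans (ball_dist Bx By) _.
  by rewrite /rho mulrCA mulrA ltr_pM2r// ltr_pM2r// ltr_nat.
have b'b : b' <= (3 * n%:R * n%:R) ^+ n * b.
  apply: le_trans b'le _; apply: le_trans (ball_volume s0 t0 bE).
  by rewrite /rho mulrCA.
apply: (@le_trans _ _ ((mu (eucl_ball x rho) `^ (m%:R - alpha / n%:R))^-1
      * \prod_(i < m) \int[mu]_(y in eucl_ball x rho) `|f i y|%:E)%E); last first.
  by apply: ereal_sup_ubound; exists rho.
rewrite (eq_bigr (fun i => \int[mu]_(y in eucl_ball x rho) `|f i y|%:E)%E); last first.
  move=> i _; rewrite (@integral_supp _ (eucl_ball x rho)).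
    by apply: eq_integral => y _; rewrite ger0_norm.
  by move=> y nB; apply: fB => By; apply: nB; exact: BB.
rewrite lee_wpmul2r//.
  by apply: prode_ge0 => i _; apply: integral_ge0 => y _; rewrite lee_fin.
rewrite b'E poweR_EFin inver gt_eqF ?powR_gt0// lee_fin.
rewrite -(powRM _ (ltW c0) (ltW b0)) powRN.
have cb0 := mulr_gt0 c0 b0.
rewrite lef_pV2 ?posrE ?powR_gt0//.
by rewrite (ge0_ler_powR (ltW beta0)) ?nnegrE ?(ltW b'0) ?(ltW cb0).
Qed.

Lemma Apq_of_frac_int :
  bounded_mop (frac_int alpha) p_ w q (weight_prod w) -> Apq alpha p_ q w.
Proof.
have mR : 0 < m%:R :> R by rewrite ltr0n.
have t0 : 0 < m%:R * n%:R :> R by rewrite mulr_gt0.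
set t : R := m%:R * n%:R in t0.
have c0 : 0 < (t * n%:R) ^+ n :> R by rewrite exprn_gt0// mulr_gt0.
apply: (@Apq_of_bounded _ (((t * n%:R) ^+ n) `^ (- beta))).
  by rewrite powR_gt0.
move=> f z s b s0 bE mf f0 fB x Bx.
have b0 : 0 < b.
  by have [b' + [b'0 _]] := leb_ball z s0; rewrite bE => -[->].
set k := (_ * _ : R).
have gamE : m%:R * n%:R - alpha = n%:R * beta.
  by rewrite /beta mulrBr mulrCA divff ?gt_eqF// mulr1 mulrC.
have k0 : 0 <= k by rewrite mulr_ge0 ?powR_ge0.
(* Tuples with an entry equal to [x] form a null set. They are discarded because the kernel takes
   the value [0] where all distances vanish, which would spoil the lower bound. *)
pose A : set E := ~` [set x].
have [mx lebx] : measurable [set x] /\ mu [set x] = 0%E.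
  have -> : [set x] = [set y : E | forall i, [set co x i] (co y i)].
    apply/seteqP; split=> [y -> //|y /= h].
    by apply: eq_from_tnth => i; exact: h.
  have m1 i : measurable [set co x i] by exact: measurable_set1.
  split; first exact: (measurable_box m1).
  rewrite (leb_box m1).
  by rewrite (bigD1 (Ordinal n0))//= lebesgue_measure_set1 mul0e.
have mA : measurable A by exact: measurableC.
have A0 : mu (~` A) = 0%E by rewrite setCK.
have mAA := @measurable_tuple_all _ _ m _ mA.
have AA0 := @tuple_all_conull _ _ _ mu m _ mA A0.
have ff0 (y : m.-tuple E) : 0 <= \prod_(i < m) f i (tnth y i) by exact: prodr_ge0.
rewrite -(integral_tuple_prod mu mf f0) /frac_int gamE.
rewrite -ge0_integralZl_EFin//; last 2 first.
- by move=> y _; rewrite lee_fin.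
- apply/measurable_EFinP; apply: measurable_prod => i _.
  by apply: measurableT_comp => //; exact: measurable_tnth.
rewrite (integral_conull mAA AA0); last by move=> y; rewrite mule_ge0// lee_fin.
rewrite (integral_conull mAA AA0); last by move=> y; rewrite lee_fin divr_ge0 ?powR_ge0.
apply: le_integral_ge0 => y yA; first by rewrite mule_ge0// lee_fin.
rewrite -EFinM lee_fin mulrC.
have [yB|/existsNP[i yi]] := pselect (forall i, eucl_ball z s (tnth y i)); last first.
  by rewrite (bigD1 i)//= fB// !mul0r.
apply: ler_wpM2l => //.
set d := \sum_(i < m) _.
have d0 : 0 < d.
  rewrite /d (bigD1 (Ordinal m0))//= ltr_pwDl//; last first.
    by apply: sumr_ge0 => i _; exact: eucl_dist_ge0.
  rewrite lt_neqAle eucl_dist_ge0 andbT eq_sym; apply/eqP => h.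
  apply: (yA (Ordinal m0)); apply: eq_from_tnth => i.
  have := eucl_dist_ge x (tnth y (Ordinal m0)) i; rewrite h normr_le0 subr_eq0.
  by move=> /eqP; exact: esym.
have dle : d <= t * (2 * s).
  apply: (@le_trans _ _ (\sum_(i < m) n%:R * (2 * s))).
    by apply: ler_sum => i _; exact: ball_dist Bx (yB i).
  by rewrite sumr_const card_ord -[_ *+ m]mulr_natl /t mulrA.
have cb0 := mulr_gt0 c0 b0.
rewrite /k -(powRM _ (ltW c0) (ltW b0)) powRN lef_pV2 ?posrE ?powR_gt0//.
rewrite powRrM powR_mulrn ?(ltW d0)//.
rewrite (ge0_ler_powR (ltW beta0)) ?nnegrE ?exprn_ge0 ?(ltW d0) ?(ltW cb0)//.
apply: le_trans (ball_volume s0 t0 bE).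
by rewrite lerXn2r ?nnegrE ?(ltW d0)// mulr_ge0 ?(ltW t0)// mulr_ge0// ltW.
Qed.

End necessity.
End main.

Theorem theorem2p3 (R : realType) (n m : nat) (alpha : R)
    (p_ : 'I_m -> 'Eucl_(n, R) -> R) (p q : 'Eucl_(n, R) -> R)
    (w : 'I_m -> 'Eucl_(n, R) -> \bar R) :
  (0 < n)%N -> (0 < m)%N ->
  (forall i, log_holder (p_ i) /\ P_exponent (p_ i)) ->
  (forall x, (p x)^-1 = \sum_(i < m) (p_ i x)^-1) ->
  P0_exponent q ->
  (forall x, alpha / n%:R = (p x)^-1 - (q x)^-1) ->
  0 < alpha / n%:R < m%:R ->
  (forall i, weight (w i)) ->
  (bounded_mop (frac_max alpha) p_ w q (weight_prod w) <-> Apq alpha p_ q w) /\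
  (bounded_mop (frac_int alpha) p_ w q (weight_prod w) <-> Apq alpha p_ q w).
Proof.
move=> n0 m0 hp pE hq qE al hw.
have [D [plo [phi [qlo [qhi [[mD D0 plo1 qlo0] [[mp mq mw] [pD qD wD]]]]]]]] :=
  good_set (fun i => (hp i).2) hq hw.
(* A dyadic cell meets [D] in a set of positive measure. *)
have [x0 Dx0] : exists x0, D x0.
  apply: contrapT => /forallNP nD; have := leb_cell mD D0 (0, [tuple 0 | i < n]).
  rewrite (_ : cell D cl _ = set0) ?measure0; last by apply/seteqP; split=> [x [/nD]|].
  by move=> [] /eqP; rewrite eq_sym gt_eqF// exprn_gt0// side_gt0.
have lh i := (hp i).1.
have p0 i x : 0 < p_ i x by case: (hp i) => _ [].
have pq x : (q x)^-1 = \sum_i (p_ i x)^-1 - alpha / n%:R.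
  by rewrite (qE x) -(pE x) opprB addrC subrK.
split; split.
- exact: (Apq_of_frac_max n0 al mD D0 Dx0 plo1 qlo0 mp mq mw pD qD wD).
- exact: (frac_max_bounded n0 m0 lh p0 pq al mD D0 Dx0 plo1 qlo0 mp mq mw pD qD wD).
- exact: (Apq_of_frac_int n0 m0 al mD D0 Dx0 plo1 qlo0 mp mq mw pD qD wD).
- exact: (frac_int_bounded n0 m0 lh p0 pq al mD D0 Dx0 plo1 qlo0 mp mq mw pD qD wD).
Qed.
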